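(* For $\alpha>0$ let $\mathcal G_\alpha$ be the diagonal comb metric graph. Then: (1) For all $\alpha>\frac12$, $H^1(\mathcal G_\alpha)$ is compactly embedded in $L^2(\mathcal G_\alpha)$. In particular, the Neumann realisation $\mathcal H_{\mathrm N}$ of the Laplacian on $\mathcal G_\alpha$ has compact resolvent and purely discrete spectrum. (2) If $\alpha\in(0,\frac12]$, then there is an $L^2(\mathcal G_\alpha)$-orthonormal sequence of $H^1(\mathcal G_\alpha)$-functions with uniformly bounded $H^1(\mathcal G_\alpha)$-norm. In particular, $\mathcal H_{\mathrm N}$ has non-empty essential spectrum. (3) For all $\alpha>0$, if $\mathfrak V$ is the union of $\{0\}$ (the end of the graph) with the set of all tips of the teeth, then $H^1_0(\mathcal G_\alpha,\mathfrak V)$ is compactly embedded in $L^2(\mathcal G_\alpha)$. Consequently, $\mathcal H_{\mathfrak V}$ has compact resolvent and purely discrete spectrum.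
   Context: Diagonal comb $\mathcal G_\alpha$: take the interval $(0,1]$ (''horizontal shaft''), put a vertex at every point $n^{-\alpha}$, $n\in\mathbb N=\{1,2,\dots\}$, and attach to that vertex an edge (''tooth'') of length $n^{-\alpha}$. The free endpoint of a tooth is its tip. The point $0$ does not belong to the graph; it is its unique end. The graph carries the path metric and the sum of Lebesgue measures on its edges. $L^2(\mathcal G_\alpha)$ is the $L^2$-space of this measure. $H^1(\mathcal G_\alpha)$ is the space of continuous functions $f$ on $\mathcal G_\alpha$ that lie in $H^1$ of every edge, with $\|f\|_{H^1}^2=\sum_e(\|f_e\|_{L^2(e)}^2+\|f_e'\|_{L^2(e)}^2)<\infty$. Every such $f$ has a limit $f(0)$ as the end $0$ is approached. $H_0^1(\mathcal G_\alpha,\mathfrak V)$ is the subspace of those $f\in H^1(\mathcal G_\alpha)$ vanishing at all points of $\mathfrak V$. $\mathcal H_{\mathrm N}$ is the self-adjoint operator on $L^2(\mathcal G_\alpha)$ associated with the quadratic form $f\mapsto\int_{\mathcal G_\alpha}|f'|^2\,dx$ with domain $H^1(\mathcal G_\alpha)$; $\mathcal H_{\mathfrak V}$ is the one associated with the same expression with domain $H^1_0(\mathcal G_\alpha,\mathfrak V)$. *)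

(* Defs.v *)
From HB Require Import structures.
From mathcomp Require Import all_boot all_order all_algebra.
From mathcomp Require Import complex.
From mathcomp Require Import all_classical all_reals all_analysis measurable_realfun.

Set Implicit Arguments.
Unset Strict Implicit.
Unset Printing Implicit Defensive.

Import Order.TTheory GRing.Theory Num.Theory.
Import numFieldNormedType.Exports.
Import ComplexField.Normc.

Local Open Scope classical_set_scope.
Local Open Scope ring_scope.
Local Open Scope complex_scope.

(* An element of the complex space L^2(mu) is represented by a function       *)
(* T -> R[i]; two functions are the same element when they agree mu-a.e.,     *)
(* i.e. when the L2norm of their difference is 0.                             *)
Section ComplexL2.
Context d (T : measurableType d) (R : realType).
Variable mu : {measure set T -> \bar R}.
Implicit Types (f g : T -> R[i]).

Definition cintegral (D : set T) f : R[i] :=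
  (\int[mu]_(x in D) complex.Re (f x)) +i* (\int[mu]_(x in D) complex.Im (f x)).

Definition L2 : set (T -> R[i]) :=
  [set f | (fun x => complex.Re (f x)) \in Lfun mu 2%:E /\
           (fun x => complex.Im (f x)) \in Lfun mu 2%:E].

Definition L2dot f g : R[i] := cintegral setT (fun x => f x * conjc (g x)).

Definition L2norm f : R := Num.sqrt (\int[mu]_x normc (f x) ^+ 2).

Definition L2_orthonormal (f : nat -> T -> R[i]) :=
  forall m n, L2dot (f m) (f n) = (m == n)%:R.

Definition L2_cvg_subseq (f : nat -> T -> R[i]) :=
  exists2 s : nat -> nat, {homo s : i j / (i < j)%N} &
  exists2 g, L2 g &
    (fun k => L2norm (fun x => f (s k) x - g x)) @ \oo --> (0 : R).

Definition compactly_embedded (D : set (T -> R[i])) (Dnorm : (T -> R[i]) -> R) :=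
  D `<=` L2 /\
  forall f : nat -> T -> R[i], (forall n, D (f n)) ->
    (exists M, forall n, Dnorm (f n) <= M) -> L2_cvg_subseq f.

End ComplexL2.

(* A linear operator A in L^2(mu) is represented by its graph: A u w means    *)
(* that u is in the domain of A and that A u = w.                             *)
Section Operators.
Context d (T : measurableType d) (R : realType).
Variable mu : {measure set T -> \bar R}.
Local Notation F := (T -> R[i]).
Implicit Types (A : F -> F -> Prop) (l : R[i]).

(* the operator associated with the sesquilinear form a of domain D           *)
Definition form_operator (D : set F) (a : F -> F -> R[i]) (u w : F) :=
  [/\ D u, L2 mu w & forall v, D v -> a u v = L2dot mu w v].

(* (A - l) u = w *)
Definition resolvent A l (w u : F) := A u (fun x => l * u x + w x).

Definition resolvent_set A : set R[i] := [set l |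
  (forall w, L2 mu w -> exists u, resolvent A l w u) /\
  (exists M, forall w u, L2 mu w -> resolvent A l w u ->
     L2norm mu u <= M * L2norm mu w)].

Definition spectrum A : set R[i] := ~` resolvent_set A.

Definition compact_operator (K : F -> F -> Prop) :=
  forall w u : nat -> F, (forall n, L2 mu (w n)) -> (forall n, K (w n) (u n)) ->
    (exists M, forall n, L2norm mu (w n) <= M) -> L2_cvg_subseq mu u.

Definition compact_resolvent A :=
  resolvent_set A !=set0 /\
  forall l, resolvent_set A l -> compact_operator (resolvent A l).

Definition eigenfunction A l (u : F) := A u (fun x => l * u x).

Definition eigenvalue A l := exists2 u, eigenfunction A l u & L2norm mu u != 0.

Definition finite_multiplicity A l :=
  exists n (b : 'I_n -> F), (forall i, eigenfunction A l (b i)) /\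
    forall u, eigenfunction A l u ->
      exists c : 'I_n -> R[i], {ae mu, forall x, u x = \sum_(i < n) c i * b i x}.

Definition isolated_in (S : set R[i]) l :=
  S l /\ exists2 e : R, 0 < e & forall z, S z -> normc (z - l) < e -> z = l.

Definition discrete_spectrum A : set R[i] := [set l |
  [/\ isolated_in (spectrum A) l, eigenvalue A l & finite_multiplicity A l]].

Definition essential_spectrum A : set R[i] := spectrum A `\` discrete_spectrum A.

Definition purely_discrete_spectrum A := essential_spectrum A = set0.

End Operators.

(* The comb is realised in the plane: the shaft is (0, 1] x {0} and the teeth *)
(* are vertical segments. Functions on the comb are represented by functions  *)
(* on the plane, of which only the values on the comb matter.                 *)
Notation plane R := (measurableTypeR R * measurableTypeR R)%type.

Section DiagonalComb.
Variables (R : realType) (alpha : R).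
Implicit Types (p q : plane R) (f g : plane R -> R[i]).

(* n counts from 0 here, whence the shift n.+1 *)
Definition shaft_vertex (n : nat) : R := n.+1%:R `^ (- alpha).

Definition comb : set (plane R) := [set p |
  (0 < p.1 <= 1 /\ p.2 = 0) \/
  exists2 n, p.1 = shaft_vertex n & 0 <= p.2 <= shaft_vertex n].

Definition comb_end : plane R := (0, 0).

Definition tips : set (plane R) :=
  [set p | exists n, p = (shaft_vertex n, shaft_vertex n)].

(* The comb is a tree: a path between different teeth has to go down to the   *)
(* shaft, along it, and up again.                                             *)
Definition comb_dist p q : R :=
  if p.1 == q.1 then `|p.2 - q.2| else p.2 + `|p.1 - q.1| + q.2.

(* inl n is the part of the shaft between two consecutive vertices, inr n is  *)
(* the tooth attached to the vertex n.                                        *)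
Definition edge : Type := (nat + nat)%type.

Definition edge_length (e : edge) : R :=
  match e with
  | inl n => shaft_vertex n - shaft_vertex n.+1
  | inr n => shaft_vertex n
  end.

Definition edge_point (e : edge) (t : R) : plane R :=
  match e with
  | inl n => (shaft_vertex n.+1 + t, 0)
  | inr n => (shaft_vertex n, t)
  end.

Lemma measurable_edge_point e : measurable_fun setT (edge_point e).
Proof.
case: e => n; apply/measurable_fun_pairP; split.
- by apply: (@measurable_funD _ _ R setT (cst _) id).
- exact: (measurable_cst (0 : R)).
- exact: measurable_cst.
- exact: measurable_id.
Qed.

Section EdgeMeasure.
Variable e : edge.

Definition edge_measure : set (plane R) -> \bar R :=
  pushforward (mrestr lebesgue_measure (measurable_itv `[0, edge_length e]))
    (edge_point e).

Let edge_measurable := measurable_edge_point e.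

Let edge_measure0 : edge_measure set0 = 0%E.
Proof. exact: measure0. Qed.

Let edge_measure_ge0 A : (0 <= edge_measure A)%E.
Proof. exact: measure_ge0. Qed.

Let edge_measure_sigma_additive : semi_sigma_additive edge_measure.
Proof. exact: measure_semi_sigma_additive. Qed.

HB.instance Definition _ := isMeasure.Build _ _ _ edge_measure
  edge_measure0 edge_measure_ge0 edge_measure_sigma_additive.

End EdgeMeasure.

Definition comb_measure : {measure set (plane R) -> \bar R} :=
  mseries (fun n => measure_add (edge_measure (inl n)) (edge_measure (inr n))) 0.

Definition comb_continuous f := forall p, comb p -> forall e : R, 0 < e ->
  exists2 r : R, 0 < r &
    forall q, comb q -> comb_dist p q < r -> normc (f q - f p) < e.

(* On every edge f is absolutely continuous with derivative g, absolute       *)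
(* continuity meaning that f is the indefinite integral of g.                 *)
Definition is_comb_derivative f g := forall e t, 0 <= t <= edge_length e ->
  f (edge_point e t) = f (edge_point e 0) +
    cintegral lebesgue_measure `[0, t] (fun s => g (edge_point e s)).

(* The derivative is unique up to a null set; since comb_measure is the sum   *)
(* of the Lebesgue measures of the edges, g in L2 sums up the edgewise norms. *)
Definition H1 : set (plane R -> R[i]) := [set f |
  [/\ comb_continuous f, L2 comb_measure f &
      exists2 g, L2 comb_measure g & is_comb_derivative f g]].

Definition comb_derivative f : plane R -> R[i] :=
  xget (fun=> 0) [set g | L2 comb_measure g /\ is_comb_derivative f g].

Definition H1norm f : R :=
  Num.sqrt (L2norm comb_measure f ^+ 2 +
            L2norm comb_measure (comb_derivative f) ^+ 2).

(* f(0) = 0, where the distance from p to the end of the comb is p.1 + p.2    *)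
Definition vanishes_at_end f := forall e : R, 0 < e ->
  exists2 r : R, 0 < r & forall p, comb p -> p.1 + p.2 < r -> normc (f p) < e.

(* V may contain points of the comb and its end *)
Definition H10 (V : set (plane R)) : set (plane R -> R[i]) := [set f |
  [/\ H1 f, forall p, V p -> comb p -> f p = 0 &
      V comb_end -> vanishes_at_end f]].

Definition dirichlet_form f g : R[i] :=
  L2dot comb_measure (comb_derivative f) (comb_derivative g).

Definition neumann_laplacian := form_operator comb_measure H1 dirichlet_form.

Definition dirichlet_laplacian (V : set (plane R)) :=
  form_operator comb_measure (H10 V) dirichlet_form.

End DiagonalComb.

(* Main.v *)
From HB Require Import structures.
From mathcomp Require Import all_boot all_order all_algebra.
From mathcomp Require Import complex ring lra zify.
From mathcomp Require Import all_classical all_reals all_analysis measurable_realfun.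
Require Import Defs.

Set Implicit Arguments.
Unset Strict Implicit.
Unset Printing Implicit Defensive.

Import Order.TTheory GRing.Theory Num.Theory.
Import numFieldNormedType.Exports.
Import ComplexField.Normc.

Local Open Scope classical_set_scope.
Local Open Scope ring_scope.
Local Open Scope complex_scope.

(* The compactness results rest on the Hoelder estimate
   |f p - f q| <= 5 d(p, q)^(1/2) ||f'||, which makes an H^1-bounded sequence
   uniformly convergent, along an ultrafilter, on the shaft and on finitely many
   teeth. The embedding is therefore compact as soon as, for every e > 0, the
   L^2-mass of f on the teeth k >= N is at most e ||f||^2 for some N.
   Let x_k = k^(-alpha). If alpha > 1 the masses are O(x_k), a summable sequence.
   If 1/2 < alpha <= 1 the total length of the teeth is infinite, so f has to
   vanish at the end, whence |f|^2 = O(x_k) on the k-th tooth and masses O(x_k^2).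
   If f vanishes at the tips the masses are O(x_k^2 ||f'||^2_{tooth k}).
   For alpha <= 1/2, trapezoids on the shaft, constant on the teeth and equal to 1
   near the M-th one, have mass at least M x_M and energy O(1 / x_M); the ratio
   O(1 / (M x_M^2)) is bounded, and M = 5^n makes the supports disjoint.

   For the spectral statements, T = (A + 1)^-1 is a self-adjoint contraction on the
   Hilbert space of L^2-classes. If the form domain is compactly embedded, T is
   compact and Riesz theory applies. If there are infinitely many form-orthogonal
   functions of norm 1 and bounded energy, then <T y, y> >= c ||y||^2 with c > 0 on
   an infinite-dimensional space, so the part of the spectrum of T in [c/2, 1]
   cannot consist of isolated points of finite multiplicity. *)

(** Elements of L^2 are functions here, so T acts on classes while the spectral notions speak of
    functions; statements are proved for classes and lifted back. The dictionary is 1 + l = 1 / s: A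
    u = l u means u = (1 + l) T u, which keeps A, given only as a relation, out of the analysis. In
    the noncompact case no spectral measure is used: positivity of the form of p(T), for a
    polynomial p that is nonnegative on the spectrum, is enough. Orthogonality for the form is what
    makes the lower bound for <T y, y> hold with one constant for all finite combinations. The
    threshold 1/2 is that of the summability of x_k^2, a squared size of order x_k times a tooth
    length x_k. With zeros at the tips, each tooth is controlled by its own energy, so x_k -> 0
    suffices for every alpha. Vertices accumulate at the end, so the Hoelder constant must not
    depend on the number of edges crossed; this is why lengths and energies are added before taking
    square roots. *)

Section ComplexNumbers.
Variable R : realType.
Implicit Types (x y z : R[i]) (k : R).

Lemma cReD x y : complex.Re (x + y) = complex.Re x + complex.Re y.
Proof. by case: x; case: y. Qed.

Lemma cReN x : complex.Re (- x) = - complex.Re x.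
Proof. by case: x. Qed.

Lemma cRe_conj x : complex.Re (conjc x) = complex.Re x.
Proof. by case: x. Qed.

Lemma cReZ k x : complex.Re (k%:C * x) = k * complex.Re x.
Proof. by case: x => a b /=; rewrite mul0r subr0. Qed.

Lemma normc_ge0 x : 0 <= normc x.
Proof. by case: x => a b; exact: sqrtr_ge0. Qed.

Lemma normcE2 x : normc x ^+ 2 = complex.Re x ^+ 2 + complex.Im x ^+ 2.
Proof. by case: x => a b /=; rewrite sqr_sqrtr// addr_ge0 ?sqr_ge0. Qed.

Lemma normc_abs x : `|x| = (normc x)%:C.
Proof. by []. Qed.

Lemma normcD x y : normc (x + y) <= normc x + normc y.
Proof. by rewrite -lecR rmorphD/= -!normc_abs ler_normD. Qed.

Lemma normcN x : normc (- x) = normc x.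
Proof. by case: x => a b /=; rewrite !sqrrN. Qed.

Lemma normcB x y : normc (x - y) = normc (y - x).
Proof. by rewrite -opprB normcN. Qed.

Lemma normc_conj x : normc (conjc x) = normc x.
Proof. by case: x => a b /=; rewrite sqrrN. Qed.

Lemma normc_real k : normc k%:C = `|k|.
Proof. by rewrite /= expr0n addr0 sqrtr_sqr. Qed.

Lemma ler_Re_normc x : `|complex.Re x| <= normc x.
Proof.
rewrite -(ler_pXn2r (n := 2)) ?nnegrE ?normc_ge0//.
by rewrite normcE2 real_normK ?num_real// lerDl sqr_ge0.
Qed.

Lemma ler_Im_normc x : `|complex.Im x| <= normc x.
Proof.
rewrite -(ler_pXn2r (n := 2)) ?nnegrE ?normc_ge0//.
by rewrite normcE2 real_normK ?num_real// lerDr sqr_ge0.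
Qed.

Lemma normc_ReIm x : normc x <= `|complex.Re x| + `|complex.Im x|.
Proof.
rewrite -(ler_pXn2r (n := 2)) ?nnegrE ?normc_ge0 ?addr_ge0//.
rewrite normcE2 sqrrD !real_normK ?num_real//.
by rewrite lerD2r lerDl mulrn_wge0 ?mulr_ge0.
Qed.

Lemma mul_conjc x : conjc x * x = (normc x ^+ 2)%:C.
Proof.
rewrite normcE2; case: x => a b /=; apply/eqP; rewrite eq_complex /=.
by apply/andP; split; apply/eqP; ring.
Qed.

(** The common source of the Cauchy-Schwarz inequalities below, for scalar products, semi-definite
    forms and integrals. The case [a = 0] is included because the second vector may be null; the
    polynomial is then affine, which forces [b = 0]. *)
Lemma discriminant (a b c : R) : 0 <= a ->
  (forall t, 0 <= a * t ^+ 2 + 2 * b * t + c) -> b ^+ 2 <= a * c.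
Proof.
rewrite le_eqVlt => /predU1P[<-|a0] h.
  rewrite mul0r; have [->|b0] := eqVneq b 0; first by rewrite expr0n.
  (* The affine function takes the value -1 at this point. *)
  have := h (- (c + 1) / (2 * b)); rewrite mul0r add0r.
  by rewrite mulrCA divff ?mulf_neq0 ?pnatr_eq0//; lra.
have := h (- b / a).
have -> : a * (- b / a) ^+ 2 + 2 * b * (- b / a) + c = (a * c - b ^+ 2) / a.
  by field; exact: lt0r_neq0.
by rewrite pmulr_lge0 ?invr_gt0// subr_ge0.
Qed.

Lemma archi_inv (e : R) : 0 < e -> exists N : nat, forall n, (N <= n)%N -> n.+1%:R^-1 < e.
Proof.
move=> e0; exists (Num.trunc e^-1) => n Nn.
rewrite invf_plt ?posrE//; apply: lt_le_trans (truncnS_gt _) _.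
by rewrite ler_nat ltnS.
Qed.

End ComplexNumbers.

(** * Hilbert spaces *)

Section HilbertSpace.
Variables (R : realType) (V : lmodType R[i]) (dot : V -> V -> R[i]).

Definition hnorm (x : V) : R := Num.sqrt (complex.Re (dot x x)).

Definition hcvg (u : nat -> V) (l : V) :=
  forall e : R, 0 < e -> exists N, forall n, (N <= n)%N -> hnorm (u n - l) < e.

Definition hcauchy (u : nat -> V) :=
  forall e : R, 0 < e -> exists N, forall m n, (N <= m)%N -> (N <= n)%N ->
    hnorm (u m - u n) < e.

(** Positivity and definiteness only mention the real part, since [dotC] makes [dot x x] real. *)
Record hilbert : Prop := Hilbert {
  dotDl : forall x y z, dot (x + y) z = dot x z + dot y z;
  dotZl : forall (c : R[i]) x y, dot (c *: x) y = c * dot x y;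
  dotC : forall x y, dot y x = conjc (dot x y);
  dot_ge0 : forall x, 0 <= complex.Re (dot x x);
  dot_eq0 : forall x, complex.Re (dot x x) = 0 -> x = 0;
  hcomplete : forall u, hcauchy u -> exists l, hcvg u l }.

Hypothesis hH : hilbert.
Implicit Types (x y z : V) (c : R[i]) (k : R).

Lemma dotDr x y z : dot x (y + z) = dot x y + dot x z.
Proof. by rewrite dotC// dotDl// rmorphD/= -!dotC. Qed.

Lemma dotZr c x y : dot x (c *: y) = conjc c * dot x y.
Proof. by rewrite dotC// dotZl// rmorphM/= -dotC. Qed.

Lemma dot0l y : dot 0 y = 0.
Proof. by rewrite -(scale0r 0) dotZl// mul0r. Qed.

Lemma dot0r y : dot y 0 = 0.
Proof. by rewrite -(scale0r 0) dotZr rmorph0 mul0r. Qed.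

Lemma dotNl x y : dot (- x) y = - dot x y.
Proof. by rewrite -scaleN1r dotZl// mulN1r. Qed.

Lemma dotNr x y : dot x (- y) = - dot x y.
Proof. by rewrite -scaleN1r dotZr rmorphN rmorph1 mulN1r. Qed.

Lemma dotBl x y z : dot (x - y) z = dot x z - dot y z.
Proof. by rewrite dotDl// dotNl. Qed.

Lemma dotBr x y z : dot x (y - z) = dot x y - dot x z.
Proof. by rewrite dotDr dotNr. Qed.

Lemma dot_suml I (r : seq I) (F : I -> V) y :
  dot (\sum_(i <- r) F i) y = \sum_(i <- r) dot (F i) y.
Proof.
elim: r => [|a r ih]; first by rewrite !big_nil dot0l.
by rewrite !big_cons dotDl// ih.
Qed.

Lemma dot_sumr I (r : seq I) (F : I -> V) y :
  dot y (\sum_(i <- r) F i) = \sum_(i <- r) dot y (F i).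
Proof.
elim: r => [|a r ih]; first by rewrite !big_nil dot0r.
by rewrite !big_cons dotDr ih.
Qed.

Lemma dot_real x : dot x x = (complex.Re (dot x x))%:C.
Proof.
have := dotC hH x x; case: (dot x x) => a b /= [] b0.
by congr (_ +i* _); lra.
Qed.

Lemma hnorm_ge0 x : 0 <= hnorm x.
Proof. exact: sqrtr_ge0. Qed.

Lemma hnorm2 x : hnorm x ^+ 2 = complex.Re (dot x x).
Proof. by rewrite sqr_sqrtr// dot_ge0. Qed.

Lemma dot_hnorm x : dot x x = (hnorm x ^+ 2)%:C.
Proof. by rewrite hnorm2 -dot_real. Qed.

Lemma hnorm0 : hnorm 0 = 0.
Proof. by rewrite /hnorm dot0l sqrtr0. Qed.

Lemma hnorm_eq0 x : hnorm x = 0 -> x = 0.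
Proof. by move=> x0; apply: dot_eq0 => //; rewrite -hnorm2 x0 expr0n. Qed.

Lemma hnorm_gt0 x : x <> 0 -> 0 < hnorm x.
Proof.
move=> x0; rewrite lt_neqAle hnorm_ge0 andbT eq_sym.
by apply/eqP => /hnorm_eq0.
Qed.

Lemma hnormZ c x : hnorm (c *: x) = normc c * hnorm x.
Proof.
rewrite /hnorm dotZl// dotZr mulrA [c * _]mulrC mul_conjc cReZ.
by rewrite sqrtrM ?sqr_ge0// sqrtr_sqr ger0_norm ?normc_ge0.
Qed.

Lemma hnormN x : hnorm (- x) = hnorm x.
Proof. by rewrite /hnorm dotNl dotNr opprK. Qed.

Lemma hnormB x y : hnorm (x - y) = hnorm (y - x).
Proof. by rewrite -opprB hnormN. Qed.

Lemma rdotC x y : complex.Re (dot x y) = complex.Re (dot y x).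
Proof. by rewrite dotC// cRe_conj. Qed.

Lemma hnormD2 x y :
  hnorm (x + y) ^+ 2 = hnorm x ^+ 2 + 2 * complex.Re (dot x y) + hnorm y ^+ 2.
Proof.
rewrite !hnorm2 dotDl// !dotDr !cReD (rdotC y x); ring.
Qed.

Lemma rcauchy_schwarz x y : complex.Re (dot x y) <= hnorm x * hnorm y.
Proof.
suff : complex.Re (dot x y) ^+ 2 <= (hnorm x * hnorm y) ^+ 2.
  move=> h; apply: le_trans (ler_norm _) _.
  rewrite -(ler_pXn2r (n := 2)) ?nnegrE ?mulr_ge0 ?hnorm_ge0//.
  by rewrite real_normK ?num_real.
rewrite exprMn [_ * hnorm y ^+ 2]mulrC; apply: discriminant (sqr_ge0 _) _ => t.
have := sqr_ge0 (hnorm (x + t%:C *: y)); rewrite hnormD2 dotZr hnormZ normc_real.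
rewrite exprMn real_normK ?num_real// (_ : conjc t%:C = t%:C) ?cReZ; first by lra.
by rewrite /= oppr0.
Qed.

(** Multiplying [x] by the conjugate of [dot x y] turns the scalar product into its squared modulus,
    to which the bound for the real part applies. *)
Lemma cauchy_schwarz x y : normc (dot x y) <= hnorm x * hnorm y.
Proof.
have [->|d0] := eqVneq (normc (dot x y)) 0; first by rewrite mulr_ge0 ?hnorm_ge0.
have := rcauchy_schwarz (conjc (dot x y) *: x) y.
rewrite dotZl// mul_conjc hnormZ normc_conj -mulrA ler_pM2l//.
by rewrite lt_neqAle eq_sym d0 normc_ge0.
Qed.

Lemma hnormD x y : hnorm (x + y) <= hnorm x + hnorm y.
Proof.
rewrite -(ler_pXn2r (n := 2)) ?nnegrE ?addr_ge0 ?hnorm_ge0//.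
rewrite hnormD2 sqrrD lerD2r lerD2l -[leRHS]mulr_natl.
by rewrite ler_pM2l ?rcauchy_schwarz.
Qed.

Lemma hnormBB x y z : hnorm (x - z) <= hnorm (x - y) + hnorm (y - z).
Proof. by apply: le_trans (hnormD _ _); rewrite addrA subrK. Qed.

Lemma ler_hnormB x y : `|hnorm x - hnorm y| <= hnorm (x - y).
Proof.
rewrite ler_norml; apply/andP; split.
  by have := hnormD (y - x) x; rewrite subrK hnormB; lra.
by have := hnormD (x - y) y; rewrite subrK; lra.
Qed.

Lemma hcvg_uniq u l l' : hcvg u l -> hcvg u l' -> l = l'.
Proof.
move=> ul ul'; apply/eqP; rewrite -subr_eq0; apply/eqP/hnorm_eq0.
apply/eqP; rewrite eq_le hnorm_ge0 andbT; apply/ler_addgt0Pr => e e0.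
have e2 : 0 < e / 2 by lra.
have [N hN] := ul _ e2; have [M hM] := ul' _ e2.
have := hnormBB l (u (maxn N M)) l'.
have := hN _ (leq_maxl N M); have := hM _ (leq_maxr N M).
by rewrite (hnormB l (u _)); lra.
Qed.

Lemma hcvg_norm u l k : hcvg u l -> (forall n, hnorm (u n) = k) -> hnorm l = k.
Proof.
move=> ul uk; apply/eqP; rewrite -subr_eq0 -normr_eq0 eq_le normr_ge0 andbT.
apply/ler_addgt0Pr => e e0; have [N hN] := ul _ e0.
have := hN _ (leqnn N); have := ler_hnormB (u N) l.
by rewrite uk distrC; lra.
Qed.

Lemma hcvg_cauchy u l : hcvg u l -> hcauchy u.
Proof.
move=> ul e e0; have e2 : 0 < e / 2 by lra.
have [N hN] := ul _ e2; exists N => m n Nm Nn.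
have := hnormBB (u m) l (u n); have := hN _ Nm; have := hN _ Nn.
by rewrite (hnormB (u n)); lra.
Qed.

Lemma hcvgB u v l l' : hcvg u l -> hcvg v l' -> hcvg (fun n => u n - v n) (l - l').
Proof.
move=> ul vl e e0; have e2 : 0 < e / 2 by lra.
have [N hN] := ul _ e2; have [M hM] := vl _ e2.
exists (maxn N M) => n; rewrite geq_max => /andP[/hN a /hM b].
have -> : u n - v n - (l - l') = u n - l - (v n - l').
  by rewrite !opprB addrACA [RHS]addrACA; congr (_ + _); rewrite addrC.
apply: le_lt_trans (hnormD _ _) _.
by rewrite hnormN; lra.
Qed.

Lemma hcvg_dot u l x : hcvg u l -> (forall n, dot (u n) x = 0) -> dot l x = 0.
Proof.
move=> ul ux; suff : normc (dot l x) = 0 by move/eq0_normc.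
apply/eqP; rewrite eq_le normc_ge0 andbT; apply/ler_addgt0Pr => e e0.
have e2 : 0 < e / (hnorm x + 1) by rewrite divr_gt0// ltr_wpDl// hnorm_ge0.
have [N hN] := ul _ e2.
have -> : dot l x = dot (l - u N) x by rewrite dotBl ux subr0.
apply: le_trans (cauchy_schwarz _ _) _; rewrite hnormB add0r.
have : hnorm (u N - l) * hnorm x <= e / (hnorm x + 1) * (hnorm x + 1).
  by apply: ler_pM; rewrite ?hnorm_ge0 ?ltW ?hN// ltrDl.
by move=> /le_trans; apply; rewrite divfK// gt_eqF// ltr_wpDl// hnorm_ge0.
Qed.

(** [M] need not be closed, so the projection is only reached by a sequence in [M]. A minimizing
    sequence is almost orthogonal to [M], because moving along a line inside [M] cannot go below the
    infimum; almost orthogonality makes it Cauchy and becomes exact in the limit. *)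
Lemma projection (M : set V) : M 0 -> (forall x y, M x -> M y -> M (x + y)) ->
  (forall c x, M x -> M (c *: x)) ->
  forall x, exists p, [/\ exists2 m : nat -> V, forall n, M (m n) & hcvg m p &
    forall y, M y -> dot (x - p) y = 0].
Proof.
move=> M0 MD MZ x.
pose S := [set hnorm (x - y) ^+ 2 | y in M].
have S0 : S !=set0 by exists (hnorm (x - 0) ^+ 2), 0.
have lbS : lbound S 0 by move=> _ [y _ <-]; exact: sqr_ge0.
have hS : has_inf S by split=> //; exists 0.
have [m hm] : exists m : nat -> V, forall n,
    M (m n) /\ hnorm (x - m n) ^+ 2 < inf S + n.+1%:R^-1.
  have /choice[m hm] : forall n : nat, exists y,
      M y /\ hnorm (x - y) ^+ 2 < inf S + n.+1%:R^-1; last by exists m.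
  move=> n; have n0 : 0 < n.+1%:R^-1 :> R by rewrite invr_gt0 ltr0n.
  by have [_ [y My <-] hy] := inf_adherent n0 hS; exists y.
(* The excess over the infimum, below [n.+1%:R^-1], is the slack in the quadratic inequality along
   the line through [m n] with direction [y]. *)
have ortho n y : M y -> complex.Re (dot (x - m n) y) ^+ 2 <=
    n.+1%:R^-1 * hnorm y ^+ 2.
  move=> My; have [Mm hmn] := hm n; rewrite mulrC.
  apply: (@le_trans _ _ (hnorm y ^+ 2 * (hnorm (x - m n) ^+ 2 - inf S))); last first.
    by rewrite ler_wpM2l ?sqr_ge0// lerBlDl ltW.
  apply: discriminant (sqr_ge0 _) _ => t.
  have : inf S <= hnorm (x - (m n - t%:C *: y)) ^+ 2.
    apply: ge_inf; first by case: hS.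
    by exists (m n - t%:C *: y) => //; apply: MD => //; rewrite -scaleNr; apply: MZ.
  have -> : x - (m n - t%:C *: y) = (x - m n) + t%:C *: y.
    by rewrite opprB addrCA addrC.
  rewrite [in X in X -> _]hnormD2 dotZr hnormZ normc_real.
  rewrite exprMn real_normK ?num_real// (_ : conjc t%:C = t%:C) ?cReZ; first by lra.
  by rewrite /= oppr0.
have ortho' n y : M y ->
    `|complex.Re (dot (x - m n) y)| <= Num.sqrt n.+1%:R^-1 * hnorm y.
  move=> My; rewrite -(ler_pXn2r (n := 2)) ?nnegrE ?mulr_ge0 ?hnorm_ge0 ?sqrtr_ge0//.
  by rewrite real_normK ?num_real// exprMn sqr_sqrtr ?ortho// invr_ge0 ler0n.
(* The difference lies in [M], and its squared norm is the difference of its products with [x - m j]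
   and [x - m i], both small. *)
have mm i j : hnorm (m i - m j) <= Num.sqrt i.+1%:R^-1 + Num.sqrt j.+1%:R^-1.
  have Mij : M (m i - m j).
    by apply: MD; [case: (hm i)|rewrite -scaleN1r; apply: MZ; case: (hm j)].
  have [h0|h0] := eqVneq (hnorm (m i - m j)) 0; first by rewrite h0 addr_ge0 ?sqrtr_ge0.
  have hp : 0 < hnorm (m i - m j) by rewrite lt_neqAle eq_sym h0 hnorm_ge0.
  rewrite -(ler_pM2r hp) -expr2 hnorm2.
  have -> : dot (m i - m j) (m i - m j) =
      dot (x - m j) (m i - m j) - dot (x - m i) (m i - m j).
    rewrite -dotBl; congr (dot _ _).
    by rewrite opprB [RHS]addrC addrA subrK.
  rewrite cReD cReN mulrDl.
  have := ortho' i _ Mij; have := ortho' j _ Mij.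
  by rewrite !ler_norml => /andP[_ a] /andP[b _]; lra.
have small e : 0 < e -> exists N : nat, forall n, (N <= n)%N ->
    Num.sqrt n.+1%:R^-1 < e :> R.
  move=> e0; have [N hN] := archi_inv (exprn_gt0 2 e0); exists N => n /hN h.
  rewrite -(ltr_pXn2r (n := 2)) ?nnegrE ?sqrtr_ge0 ?(ltW e0)// sqr_sqrtr//.
have cm : hcauchy m.
  move=> e e0; have e2 : 0 < e / 2 by lra.
  have [N hN] := small _ e2; exists N => i j /hN hi /hN hj.
  by apply: le_lt_trans (mm i j) _; lra.
have [p mp] := hcomplete hH cm; exists p; split.
  by exists m => // n; case: (hm n).
have rp y : M y -> complex.Re (dot (x - p) y) = 0.
  move=> My; apply/eqP; rewrite -normr_eq0 eq_le normr_ge0 andbT.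
  apply/ler_addgt0Pr => e e0; rewrite add0r.
  have e2 : 0 < e / 2 / (hnorm y + 1) by rewrite !divr_gt0// ltr_wpDl// hnorm_ge0.
  have [N hN] := small _ e2; have [K hK] := mp _ e2.
  have -> : x - p = (x - m (maxn N K)) + (m (maxn N K) - p).
    by rewrite addrA subrK.
  rewrite dotDl// cReD; apply: le_trans (ler_normD _ _) _.
  have h1 := ortho' (maxn N K) _ My.
  have h2 := le_trans (ler_Re_normc _) (cauchy_schwarz (m (maxn N K) - p) y).
  have h3 := hN _ (leq_maxl N K); have h4 := hK _ (leq_maxr N K).
  have yp : 0 < hnorm y + 1 by rewrite ltr_wpDl// hnorm_ge0.
  have bnd k : k < e / 2 / (hnorm y + 1) -> k * hnorm y <= e / 2.
    move=> hk; apply: (@le_trans _ _ (e / 2 / (hnorm y + 1) * (hnorm y + 1))).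
      apply: (@le_trans _ _ (e / 2 / (hnorm y + 1) * hnorm y)).
        by rewrite ler_wpM2r ?hnorm_ge0 ?(ltW hk).
      by rewrite ler_wpM2l ?(ltW e2)// lerDl.
    by rewrite divfK// gt_eqF.
  by have := bnd _ h3; have := bnd _ h4; lra.
move=> y My; apply/eqP; rewrite eq_complex rp//= eqxx/=.
(* Testing with ['i *: y] gives the imaginary part. *)
have := rp _ (MZ 'i _ My); rewrite dotZr.
by case: (dot _ y) => a b /= h; apply/eqP; lra.
Qed.

(** The representing vector is a multiple of the component [z], orthogonal to the kernel, of a
    vector outside the kernel; boundedness makes [phi] vanish on limits of kernel elements. The
    coefficient is conjugated because [dot] is antilinear in its second argument. *)
Lemma riesz (phi : V -> R[i]) (K : R) :
  (forall x y, phi (x + y) = phi x + phi y) ->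
  (forall c x, phi (c *: x) = c * phi x) ->
  (forall x, normc (phi x) <= K * hnorm x) ->
  exists u, forall v, phi v = dot v u.
Proof.
move=> phiD phiZ phiK.
have [phi0|] := pselect (forall v, phi v = 0).
  by exists 0 => v; rewrite phi0 dot0r.
move=> /existsNP[x0 x0N].
have phi00 : phi 0 = 0 by rewrite -(scale0r 0) phiZ mul0r.
have phiB x y : phi (x - y) = phi x - phi y.
  by rewrite phiD -scaleN1r phiZ mulN1r.
have kerD x y : phi x = 0 -> phi y = 0 -> phi (x + y) = 0.
  by move=> hx hy; rewrite phiD hx hy addr0.
have kerZ c x : phi x = 0 -> phi (c *: x) = 0 by move=> hx; rewrite phiZ hx mulr0.
have [p [[m Mm mp] orth]] := @projection [set x | phi x = 0] phi00 kerD kerZ x0.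
have phip : phi p = 0.
  apply: eq0_normc; apply/eqP; rewrite eq_le normc_ge0 andbT.
  apply/ler_addgt0Pr => e e0; rewrite add0r.
  have e2 : 0 < e / (`|K| + 1) by rewrite divr_gt0// ltr_wpDl.
  have [N hN] := mp _ e2; have := phiK (m N - p).
  rewrite phiB Mm sub0r normcN => /le_trans; apply.
  apply: (@le_trans _ _ ((`|K| + 1) * (e / (`|K| + 1)))).
    apply: (@le_trans _ _ ((`|K| + 1) * hnorm (m N - p))).
      by rewrite ler_wpM2r ?hnorm_ge0//; have := ler_norm K; lra.
    by rewrite ler_wpM2l ?addr_ge0// ltW// hN.
  by rewrite mulrC divfK// gt_eqF// ltr_wpDl.
set z := x0 - p in orth.
have phiz : phi z = phi x0 by rewrite phiB phip subr0.
have z0 : hnorm z != 0.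
  apply/eqP => /hnorm_eq0 z0; apply: x0N.
  by rewrite -phiz z0.
exists (conjc (phi z / dot z z) *: z) => v.
have dz : dot z z != 0.
  by rewrite dot_hnorm -(rmorph0 (real_complex R)) (inj_eq (@complexI R)) sqrf_eq0.
have : dot z (v - phi v / phi z *: z) = 0.
  by apply: orth => /=; rewrite phiB phiZ divfK ?subrr// phiz; apply/eqP.
rewrite dotBr dotZr => /eqP; rewrite subr_eq0 => /eqP h.
have : dot v z = phi v / phi z * dot z z.
  by rewrite dotC// h rmorphM/= conjcK -dotC.
move=> hv; rewrite dotZr conjcK hv.
rewrite [_ * dot z z]mulrC mulrA divfK// mulrC divfK//.
by rewrite phiz; apply/eqP.
Qed.

End HilbertSpace.

(** * Orthonormal systems *)

Section Orthonormal.
Variables (R : realType) (V : lmodType R[i]) (dot : V -> V -> R[i]).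
Hypothesis hH : hilbert dot.
Local Notation hnorm := (hnorm dot).

Definition finitely_spanned (M : set V) := exists n (b : 'I_n -> V),
  (forall i, M (b i)) /\
  forall x, M x -> exists c : 'I_n -> R[i], x = \sum_(i < n) c i *: b i.

Lemma normalize x : x <> 0 -> hnorm ((hnorm x)^-1%:C *: x) = 1.
Proof.
move=> x0; rewrite hnormZ// normc_real ger0_norm ?invr_ge0 ?hnorm_ge0//.
by rewrite mulVf// gt_eqF// hnorm_gt0.
Qed.

(** Gram-Schmidt: no finite list spans [M], so some element of [M] differs from its expansion in the
    orthonormal list built so far, and the normalized difference is the next vector. *)
Lemma orthonormal_sequence (M : set V) :
  (forall x y, M x -> M y -> M (x + y)) ->
  (forall c x, M x -> M (c *: x)) -> M 0 ->
  ~ finitely_spanned M ->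
  exists e : nat -> V, [/\ forall n, M (e n), forall n, hnorm (e n) = 1 &
    forall m n, (m < n)%N -> dot (e n) (e m) = 0].
Proof.
move=> MD MZ M0 Minf.
pose good (s : seq V) := [/\ forall x, x \in s -> M x,
  forall x, x \in s -> dot x x = 1 &
  forall x y, x \in s -> y \in s -> x != y -> dot x y = 0].
(* The conditions on [s] stand under the existential, with 0 as default value, to give a total
   choice function on lists. *)
have /choice[F hF] : forall s : seq V, exists x, uniq s -> good s ->
    [/\ M x, hnorm x = 1 & forall y, y \in s -> dot x y = 0].
  move=> s; have [[us [sM s1 s0]]|] := pselect (uniq s /\ good s); last first.
    by move=> h; exists 0 => us gs; exfalso; apply: h.
  have [x Mx xs] : exists2 x, M x & x <> \sum_(y <- s) dot x y *: y.
    apply: contrapT => h; apply: Minf; exists (size s), (fun i => tnth (in_tuple s) i).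
    split=> [i|x Mx]; first by apply: sM; rewrite mem_tnth.
    exists (fun i => dot x (tnth (in_tuple s) i)).
    have -> : x = \sum_(y <- s) dot x y *: y.
      by apply: contrapT => hx; apply: h; exists x.
    rewrite {1}big_tnth; apply: eq_bigr => i _; congr (dot _ _ *: _).
    by apply: contrapT => hx; apply: h; exists x => // e; apply: hx.
  pose z := x - \sum_(y <- s) dot x y *: y.
  have z0 : z <> 0 by move=> /eqP; rewrite subr_eq0 => /eqP.
  have Mz : M z.
    apply: (MD _ _) => //; rewrite -scaleN1r; apply: (MZ _).
    have {z z0 xs} : forall t : seq V, {subset t <= s} -> M (\sum_(y <- t) dot x y *: y).
      elim=> [|a t ih] ts; first by rewrite big_nil.
      rewrite big_cons; apply: (MD _ _); last by apply: ih => w wt; apply: ts; rewrite inE wt orbT.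
      by apply: (MZ _); apply: sM; apply: ts; rewrite inE eqxx.
    exact.
  exists ((hnorm z)^-1%:C *: z) => _ _; split; [exact: MZ|exact: normalize|].
  move=> y ys; rewrite dotZl// [X in _ * X](_ : _ = 0) ?mulr0//.
  rewrite dotBl// dot_suml// (bigD1_seq y)//= dotZl// s1// mulr1.
  rewrite big_seq_cond big1 ?addr0 ?subrr// => w /andP[ws wy].
  by rewrite dotZl// (s0 _ _ ws ys wy) mulr0.
(* [S n] keeps all earlier vectors, as the next one, [F (S n)], has to be orthogonal to each of
   them. *)
pose S := fix S n := if n is n'.+1 then F (S n') :: S n' else [::].
have hS n : uniq (S n) /\ good (S n).
  elim: n => [|n [un [gM g1 g0]]]; first by split.
  have [FM F1 F0] := hF (S n) un (And3 gM g1 g0).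
  have d1 : dot (F (S n)) (F (S n)) = 1 by rewrite dot_hnorm// F1 expr1n.
  have FS : F (S n) \notin S n.
    by apply/negP => /F0/eqP; rewrite d1 oner_eq0.
  split; first by rewrite /= FS.
  split=> [x|x|x y]; rewrite !inE.
  - by move=> /predU1P[->|/gM].
  - by move=> /predU1P[->|/g1].
  - move=> /predU1P[->|xs] /predU1P[->|ys]; rewrite ?eqxx// => xy.
    + exact: F0.
    + by rewrite dotC// F0// rmorph0.
    + exact: g0.
have hFS n : [/\ M (F (S n)), hnorm (F (S n)) = 1 & forall y, y \in S n -> dot (F (S n)) y = 0].
  by have [un gn] := hS n; exact: hF.
have memS m n : (m < n)%N -> F (S m) \in S n.
  elim: n => // n ih; rewrite ltnS leq_eqVlt => /predU1P[->|/ih h].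
    by rewrite inE eqxx.
  by rewrite inE h orbT.
exists (fun n => F (S n)); split => [n|n|m n mn].
- by case: (hFS n).
- by case: (hFS n).
- by case: (hFS n) => _ _; apply; exact: memS.
Qed.

End Orthonormal.

Lemma homo_ltn_geq (s : nat -> nat) : {homo s : i j / (i < j)%N} ->
  forall n, (n <= s n)%N.
Proof.
by move=> hs; elim=> // n ih; apply: leq_ltn_trans ih _; exact: hs.
Qed.

(** * Compact self-adjoint operators *)

Section Operator.
Variables (R : realType) (V : lmodType R[i]) (dot : V -> V -> R[i]).
Hypothesis hH : hilbert dot.
Variable T : {linear V -> V}.
Local Notation hnorm := (hnorm dot).
Hypothesis T_sa : forall x y, dot (T x) y = dot x (T y).
Hypothesis T_le1 : forall x, hnorm (T x) <= hnorm x.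
Implicit Types (x y z : V) (c : R[i]) (k : R).

(** Eigenvectors of [T] for 1 / c; for T = (A + 1)^-1 and c = 1 + l these are the eigenvectors of A
    for l. *)
Definition eig c := [set x | x = c *: T x].

Lemma dot_T_real x : dot (T x) x = (complex.Re (dot (T x) x))%:C.
Proof.
have := dotC hH (T x) x; rewrite -T_sa; case: (dot _ _) => a b /= [] b0.
by congr (_ +i* _); lra.
Qed.

(** Both [dot x x] and [dot (T x) x] are real, and the second cannot vanish unless [x] does. *)
Lemma eig_real c x : eig c x -> x <> 0 -> conjc c = c.
Proof.
move=> xc x0; have : dot x x = c * dot (T x) x by rewrite {1}xc dotZl.
rewrite dot_T_real dot_hnorm//; case: c xc => a b hx /= [] _ /eqP.
rewrite mulr0 add0r eq_sym mulf_eq0 => /orP[/eqP->|/eqP h]; first by rewrite oppr0.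
exfalso; apply: x0; apply: (hnorm_eq0 hH).
have := dot_T_real x; rewrite h => Tx0.
have : dot x x = 0 by rewrite {1}hx dotZl// Tx0 mulr0.
by rewrite dot_hnorm// => -[] /eqP; rewrite sqrf_eq0 => /eqP.
Qed.

Lemma T_hcvg u l : hcvg dot u l -> hcvg dot (T \o u) (T l).
Proof.
move=> ul e /ul[N hN]; exists N => n /hN; apply: le_lt_trans.
by rewrite /= -(linearB T) T_le1.
Qed.

Lemma hcvgZ (c : nat -> R[i]) c0 (u : nat -> V) l :
  (forall e : R, 0 < e -> exists N, forall n, (N <= n)%N -> normc (c n - c0) < e) ->
  hcvg dot u l -> hcvg dot (fun n => c n *: u n) (c0 *: l).
Proof.
move=> cc ul e e0.
pose K := normc c0 + 1; have K0 : 0 < K by rewrite ltr_wpDl ?normc_ge0.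
pose L := hnorm l + 1; have L0 : 0 < L by rewrite ltr_wpDl ?hnorm_ge0.
have [N1 h1] := cc 1 ltr01.
have [N2 h2] := cc (e / 2 / L) (divr_gt0 (divr_gt0 e0 (ltr0Sn _ 1)) L0).
have [N3 h3] := ul (e / 2 / K) (divr_gt0 (divr_gt0 e0 (ltr0Sn _ 1)) K0).
exists (maxn N1 (maxn N2 N3)) => n; rewrite !geq_max => /and3P[/h1 a /h2 b /h3 d].
have -> : c n *: u n - c0 *: l = c n *: (u n - l) + (c n - c0) *: l.
  by rewrite scalerBr scalerBl addrA subrK.
apply: le_lt_trans (hnormD hH _ _) _; rewrite !hnormZ//.
have cK : normc (c n) <= K.
  by have := normcD (c n - c0) c0; rewrite subrK /K; lra.
have := ler_pM (normc_ge0 _) (hnorm_ge0 _ _) cK (ltW d).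
rewrite [K * _]mulrC divfK ?gt_eqF//.
have lL : hnorm l <= L by rewrite lerDl.
have h := ler_pM (normc_ge0 _) (hnorm_ge0 _ _) (lexx (normc (c n - c0))) lL.
have : normc (c n - c0) * L < e / 2 by rewrite -ltr_pdivlMr.
by lra.
Qed.

Definition hcompact := forall u : nat -> V,
  (exists M, forall n, hnorm (u n) <= M) ->
  exists2 s : nat -> nat, {homo s : i j / (i < j)%N} &
  exists l, hcvg dot (T \o u \o s) l.

Hypothesis T_compact : hcompact.

Lemma cvg_const (c : R[i]) : forall e : R, 0 < e ->
  exists N : nat, forall n, (N <= n)%N -> normc (c - c) < e.
Proof. by move=> e e0; exists 0%N => n _; rewrite subrr normc0. Qed.

(** Compactness turns approximate eigenvectors into a genuine one: [T (x n)] converges along a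
    subsequence, hence [x n], close to [c n *: T (x n)], converges to [c0] times that limit, which
    still has norm 1. The parameter may vary with [n], as the isolation of eigenvalues requires. *)
Lemma approx_eig (c : nat -> R[i]) c0 (x : nat -> V) :
  (forall e : R, 0 < e -> exists N, forall n, (N <= n)%N -> normc (c n - c0) < e) ->
  (forall n, hnorm (x n) = 1) ->
  (forall e : R, 0 < e -> exists N, forall n, (N <= n)%N ->
     hnorm (x n - c n *: T (x n)) < e) ->
  exists2 s : nat -> nat, {homo s : i j / (i < j)%N} &
  exists l, [/\ hcvg dot (x \o s) l, hnorm l = 1 & eig c0 l].
Proof.
move=> cc x1 xc.
have [|s hs [l Tl]] := T_compact (u := x); first by exists 1 => n; rewrite x1.
exists s => //; exists (c0 *: l).
have cc' e : 0 < e -> exists N, forall n, (N <= n)%N -> normc (c (s n) - c0) < e.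
  move=> /cc[N hN]; exists N => n Nn; apply: hN.
  by apply: leq_trans Nn _; exact: homo_ltn_geq.
have xl : hcvg dot (x \o s) (c0 *: l).
  move=> e e0; have e2 : 0 < e / 2 by lra.
  have [N1 h1] := xc _ e2; have [N2 h2] := hcvgZ cc' Tl e2.
  exists (maxn N1 N2) => n; rewrite geq_max => /andP[N1n /h2 b].
  have := h1 _ (leq_trans N1n (homo_ltn_geq hs n)).
  have := hnormBB hH (x (s n)) (c (s n) *: T (x (s n))) (c0 *: l).
  by move: b => /=; lra.
split=> //; first by apply: (hcvg_norm hH xl) => n /=.
by congr (_ *: _); apply: (hcvg_uniq hH Tl); exact: (T_hcvg xl).
Qed.

(** Otherwise unit vectors with [x - c *: T x] tending to 0 would accumulate at a unit
    eigenvector. *)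
Lemma fredholm_bounded c : (forall x, eig c x -> x = 0) ->
  exists K, forall x, hnorm x <= K * hnorm (x - c *: T x).
Proof.
move=> ceig; apply: contrapT => hK.
have /choice[x hx] : forall n : nat, exists x, hnorm x = 1 /\
    hnorm (x - c *: T x) < n.+1%:R^-1.
  move=> n; have [x] : exists x, ~ (hnorm x <= n.+1%:R * hnorm (x - c *: T x)).
    apply: contrapT => h; apply: hK; exists n.+1%:R => x.
    by apply: contrapT => hx; apply: h; exists x.
  move=> /negP; rewrite -ltNge => hx.
  have x0 : 0 < hnorm x by apply: le_lt_trans hx; rewrite mulr_ge0 ?hnorm_ge0.
  have xN : x <> 0 by move=> x0'; move: x0; rewrite x0' hnorm0 ?ltxx.
  exists ((hnorm x)^-1%:C *: x); split; first exact: normalize.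
  rewrite (linearZZ T) scalerA mulrC -scalerA -scalerBr hnormZ// normc_real.
  rewrite ger0_norm ?invr_ge0 ?hnorm_ge0// mulrC ltr_pdivrMr//.
  by rewrite ltr_pdivlMl ?ltr0n.
have [||s hs [l [_ l1 lc]]] := @approx_eig (fun=> c) c x (cvg_const c).
- by move=> n; case: (hx n).
- move=> e /archi_inv[N hN]; exists N => n /hN; apply: lt_trans.
  by case: (hx n).
by move: l1; rewrite (ceig _ lc) hnorm0// => /eqP; rewrite eq_sym oner_eq0.
Qed.

(** The lower bound makes the range of 1 - c T closed. A vector orthogonal to it is an eigenvector
    for the conjugate of [c]; unless the vector is null this parameter is real, hence equal to [c],
    which is excluded. *)
Lemma fredholm_surjective c : (forall x, eig c x -> x = 0) ->
  forall y, exists x, y = x - c *: T x.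
Proof.
move=> ceig y; have [K hK] := fredholm_bounded ceig.
pose A x := x - c *: T x.
have AD x z : A (x + z) = A x + A z.
  by rewrite /A (linearD T) scalerDr opprD addrACA.
have AZ a x : A (a *: x) = a *: A x.
  by rewrite /A (linearZZ T) scalerBr !scalerA mulrC.
have AB x z : A (x - z) = A x - A z by rewrite AD -scaleN1r AZ scaleN1r.
have [|||p [[m Mm mp] orth]] := @projection _ _ _ hH (range A) _ _ _ y.
- by exists 0 => //; rewrite /A (linear0 T) scaler0 subr0.
- by move=> _ _ [a _ <-] [b _ <-]; exists (a + b).
- by move=> a _ [b _ <-]; exists (a *: b).
have yp : y - p = 0.
  set z := y - p in orth *.
  have zT : eig (conjc c) z.
    apply/eqP; rewrite -subr_eq0; apply/eqP; apply: (hnorm_eq0 hH).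
    set w := _ - _; suff : dot w w = 0.
      by rewrite dot_hnorm// => -[] /eqP; rewrite sqrf_eq0 => /eqP.
    have := orth (A w) (ex_intro2 _ _ w I erefl).
    rewrite {1}/A dotBr// dotZr// -T_sa => h.
    by rewrite {1}/w dotBl// dotZl.
  have [//|z0] := pselect (z = 0).
  have cc := eig_real zT z0; rewrite conjcK in cc.
  by apply: ceig; rewrite cc.
have /choice[x hx] : forall n, exists x, A x = m n.
  by move=> n; have [x _ <-] := Mm n; exists x.
have cx : hcauchy dot x.
  have K1 : 0 < `|K| + 1 by rewrite ltr_wpDl.
  move=> e e0; have [N hN] := hcvg_cauchy hH mp (divr_gt0 e0 K1).
  exists N => i j Ni Nj; apply: le_lt_trans (hK _) _.
  rewrite -/(A _) AB !hx; have := hN _ _ Ni Nj.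
  rewrite ltr_pdivlMr// mulrC; apply: le_lt_trans.
  by rewrite ler_wpM2r ?hnorm_ge0//; have := ler_norm K; lra.
have [l xl] := hcomplete hH cx; exists l.
have Al : hcvg dot (fun n => x n - c *: T (x n)) (A l).
  by apply: (hcvgB hH xl); apply: hcvgZ (cvg_const c) _; exact: T_hcvg.
rewrite -/(A l); have <- : p = A l.
  apply: (hcvg_uniq hH mp) => e /Al[N hN]; exists N => n /hN.
  by rewrite -/(A _) hx.
by apply/eqP; rewrite -subr_eq0 yp.
Qed.

(** Eigenvectors for different parameters are orthogonal. If parameters accumulated at [c0], a limit
    of their unit eigenvectors would be an eigenvector for [c0] orthogonal to the approximating
    ones, hence to itself. *)
Lemma eig_isolated c0 : exists2 e : R, 0 < e & forall c, normc (c - c0) < e ->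
  (exists2 x, eig c x & x <> 0) -> c = c0.
Proof.
apply: contrapT => h.
have /choice[cx hcx] : forall n : nat, exists cx : R[i] * V,
    [/\ normc (cx.1 - c0) < n.+1%:R^-1, eig cx.1 cx.2, hnorm cx.2 = 1 & cx.1 <> c0].
  move=> n; apply: contrapT => hn; apply: h; exists n.+1%:R^-1.
    by rewrite invr_gt0 ltr0n.
  move=> c cc0 [x xc x0]; apply: contrapT => cN; apply: hn.
  exists (c, (hnorm x)^-1%:C *: x); split => //; last exact: normalize.
  by rewrite /eig/= (linearZZ T) scalerA mulrC -scalerA; congr (_ *: _).
have [|||s hs [l [xl l1 lc]]] := @approx_eig (fun n => (cx n).1) c0 (fun n => (cx n).2).
- move=> e /archi_inv[N hN]; exists N => n /hN; apply: lt_trans.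
  by case: (hcx n).
- by move=> n; case: (hcx n).
- move=> e e0; exists 0%N => n _; have [_ xc _ _] := hcx n.
  by rewrite -xc subrr hnorm0.
have l0 : l <> 0.
  by move=> l0; move: l1; rewrite l0 hnorm0// => /eqP; rewrite eq_sym oner_eq0.
have c0r := eig_real lc l0.
have ll : dot l l = 0.
  apply: (hcvg_dot hH xl) => n /=; have [_ xc x1 cN] := hcx (s n).
  have e1 : dot (cx (s n)).2 l = (cx (s n)).1 * dot (T (cx (s n)).2) l.
    by rewrite {1}xc dotZl.
  have e2 : dot (cx (s n)).2 l = c0 * dot (T (cx (s n)).2) l.
    by rewrite {1}lc dotZr// c0r T_sa.
  rewrite e1 in e2; have /eqP := e2; rewrite -subr_eq0 -mulrBl mulf_eq0 subr_eq0.
  by rewrite e1; move=> /orP[/eqP//|/eqP ->]; rewrite mulr0.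
by apply: l0; apply: (hnorm_eq0 hH); move: ll; rewrite dot_hnorm// => -[] /eqP;
  rewrite sqrf_eq0 => /eqP.
Qed.

(** An orthonormal sequence of eigenvectors would have a convergent subsequence, while its members
    stay at distance sqrt 2 from each other. *)
Lemma eig_finite_dim c : finitely_spanned (eig c).
Proof.
apply: contrapT => notfin.
have [|||e [ec e1 e0]] := orthonormal_sequence hH _ _ _ notfin.
- by move=> x y; rewrite /eig/= (linearD T) scalerDr => <- <-.
- by move=> a x; rewrite /eig/= (linearZZ T) scalerA mulrC -scalerA => <-.
- by rewrite /eig/= (linear0 T) scaler0.
have [|s hs [l [el _ _]]] := @approx_eig (fun=> c) c e (cvg_const c) e1.
  by move=> r r0; exists 0%N => n _; rewrite -ec subrr hnorm0.
have [N hN] := hcvg_cauchy hH el ltr01.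
have := hN N N.+1 (leqnn _) (leqnSn _) => /=.
suff : hnorm (e (s N) - e (s N.+1)) ^+ 2 = 2.
  have := hnorm_ge0 dot (e (s N) - e (s N.+1)).
  by set h := hnorm _ => h0 h2 h1; nra.
have e00 : dot (e (s N)) (e (s N.+1)) = 0.
  by rewrite (dotC hH (e (s N.+1))) (e0 _ _ (hs _ _ (ltnSn N))) rmorph0.
by rewrite hnormD2// hnormN// !e1 dotNr// e00 oppr0 /= expr1n mulr0 addr0.
Qed.

End Operator.

(** * Self-adjoint contractions *)

Section PolynomialCalculus.
Variables (R : realType) (V : lmodType R[i]) (dot : V -> V -> R[i]).
Hypothesis hH : hilbert dot.
Variable T : {linear V -> V}.
Local Notation hnorm := (hnorm dot).
Hypothesis T_sa : forall x y, dot (T x) y = dot x (T y).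
Hypothesis T_le1 : forall x, hnorm (T x) <= hnorm x.
Implicit Types (x y z : V) (c : R[i]) (s t k : R) (p q : {poly R[i]}).

Definition poly_app p x := \sum_(i < size p) p`_i *: iter i T x.

Lemma poly_app_widen n p x : (size p <= n)%N ->
  poly_app p x = \sum_(i < n) p`_i *: iter i T x.
Proof.
move=> pn; rewrite /poly_app (big_ord_widen n (fun i => p`_i *: iter i T x))//.
rewrite big_mkcond/=; apply: eq_bigr => i _; case: ltnP => // h.
by rewrite nth_default// scale0r.
Qed.

Lemma poly_appD p q x : poly_app (p + q) x = poly_app p x + poly_app q x.
Proof.
rewrite (@poly_app_widen (maxn (size p) (size q)) (p + q)) ?size_polyD//.
rewrite (poly_app_widen x (leq_maxl (size p) (size q))).
rewrite (poly_app_widen x (leq_maxr (size p) (size q))) -big_split/=.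
by apply: eq_bigr => i _; rewrite coefD scalerDl.
Qed.

Lemma poly_app0 x : poly_app 0 x = 0.
Proof. by rewrite /poly_app size_poly0 big_ord0. Qed.

Lemma poly_appZ c p x : poly_app (c *: p) x = c *: poly_app p x.
Proof.
rewrite (poly_app_widen x (size_scale_leq c p)) /poly_app scaler_sumr.
by apply: eq_bigr => i _; rewrite coefZ scalerA.
Qed.

Lemma poly_appN p x : poly_app (- p) x = - poly_app p x.
Proof. by rewrite -[- p]scaleN1r poly_appZ scaleN1r. Qed.

Lemma poly_appC c x : poly_app c%:P x = c *: x.
Proof.
rewrite (@poly_app_widen 1) ?size_polyC ?leq_b1//.
by rewrite big_ord_recl big_ord0 addr0 coefC.
Qed.

Lemma poly_appMX p x : poly_app (p * 'X) x = poly_app p (T x).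
Proof.
rewrite (@poly_app_widen (size p).+1); last first.
  by have [->|p0] := eqVneq p 0; rewrite ?mul0r ?size_poly0// size_mulX.
rewrite big_ord_recl coefMX/= scale0r add0r; apply: eq_bigr => i _.
by rewrite coefMX/= /bump/= -iterSr.
Qed.

Lemma poly_appX x : poly_app 'X x = T x.
Proof. by rewrite -['X]mul1r poly_appMX poly_appC scale1r. Qed.

Lemma poly_appXsub c x : poly_app ('X - c%:P) x = T x - c *: x.
Proof. by rewrite poly_appD poly_appN poly_appC poly_appX. Qed.

Lemma iterTD i x y : iter i T (x + y) = iter i T x + iter i T y.
Proof. by elim: i => //= i ->; rewrite (linearD T). Qed.

Lemma iterTZ i c x : iter i T (c *: x) = c *: iter i T x.
Proof. by elim: i => //= i ->; rewrite (linearZZ T). Qed.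

Lemma poly_app_vecD p x y : poly_app p (x + y) = poly_app p x + poly_app p y.
Proof.
by rewrite /poly_app -big_split/=; apply: eq_bigr => i _; rewrite iterTD scalerDr.
Qed.

Lemma poly_app_vecZ p c x : poly_app p (c *: x) = c *: poly_app p x.
Proof.
rewrite /poly_app scaler_sumr; apply: eq_bigr => i _.
by rewrite iterTZ !scalerA mulrC.
Qed.

Lemma poly_app_vecB p x y : poly_app p (x - y) = poly_app p x - poly_app p y.
Proof. by rewrite poly_app_vecD -scaleN1r poly_app_vecZ scaleN1r. Qed.

Lemma poly_appM p q x : poly_app (p * q) x = poly_app q (poly_app p x).
Proof.
elim/poly_ind: p x => [|p c ih] x.
  by rewrite mul0r !poly_app0 -[in RHS](scale0r x) poly_app_vecZ scale0r.
rewrite mulrDl mulrAC poly_appD poly_appMX ih mul_polyC poly_appZ.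
by rewrite poly_appD poly_appMX poly_appC poly_app_vecD poly_app_vecZ.
Qed.

Lemma poly_app_bounded p : exists2 K, 0 <= K & forall x, hnorm (poly_app p x) <= K * hnorm x.
Proof.
elim/poly_ind: p => [|p c [K K0 hK]].
  by exists 0 => // x; rewrite poly_app0 hnorm0// mul0r.
exists (K + normc c); first by rewrite addr_ge0 ?normc_ge0.
move=> x; rewrite poly_appD poly_appMX poly_appC; apply: le_trans (hnormD hH _ _) _.
rewrite mulrDl lerD ?hnormZ//; apply: le_trans (hK _) _.
by rewrite ler_wpM2l.
Qed.

Definition selfadjoint p := forall x y, dot (poly_app p x) y = dot x (poly_app p y).

Lemma selfadjointM p q : selfadjoint p -> selfadjoint q -> selfadjoint (p * q).
Proof. by move=> sp sq x y; rewrite poly_appM sq sp -poly_appM mulrC. Qed.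

Lemma selfadjointD p q : selfadjoint p -> selfadjoint q -> selfadjoint (p + q).
Proof. by move=> sp sq x y; rewrite !poly_appD dotDl// dotDr// sp sq. Qed.

Lemma selfadjointC t : selfadjoint (t%:C)%:P.
Proof. by move=> x y; rewrite !poly_appC dotZl// dotZr// /= oppr0. Qed.

Lemma selfadjointX : selfadjoint 'X.
Proof. by move=> x y; rewrite !poly_appX T_sa. Qed.

Lemma polyCrN t : - (t%:C)%:P = ((- t)%:C)%:P :> {poly R[i]}.
Proof. by rewrite rmorphN polyCN. Qed.

(** Stands for invertibility, to which it is equivalent for a polynomial in a self-adjoint
    operator. *)
Definition bounded_below p :=
  exists2 d : R, 0 < d & forall x, d * hnorm x <= hnorm (poly_app p x).

Lemma bounded_belowM p q : bounded_below p -> bounded_below q -> bounded_below (p * q).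
Proof.
move=> [d d0 hd] [e e0 he]; exists (e * d); first by rewrite mulr_gt0.
move=> x; rewrite poly_appM; apply: le_trans (he _).
by rewrite -mulrA ler_wpM2l// ltW.
Qed.

Lemma bounded_belowC c : c != 0 -> bounded_below c%:P.
Proof.
move=> c0; exists (normc c); last by move=> x; rewrite poly_appC hnormZ.
rewrite lt_neqAle normc_ge0 andbT eq_sym; apply/eqP => /eq0_normc/eqP.
by rewrite (negbTE c0).
Qed.

Lemma bounded_below_prod (r : seq R[i]) :
  (forall c, c \in r -> bounded_below ('X - c%:P)) ->
  bounded_below (\prod_(c <- r) ('X - c%:P)).
Proof.
elim: r => [|z r ih] h.
  by rewrite big_nil; apply: bounded_belowC; exact: oner_neq0.
rewrite big_cons; apply: bounded_belowM; first by apply: h; rewrite inE eqxx.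
by apply: ih => w wr; apply: h; rewrite inE wr orbT.
Qed.

(** [dot (T x) x] is real, so the imaginary part of [dot (T x - c *: x) x] is that of [- c] times
    the squared norm of [x]. *)
Lemma bounded_below_nonreal c : complex.Im c != 0 -> bounded_below ('X - c%:P).
Proof.
move=> c0; exists `|complex.Im c|; first by rewrite normr_gt0.
move=> x; rewrite poly_appXsub.
have [->|x0] := pselect (x = 0); first by rewrite hnorm0// mulr0 hnorm_ge0.
rewrite -(ler_pM2r (hnorm_gt0 hH x0)); apply: le_trans (cauchy_schwarz hH _ _).
apply: le_trans (ler_Im_normc _).
rewrite dotBl// dotZl// (dot_T_real hH T_sa) dot_hnorm//.
rewrite -mulrA -expr2 -[X in _ * X]ger0_norm ?sqr_ge0// -normrM.
rewrite [X in _ <= `|X|](_ : _ = - (complex.Im c * hnorm x ^+ 2)) ?normrN//.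
by case: c c0 => a b /= _; rewrite mulr0 add0r add0r.
Qed.

(** For a self-adjoint operator this is the whole spectrum, nonreal points being excluded by
    [bounded_below_nonreal]. *)
Definition approx_spectrum : set R := [set s | ~ bounded_below ('X - (s%:C)%:P)].

Lemma approx_spectrum_le1 s : approx_spectrum s -> s <= 1.
Proof.
move=> hs; rewrite leNgt; apply/negP => s1; apply: hs.
exists (s - 1); first by rewrite subr_gt0.
move=> x; rewrite poly_appXsub hnormB//; have := T_le1 x.
have := ler_hnormB hH (s%:C *: x) (T x); rewrite hnormZ// normc_real (@ger0_norm _ s); last lra.
have := ler_norm (s * hnorm x - hnorm (T x)); lra.
Qed.

Lemma approx_spectrum_open s : ~ approx_spectrum s ->
  exists2 e : R, 0 < e & forall t, `|t - s| < e -> ~ approx_spectrum t.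
Proof.
move=> /contrapT[d d0 hd]; exists (d / 2); first by rewrite divr_gt0.
move=> t ts; apply; exists (d / 2); first by rewrite divr_gt0.
move=> x; rewrite poly_appXsub; have := hd x; rewrite poly_appXsub.
have -> : T x - s%:C *: x = T x - t%:C *: x + (t - s)%:C *: x.
  by rewrite rmorphB scalerBl addrA subrK.
move=> h; have := le_trans h (hnormD hH _ _); rewrite hnormZ// normc_real.
have := ler_wpM2r (hnorm_ge0 dot x) (ltW ts); lra.
Qed.

(** A closed discrete subset of a bounded interval is finite. Concretely, the supremum of the [u]
    for which the spectrum between [s0] and [u] is finite can be exceeded, by isolation if it is a
    spectral point and by openness of the complement if not. *)
Lemma approx_spectrum_finite s0 :
  (forall s, s0 <= s -> approx_spectrum s -> exists2 e : R, 0 < e &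
     forall t, approx_spectrum t -> `|t - s| < e -> t = s) ->
  exists r : seq R, forall t, approx_spectrum t -> s0 <= t -> t \in r.
Proof.
move=> iso.
pose P u := exists r : seq R, forall t, approx_spectrum t -> s0 <= t <= u -> t \in r.
suff [r hr] : P 1.
  exists r => t St s0t; apply: hr => //; rewrite s0t/=.
  exact: approx_spectrum_le1.
have Pmono u v : u <= v -> P v -> P u.
  move=> uv [r hr]; exists r => t St /andP[a b]; apply: hr => //.
  by rewrite a (le_trans b).
apply: contrapT => P1.
pose E := [set u | s0 <= u /\ P u].
have E0 : E s0.
  split=> //; exists [:: s0] => t _ h; rewrite inE eq_le andbC.
  by case/andP: h => -> ->.
have ubE : ubound E 1.
  move=> u [_ Pu]; rewrite leNgt; apply/negP => u1; apply: P1.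
  exact: Pmono (ltW u1) Pu.
have supE : has_sup E by split; [exists s0|exists 1].
set u := sup E.
have s0u : s0 <= u by apply: (ub_le_sup _ E0); exists 1.
have [e e0 he] : exists2 e : R, 0 < e &
    forall t, approx_spectrum t -> `|t - u| < e -> t = u.
  have [Su|/approx_spectrum_open[e e0 he]] := pselect (approx_spectrum u).
    exact: iso.
  by exists e => // t St /he.
have [v [s0v [r hr]] uv] := sup_adherent e0 supE.
have : E (u + e / 2).
  split; first by rewrite ler_wpDr// divr_ge0// ltW.
  exists (u :: r) => t St /andP[s0t tu]; rewrite inE.
  have [tv|vt] := leP t v; first by rewrite hr ?orbT ?s0t.
  by rewrite (he t)// ?eqxx// ltr_norml; apply/andP; split; rewrite -/u in uv; lra.
have := @ub_le_sup _ E (ex_intro _ 1 ubE) (u + e / 2); rewrite -/u => h /h.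
lra.
Qed.

(* A negative infimum k of the form of p(T) on the unit sphere would be an
   approximate eigenvalue, by Cauchy-Schwarz for the semi-definite p(T) - k. *)
Lemma selfadjoint_form_ge0 p : selfadjoint p ->
  (forall k, k < 0 -> bounded_below (p - (k%:C)%:P)) ->
  forall x, 0 <= complex.Re (dot (poly_app p x) x).
Proof.
move=> sp bb.
suff unit1 : forall x, hnorm x = 1 -> 0 <= complex.Re (dot (poly_app p x) x).
  move=> x; have [->|x0] := pselect (x = 0); first by rewrite dot0r.
  have := unit1 _ (normalize hH x0).
  rewrite poly_app_vecZ dotZl// dotZr// (_ : conjc _ = (hnorm x)^-1%:C); last by rewrite /= oppr0.
  by rewrite !cReZ mulrA pmulr_rge0// mulr_gt0// invr_gt0 hnorm_gt0.
move=> x1 hx1; rewrite leNgt; apply/negP => neg.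
have [K K0 hK] := poly_app_bounded p.
pose S := [set complex.Re (dot (poly_app p x) x) | x in [set x | hnorm x = 1]].
have S1 : S (complex.Re (dot (poly_app p x1) x1)) by exists x1.
have lbS : lbound S (- K).
  move=> _ [x /= hx <-]; have := le_trans (ler_Re_normc _) (cauchy_schwarz hH (poly_app p x) x).
  by have := hK x; rewrite hx !mulr1 ler_norml => a /andP[b _]; lra.
have infS : has_inf S by split; [exists (complex.Re (dot (poly_app p x1) x1))|exists (- K)].
set k := inf S.
have kS x : hnorm x = 1 -> k <= complex.Re (dot (poly_app p x) x).
  by move=> hx; apply: ge_inf; [exists (- K)|exists x].
have k0 : k < 0 by apply: le_lt_trans neg; exact: kS.
pose q := p - (k%:C)%:P.
have sq : selfadjoint q by rewrite /q polyCrN; apply: selfadjointD => //; exact: selfadjointC.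
have qE x : complex.Re (dot (poly_app q x) x) = complex.Re (dot (poly_app p x) x) - k * hnorm x ^+ 2.
  by rewrite poly_appD poly_appN poly_appC dotBl// dotZl// dot_hnorm// cReD cReN cReZ.
have q0 x : 0 <= complex.Re (dot (poly_app q x) x).
  rewrite qE; have [->|x0] := pselect (x = 0).
    by rewrite dot0r// hnorm0// expr0n/= mulr0 subr0.
  have := kS _ (normalize hH x0).
  rewrite poly_app_vecZ dotZl// dotZr// (_ : conjc _ = (hnorm x)^-1%:C); last by rewrite /= oppr0.
  have hx := hnorm_gt0 hH x0.
  rewrite !cReZ mulrA -invfM mulrC ler_pdivlMr ?mulr_gt0// -expr2 => h.
  by rewrite subr_ge0.
have qCS x y : complex.Re (dot (poly_app q x) y) ^+ 2 <=
    complex.Re (dot (poly_app q y) y) * complex.Re (dot (poly_app q x) x).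
  apply: discriminant (q0 y) _ => t; have := q0 (x + t%:C *: y).
  rewrite poly_app_vecD poly_app_vecZ (dotDl hH) !(dotDr hH) !(dotZl hH) !(dotZr hH).
  rewrite (_ : conjc t%:C = t%:C); last by rewrite /= oppr0.
  rewrite !cReD !cReZ (rdotC hH (poly_app q y) x) -sq.
  by lra.
have [L L0 hL] := poly_app_bounded q.
(* Cauchy-Schwarz for the form of [q], applied to [x] and its image under q(T), then divided by the
   squared norm of that image. *)
have qn x : hnorm (poly_app q x) ^+ 2 <= L * complex.Re (dot (poly_app q x) x).
  have := qCS x (poly_app q x); rewrite -hnorm2// => h.
  have [->|n0] := eqVneq (hnorm (poly_app q x)) 0; first by rewrite expr0n mulr_ge0.
  have np : 0 < hnorm (poly_app q x) ^+ 2.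
    by rewrite exprn_gt0// lt_neqAle eq_sym n0 hnorm_ge0.
  rewrite -(ler_pM2r np) -expr2; apply: le_trans h _.
  rewrite [X in _ <= X]mulrAC; apply: ler_wpM2r => //.
  apply: le_trans (ler_norm _) _; apply: le_trans (ler_Re_normc _) _.
  apply: le_trans (cauchy_schwarz hH _ _) _; rewrite expr2 mulrA ler_wpM2r ?hnorm_ge0//.
have [d d0 hd] := bb k k0.
(* A unit vector whose form value lies within this distance of [k] is mapped by q(T) to a vector
   shorter than [d]. *)
have e0 : 0 < d ^+ 2 / (L + 1) by rewrite divr_gt0 ?exprn_gt0// ltr_wpDl.
have [_ [x /= hx <-] xk] := inf_adherent e0 infS.
have h1 := qn x; have h2 := hd x; rewrite qE hx expr1n in h1; rewrite hx in h2.
rewrite -/k -/q mulr1 in h1 h2 xk.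
have h3 : d ^+ 2 <= hnorm (poly_app q x) ^+ 2 by rewrite ler_pXn2r ?nnegrE ?hnorm_ge0// ltW.
have h4 : complex.Re (dot (poly_app p x) x) - k < d ^+ 2 / (L + 1) by lra.
have h5 : L * (complex.Re (dot (poly_app p x) x) - k) <= L * (d ^+ 2 / (L + 1)).
  by rewrite ler_wpM2l// ltW.
have h6 : L * (d ^+ 2 / (L + 1)) < d ^+ 2.
  rewrite mulrA ltr_pdivrMr ?ltr_wpDl// mulrC ltr_pM2l ?exprn_gt0//; lra.
by lra.
Qed.

(** For [k < 0] the polynomial p - k splits into linear factors over the complex numbers. Factors
    with a nonreal root are bounded below, and a real root has p equal to k < 0 there, so it lies
    outside the spectrum. [1 < size p] keeps p - k nonzero. *)
Lemma spectral_positivity p : (1 < size p)%N -> selfadjoint p ->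
  (forall t, approx_spectrum t -> 0 <= complex.Re p.[t%:C]) ->
  forall x, 0 <= complex.Re (dot (poly_app p x) x).
Proof.
move=> size_p sp p0; apply: selfadjoint_form_ge0 => // k k0.
set q := p - _.
have q0 : q != 0.
  apply/eqP => /eqP; rewrite subr_eq0 => /eqP pE.
  by move: size_p; rewrite pE size_polyC; case: (_ == _).
have [r qE] := closed_field_poly_normal q.
rewrite qE -mul_polyC; apply: bounded_belowM.
  by apply: bounded_belowC; rewrite lead_coef_eq0.
apply: bounded_below_prod => z zr.
have [z0|z0] := eqVneq (complex.Im z) 0; last exact: bounded_below_nonreal.
have zE : z = (complex.Re z)%:C by case: z z0 {zr} => a b /= ->.
have rz : root q z.
  rewrite qE rootZ ?lead_coef_eq0// root_prod_XsubC.
  exact: zr.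
apply: contrapT => nb.
rewrite zE in nb; have := p0 _ nb; rewrite -zE.
have -> : p.[z] = k%:C.
  by apply/eqP; rewrite -subr_eq0; move: rz; rewrite /root /q hornerD hornerN hornerC.
by rewrite /= leNgt k0.
Qed.

(** Simple roots make the kernel of the product the sum of the eigenspaces: the remaining factors
    [N] send [x] to an eigenvector for [s], on which N(T) acts as the nonzero number N(s), and
    subtracting the matching multiple of it from [x] leaves an element of the kernel of N(T). *)
Lemma polynomial_kernel (r : seq R) y : uniq r ->
  (forall s, s \in r -> forall x, T x = s%:C *: x -> dot y x = 0) ->
  forall x, poly_app (\prod_(s <- r) ('X - (s%:C)%:P)) x = 0 -> dot y x = 0.
Proof.
elim: r => [|s r ih] /=.
  by move=> _ _ x; rewrite big_nil poly_appC scale1r => ->; rewrite dot0r.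
move=> /andP[sr ur] hy x; rewrite big_cons mulrC; set N := \prod_(_ <- _) _.
rewrite poly_appM poly_appXsub => /eqP; rewrite subr_eq0 => /eqP Nx.
have Ns q : poly_app q (poly_app N x) = q.[s%:C] *: poly_app N x.
  elim/poly_ind: q => [|q c ihq]; first by rewrite poly_app0 horner0 scale0r.
  by rewrite poly_appD poly_appMX poly_appC Nx poly_app_vecZ ihq hornerMXaddC scalerDl scalerA mulrC.
have N0 : N.[s%:C] != 0.
  rewrite /N horner_prod prodf_seq_neq0; apply/allP => t tr /=.
  rewrite hornerXsubC subr_eq0 (inj_eq (@complexI R)).
  by apply: contraNneq sr => ->.
have yN : dot y (poly_app N x) = 0 by apply: (hy s); rewrite ?inE ?eqxx.
have : dot y (x - N.[s%:C]^-1 *: poly_app N x) = 0.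
  apply: ih => // [t tr|]; first by apply: hy; rewrite inE tr orbT.
  by rewrite poly_app_vecB poly_app_vecZ Ns scalerA mulVf// scale1r subrr.
by rewrite dotBr// dotZr// yN mulr0 subr0.
Qed.

(** By self-adjointness the component of [y] orthogonal to the range lies in the kernel, so it is
    also orthogonal to [y] and vanishes. *)
Lemma range_closure N y : selfadjoint N ->
  (forall x, poly_app N x = 0 -> dot y x = 0) ->
  exists u : nat -> V, hcvg dot (poly_app N \o u) y.
Proof.
move=> sN hy.
have [|||p [[m Mm mp] orth]] := @projection _ _ _ hH (range (poly_app N)) _ _ _ y.
- by exists 0 => //; rewrite -(scale0r 0) poly_app_vecZ !scale0r.
- by move=> _ _ [a _ <-] [b _ <-]; exists (a + b); rewrite ?poly_app_vecD.
- by move=> a _ [b _ <-]; exists (a *: b); rewrite ?poly_app_vecZ.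
have Nz : poly_app N (y - p) = 0.
  apply: (hnorm_eq0 hH); apply/eqP; rewrite -sqrf_eq0 hnorm2//.
  by rewrite sN orth.
have yp : y = p.
  apply/eqP; rewrite -subr_eq0; apply/eqP/(hnorm_eq0 hH)/eqP.
  rewrite -sqrf_eq0 hnorm2// dotBl// hy//.
  by rewrite (hcvg_dot hH mp) ?subrr// => n; rewrite dotC// orth ?rmorph0.
have /choice[x hx] : forall n, exists x, poly_app N x = m n.
  by move=> n; have [x _ <-] := Mm n; exists x.
exists x => e; rewrite yp => /mp[K hK]; exists K => n /hK.
by rewrite /= hx.
Qed.

Lemma form_le_closure s (u : nat -> V) y : hcvg dot u y ->
  (forall n, complex.Re (dot (T (u n)) (u n)) <= s * hnorm (u n) ^+ 2) ->
  complex.Re (dot (T y) y) <= s * hnorm y ^+ 2.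
Proof.
move=> uy us; pose B x := s%:C *: x - T x.
have BB x z : B x - B z = B (x - z).
  by rewrite /B scalerBr (linearB T) !opprD !opprK addrACA.
have Bn x : hnorm (B x) <= (`|s| + 1) * hnorm x.
  rewrite /B; apply: le_trans (hnormD hH _ _) _.
  by rewrite hnormN// hnormZ// normc_real mulrDl mul1r lerD2l.
have BE x : complex.Re (dot (B x) x) = s * hnorm x ^+ 2 - complex.Re (dot (T x) x).
  by rewrite /B dotBl// dotZl// dot_hnorm// cReD cReN cReZ.
suff : 0 <= complex.Re (dot (B y) y) by rewrite BE subr_ge0.
apply/ler_addgt0Pr => e e0; set L := `|s| + 1.
have L0 : 0 < L by rewrite ltr_wpDl.
have D0 : 0 < L * (2 * hnorm y + 1) by rewrite mulr_gt0// ltr_wpDl// mulr_ge0// hnorm_ge0.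
(* The bound 1 gives [hnorm v <= hnorm y + 1]; the other one absorbs the two error terms, at most
   [L * h * (hnorm y + 1)] and [L * hnorm y * h]. *)
have d0 : 0 < Num.min 1 (e / (L * (2 * hnorm y + 1))).
  by rewrite lt_min ltr01 divr_gt0.
have [N /(_ N (leqnn N))] := uy _ d0; rewrite lt_min => /andP[h1 h2].
set v := u N in h1 h2.
have Bv : 0 <= complex.Re (dot (B v) v) by rewrite BE subr_ge0 us.
have vy : hnorm v <= hnorm y + 1.
  by have := hnormD hH (v - y) y; rewrite subrK; lra.
have : complex.Re (dot (B v) v) - complex.Re (dot (B y) y) <= e; last by lra.
have -> : complex.Re (dot (B v) v) - complex.Re (dot (B y) y) =
    complex.Re (dot (B (v - y)) v) + complex.Re (dot (B y) (v - y)).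
  by rewrite -BB (dotBl hH (B v) (B y)) (dotBr hH (B y) v y) !cReD !cReN; ring.
have a1 := le_trans (ler_norm _) (le_trans (ler_Re_normc _) (cauchy_schwarz hH (B (v - y)) v)).
have a2 := le_trans (ler_norm _) (le_trans (ler_Re_normc _) (cauchy_schwarz hH (B y) (v - y))).
have b1 := ler_pM (hnorm_ge0 _ _) (hnorm_ge0 _ _) (Bn (v - y)) vy.
have b2 := ler_wpM2r (hnorm_ge0 dot (v - y)) (Bn y).
rewrite ltr_pdivlMr// in h2; rewrite -/L in b1 b2; set h := hnorm (v - y) in h2 b1 b2 a1 a2 *.
have : L * h * (hnorm y + 1) + L * hnorm y * h = h * (L * (2 * hnorm y + 1)) by ring.
lra.
Qed.

(** There is one vector more than there are conditions: the coefficients are a nonzero element of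
    the left kernel of a matrix with more rows than columns, and orthonormality keeps the
    combination nonzero. *)
Lemma orthogonal_combination (f : nat -> V) (b : seq V) :
  (forall m n, dot (f m) (f n) = (m == n)%:R) ->
  exists n (c : 'I_n -> R[i]), let y := \sum_(i < n) c i *: f i in
    y <> 0 /\ forall x, x \in b -> dot y x = 0.
Proof.
move=> fo; pose d := size b.
pose A : 'M[R[i]]_(d.+1, d) := \matrix_(i, j) dot (f i) (tnth (in_tuple b) j).
have kA : kermx A != 0.
  rewrite kermx_eq0 /row_free neq_ltn; apply/orP; left.
  by rewrite ltnS rank_leq_col.
have [v /sub_kermxP vA v0] := rowV0Pn kA.
exists d.+1, (fun i => v 0 i) => y; split=> [y0|x xb].
  move: v0 => /negP; apply; apply/eqP/rowP => j; rewrite mxE.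
  have : dot y (f j) = v 0 j.
    rewrite /y dot_suml// (bigD1 j)//= dotZl// fo eqxx mulr1 big1 ?addr0// => i ij.
    by rewrite dotZl// fo (inj_eq val_inj) (negbTE ij) mulr0.
  by rewrite y0 dot0l.
have [j ->] : exists j, x = tnth (in_tuple b) j.
  by have /tnthP[j ->] : x \in in_tuple b by []; exists j.
move/rowP: vA => /(_ j); rewrite !mxE => <-; rewrite /y dot_suml//.
by apply: eq_bigr => i _; rewrite dotZl// mxE.
Qed.

(* Otherwise the spectrum in [s1/2, 1] consists of finitely many eigenvalues of
   finite multiplicity. Let N be the polynomial vanishing on them. Since
   (s1/2 - X) N^2 is nonnegative on the whole spectrum, <T y, y> <= s1/2 ||y||^2 on
   the closure of the range of N(T), that is on the complement of the eigenspaces,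
   and this complement contains a nonzero combination of the f n. *)
Lemma no_isolated_spectrum (f : nat -> V) s1 : 0 < s1 ->
  (forall m n, dot (f m) (f n) = (m == n)%:R) ->
  (forall n (c : 'I_n -> R[i]), let y := \sum_(i < n) c i *: f i in
     s1 * hnorm y ^+ 2 <= complex.Re (dot (T y) y)) ->
  exists2 s, 0 < s & approx_spectrum s /\
    ~ ((exists2 e : R, 0 < e & forall t, approx_spectrum t -> `|t - s| < e -> t = s) /\
       finitely_spanned [set x | T x = s%:C *: x]).
Proof.
move=> s1_gt0 fo fT; apply: contrapT => hN.
have h s : 0 < s -> approx_spectrum s ->
    (exists2 e : R, 0 < e & forall t, approx_spectrum t -> `|t - s| < e -> t = s) /\
       finitely_spanned [set x | T x = s%:C *: x].
  by move=> s0 Ss; apply: contrapT => h; apply: hN; exists s.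
pose s0 := s1 / 2; have s0_gt0 : 0 < s0 by rewrite divr_gt0.
have [r hr] : exists r : seq R, forall t, approx_spectrum t -> s0 <= t -> t \in r.
  apply: approx_spectrum_finite => s s0s Ss.
  by have [] := h s (lt_le_trans s0_gt0 s0s) Ss.
(* Only spectral points are kept, since these have finite-dimensional eigenspaces, and duplicates
   are removed so that [N] has simple roots. *)
pose r' := undup [seq s <- r | `[< approx_spectrum s >] && (s0 <= s)].
have r'P s : s \in r' -> approx_spectrum s /\ s0 <= s.
  by rewrite mem_undup mem_filter => /andP[/andP[/asboolP]].
have hr' t : approx_spectrum t -> s0 <= t -> t \in r'.
  by move=> St s0t; rewrite mem_undup mem_filter s0t hr// !andbT; apply/asboolP.
(* [b] joins spanning families of all these eigenspaces, which turns orthogonality to them into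
   finitely many conditions. *)
have [b hb] : exists b : seq V, forall y, (forall v, v \in b -> dot y v = 0) ->
    forall s, s \in r' -> forall x, T x = s%:C *: x -> dot y x = 0.
  elim: (r') r'P => [|s r2 ih] hr2; first by exists [::].
  have [|b hb] := ih; first by move=> t tr; apply: hr2; rewrite inE tr orbT.
  have [Ss s0s] := hr2 s (mem_head _ _).
  have [_ [n [bs [_ hbs]]]] := h s (lt_le_trans s0_gt0 s0s) Ss.
  exists ([seq bs i | i <- enum 'I_n] ++ b) => y hy t; rewrite inE => /predU1P[->|tr2].
    move=> x /hbs[c ->]; rewrite dot_sumr// big1// => i _; rewrite dotZr// hy ?mulr0//.
    by rewrite mem_cat map_f ?mem_enum.
  by apply: hb tr2 => v vb; apply: hy; rewrite mem_cat vb orbT.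
have [n [c []]] := orthogonal_combination b fo; set y := \sum_(_ < _) _ => y0 yb.
pose N := \prod_(s <- r') ('X - (s%:C)%:P) : {poly R[i]}.
have sN : selfadjoint N.
  rewrite /N; elim: (r') => [|s r2 ih].
    by rewrite big_nil -[1]/1%:P -(rmorph1 (real_complex R)); exact: selfadjointC.
  rewrite big_cons; apply: selfadjointM => //; rewrite polyCrN.
  by apply: selfadjointD; [exact: selfadjointX|exact: selfadjointC].
have [u uy] := range_closure sN (polynomial_kernel (undup_uniq _) (hb y yb)).
pose L := (s0%:C)%:P - 'X : {poly R[i]}.
have LX : L = - ('X - (s0%:C)%:P) by rewrite opprB.
have sL : selfadjoint L.
  move=> x z; rewrite LX !poly_appN dotNl// dotNr//; congr (- _).
  by rewrite polyCrN; apply: selfadjointD; [exact: selfadjointX|exact: selfadjointC].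
have Nt (t : R) : exists a : R, N.[t%:C] = a%:C.
  exists (\prod_(s <- r') (t - s)); rewrite rmorph_prod /N horner_prod.
  by apply: eq_bigr => s _; rewrite hornerXsubC rmorphB.
have N0 : N != 0.
  by rewrite /N prodf_seq_neq0; apply/allP => s _ /=; rewrite polyXsubC_eq0.
have Q0 x : 0 <= complex.Re (dot (poly_app (L * (N * N)) x) x).
  apply: spectral_positivity.
  - rewrite LX mulNr size_polyN size_mul ?mulf_neq0 ?polyXsubC_eq0// size_XsubC add2n.
    by rewrite ltnS lt0n size_poly_eq0 mulf_neq0.
  - by apply: selfadjointM sL (selfadjointM sN sN).
  - move=> t St; have [s0t|ts0] := leP s0 t.
      have Nt0 : N.[t%:C] = 0.
        rewrite /N horner_prod; apply/eqP; rewrite prodf_seq_eq0.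
        by apply/hasP; exists t; [exact: hr'|rewrite /= hornerXsubC subrr].
      by rewrite !hornerM Nt0 !mulr0.
    have [a Na] := Nt t; rewrite !hornerM Na /L hornerD hornerN hornerX hornerC.
    rewrite -!rmorphM -rmorphB -rmorphM /= mulr_ge0// ?subr_ge0 ?(ltW ts0)//.
    by rewrite -expr2 sqr_ge0.
have : complex.Re (dot (T y) y) <= s0 * hnorm y ^+ 2.
  apply: form_le_closure uy _ => i /=; have := Q0 (u i).
  rewrite mulrC -mulrA poly_appM mulrC poly_appM sN; set w := poly_app N (u i).
  by rewrite LX poly_appN poly_appXsub opprB dotBl// dotZl// dot_hnorm// cReD cReN cReZ subr_ge0.
have := fT n c; rewrite -/y.
have : 0 < hnorm y ^+ 2 by rewrite exprn_gt0// hnorm_gt0.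
by rewrite /s0; nra.
Qed.

End PolynomialCalculus.

(** * Operators associated with quadratic forms *)

Section SemiHilbert.
Variables (R : realType) (F : lmodType R[i]) (X : set F) (sdot : F -> F -> R[i]).

Definition snorm (x : F) : R := Num.sqrt (complex.Re (sdot x x)).

(** Null vectors are allowed, and every law is restricted to [X]: the integrals behind [L2dot] are
    only known to converge on square-integrable functions. *)
Record semi_hilbert : Prop := SemiHilbert {
  sh0 : X 0;
  shD : forall x y, X x -> X y -> X (x + y);
  shZ : forall (c : R[i]) x, X x -> X (c *: x);
  sdotDl : forall x y z, X x -> X y -> X z -> sdot (x + y) z = sdot x z + sdot y z;
  sdotZl : forall (c : R[i]) x y, X x -> X y -> sdot (c *: x) y = c * sdot x y;
  sdotC : forall x y, X x -> X y -> sdot y x = conjc (sdot x y);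
  sdot_ge0 : forall x, X x -> 0 <= complex.Re (sdot x x);
  scomplete : forall u : nat -> F, (forall n, X (u n)) ->
    (forall e : R, 0 < e -> exists N, forall m n, (N <= m)%N -> (N <= n)%N ->
       snorm (u m - u n) < e) ->
    exists2 l, X l & forall e : R, 0 < e -> exists N, forall n, (N <= n)%N ->
       snorm (u n - l) < e }.

Lemma shB (sH : semi_hilbert) x y : X x -> X y -> X (x - y).
Proof. by move=> Xx Xy; apply: (shD sH) => //; rewrite -scaleN1r; exact: shZ. Qed.

(* X modulo null vectors, without a quotient type: the class of x is represented
   by the functional <x, .>, extended by 0 outside X. *)
Definition functional (x : F) : F -> R[i] :=
  fun y => if `[< X y >] then sdot x y else 0.

Definition functionals (sH : semi_hilbert) : {pred F -> R[i]} :=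
  mem [set phi | exists2 x, X x & phi = functional x].

Lemma functionals_submod (sH : semi_hilbert) : submod_closed (functionals sH).
Proof.
split=> [|c _ _ /set_mem[x Xx ->] /set_mem[y Xy ->]].
  apply/mem_set; exists 0; first exact: sh0.
  apply/funext => y; rewrite /functional; case: asboolP => // Xy.
  by have := sdotZl sH 0 Xy Xy; rewrite scale0r mul0r.
apply/mem_set; exists (c *: x + y); first by apply: (shD sH) => //; exact: shZ.
apply/funext => z; rewrite /functional !fctE; case: asboolP => Xz.
  by rewrite (sdotDl sH)// ?(sdotZl sH)//; exact: shZ.
by rewrite addr0 scaler0.
Qed.

HB.instance Definition _ sH := GRing.isSubmodClosed.Build R[i] (F -> R[i])
  (functionals sH) (functionals_submod sH).

Definition hquot (sH : semi_hilbert) := {phi : F -> R[i] | phi \in functionals sH}.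

HB.instance Definition _ sH := SubType.on (hquot sH).
HB.instance Definition _ sH := Choice.on (hquot sH).
HB.instance Definition _ sH := [SubChoice_isSubLmodule of hquot sH by <:].

Variable sH : semi_hilbert.
Local Notation H := (hquot sH).

Definition hpi (x : F) : H := insubd 0 (functional x).

Definition hrep (h : H) : F := s2val (cid2 (set_mem (valP h))).

Definition hdot (h k : H) : R[i] := sdot (hrep h) (hrep k).

Lemma val_hpi x : X x -> val (hpi x) = functional x.
Proof. by move=> Xx; rewrite insubdK//; apply/mem_set; exists x. Qed.

Lemma hrepX h : X (hrep h).
Proof. by rewrite /hrep; case: cid2. Qed.

Lemma hrepK h : hpi (hrep h) = h.
Proof.
by apply: val_inj; rewrite val_hpi ?hrepX//; rewrite /hrep; case: cid2.
Qed.

Lemma hpi_inj x y z : X x -> X y -> X z -> hpi x = hpi y -> sdot x z = sdot y z.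
Proof.
move=> Xx Xy Xz /(congr1 val); rewrite !val_hpi// => /(congr1 (@^~ z)).
by rewrite /functional asboolT.
Qed.

(** The product of chosen representatives depends on the classes only; conjugate symmetry carries
    this from the first argument to the second. *)
Lemma hdotE x y : X x -> X y -> hdot (hpi x) (hpi y) = sdot x y.
Proof.
move=> Xx Xy; rewrite /hdot.
rewrite (hpi_inj (hrepX _) Xx (hrepX (hpi y)) (hrepK (hpi x))).
rewrite (sdotC sH (hrepX (hpi y)) Xx).
by rewrite (hpi_inj (hrepX _) Xy Xx (hrepK (hpi y))) -(sdotC sH Xy Xx).
Qed.

Lemma hpiD x y : X x -> X y -> hpi (x + y) = hpi x + hpi y.
Proof.
move=> Xx Xy; apply: val_inj; rewrite /= !val_hpi//; last exact: (shD sH).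
apply/funext => z; rewrite /functional !fctE; case: asboolP => Xz.
  exact: (sdotDl sH).
by rewrite addr0.
Qed.

Lemma hpiZ c x : X x -> hpi (c *: x) = c *: hpi x.
Proof.
move=> Xx; apply: val_inj; rewrite /= !val_hpi//; last exact: (shZ sH).
apply/funext => z; rewrite /functional !fctE; case: asboolP => Xz.
  exact: (sdotZl sH).
by rewrite scaler0.
Qed.

Lemma hpiB x y : X x -> X y -> hpi (x - y) = hpi x - hpi y.
Proof.
move=> Xx Xy; rewrite hpiD//; last by rewrite -scaleN1r; exact: (shZ sH).
by rewrite -scaleN1r hpiZ// scaleN1r.
Qed.

Lemma hpi0 : hpi 0 = 0.
Proof. by rewrite -(scale0r (0 : F)) hpiZ ?scale0r//; exact: (sh0 sH). Qed.

Lemma hpi_sum I (r : seq I) (G : I -> F) : (forall i, X (G i)) ->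
  X (\sum_(i <- r) G i) /\ hpi (\sum_(i <- r) G i) = \sum_(i <- r) hpi (G i).
Proof.
move=> XG; elim: r => [|i r [ih1 ih2]]; first by rewrite !big_nil hpi0; split=> //; exact: (sh0 sH).
by rewrite !big_cons hpiD// ih2; split=> //; exact: (shD sH).
Qed.

Lemma hnorm_hpi x : X x -> hnorm hdot (hpi x) = snorm x.
Proof. by move=> Xx; rewrite /hnorm hdotE. Qed.

Lemma hilbert_hdot : hilbert hdot.
Proof.
have hdE h k : exists x y, [/\ X x, X y, h = hpi x & k = hpi y].
  by exists (hrep h), (hrep k); rewrite !hrepK; split=> //; exact: hrepX.
split.
- move=> h k l; have [x [y [Xx Xy -> ->]]] := hdE h k.
  have [z [_ [Xz _ -> _]]] := hdE l l.
  by rewrite -hpiD// !hdotE//; [exact: (sdotDl sH)|exact: (shD sH)].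
- move=> c h k; have [x [y [Xx Xy -> ->]]] := hdE h k.
  by rewrite -hpiZ// !hdotE//; [exact: (sdotZl sH)|exact: (shZ sH)].
- move=> h k; exact: (sdotC sH (hrepX _) (hrepX _)).
- by move=> h; apply: (sdot_ge0 sH); exact: hrepX.
(* Cauchy-Schwarz for the semi-definite product: a null vector is orthogonal to all of [X], so its
   functional is 0. *)
- move=> h; have [x [_ [Xx _ -> _]]] := hdE h h; rewrite hdotE// => x0.
  apply: val_inj; rewrite val_hpi//=; apply/funext => y; rewrite /functional.
  case: asboolP => // Xy.
  have sq k : complex.Re (sdot x y) ^+ 2 <= 0 -> complex.Re (sdot x y) = 0.
    by move=> h0; apply/eqP; rewrite -sqrf_eq0 eq_le h0 sqr_ge0.
  have key z : X z -> complex.Re (sdot x z) = 0.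
    move=> Xz; suff : complex.Re (sdot x z) ^+ 2 <= complex.Re (sdot z z) * complex.Re (sdot x x).
      by rewrite x0 mulr0 => h0; apply/eqP; rewrite -sqrf_eq0 eq_le h0 sqr_ge0.
    apply: discriminant => [|t]; first exact: (sdot_ge0 sH).
    have Xtz : X (t%:C *: z) by exact: (shZ sH).
    have := sdot_ge0 sH (shD sH Xx Xtz).
    rewrite (sdotDl sH)//; last exact: (shD sH).
    rewrite (sdotZl sH) //; last exact: (shD sH).
    rewrite (sdotC sH (shD sH Xx Xtz) Xx) (sdotC sH (shD sH Xx Xtz) Xz).
    rewrite !(sdotDl sH)// !(sdotZl sH)// cReD cReZ !cRe_conj !cReD !cReZ.
    rewrite (sdotC sH Xx Xz) cRe_conj; lra.
  apply/eqP; rewrite eq_complex key//= eqxx/=.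
  have := key _ (shZ sH 'i Xy); rewrite (sdotC sH (shZ sH 'i Xy) Xx) (sdotZl sH)//.
  rewrite (sdotC sH Xx Xy) cRe_conj; case: (sdot x y) => a b /= h0.
  by apply/eqP; lra.
- move=> u cu.
  have [||l Xl ul] := scomplete sH (u := fun n => hrep (u n)).
  + by move=> n; exact: hrepX.
  + move=> e /cu[N hN]; exists N => m n Nm Nn; have := hN _ _ Nm Nn.
    have -> : u m - u n = hpi (hrep (u m) - hrep (u n)).
      by rewrite hpiB ?hrepK//; exact: hrepX.
    by rewrite hnorm_hpi//; apply: (shB sH); exact: hrepX.
  exists (hpi l) => e /ul[N hN]; exists N => n /hN.
  have -> : u n - hpi l = hpi (hrep (u n) - l).
    by rewrite hpiB ?hrepK//; exact: hrepX.
  by rewrite hnorm_hpi//; apply: (shB sH) => //; exact: hrepX.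
Qed.

Lemma snorm_ge0 x : 0 <= snorm x.
Proof. exact: sqrtr_ge0. Qed.

Lemma snorm2 x : X x -> snorm x ^+ 2 = complex.Re (sdot x x).
Proof. by move=> Xx; rewrite -hnorm_hpi// hnorm2 ?hdotE//; exact: hilbert_hdot. Qed.

Lemma snorm_cauchy_schwarz x y : X x -> X y -> normc (sdot x y) <= snorm x * snorm y.
Proof.
move=> Xx Xy; have := cauchy_schwarz hilbert_hdot (hpi x) (hpi y).
by rewrite hdotE// !hnorm_hpi.
Qed.

Lemma hpi_eqP x y : X x -> X y -> (hpi x = hpi y <-> snorm (x - y) = 0).
Proof.
move=> Xx Xy; rewrite -hnorm_hpi ?hpiB//; last exact: shB.
split=> [->|/(hnorm_eq0 hilbert_hdot)/eqP]; first by rewrite subrr hnorm0//; exact: hilbert_hdot.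
by rewrite subr_eq0 => /eqP.
Qed.

Lemma snormD x y : X x -> X y -> snorm (x + y) <= snorm x + snorm y.
Proof.
move=> Xx Xy; rewrite -!hnorm_hpi ?hpiD//; last exact: (shD sH).
exact: hnormD hilbert_hdot _ _.
Qed.

Lemma snormZ c x : X x -> snorm (c *: x) = normc c * snorm x.
Proof.
move=> Xx; rewrite -!hnorm_hpi ?hpiZ//; last exact: (shZ sH).
exact: hnormZ hilbert_hdot _ _.
Qed.

End SemiHilbert.

(** * The operator of a form, studied through T = (A + 1)^-1 *)

Section FormOperator.
Variables (R : realType) (F : lmodType R[i]) (X : set F) (sdot : F -> F -> R[i]).
Variables (D : set F) (a : F -> F -> R[i]).
(** The scalar product of the form domain; completeness for it is the closedness of the form. *)
Definition form_dot (u v : F) := sdot u v + a u v.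
Hypothesis sX : semi_hilbert X sdot.
Hypothesis sD : semi_hilbert D form_dot.
Hypothesis DX : D `<=` X.
Hypothesis a_ge0 : forall u, D u -> 0 <= complex.Re (a u u).
Implicit Types (u v w : F) (l : R[i]).
Local Notation H := (hquot sX).
Local Notation pi := (hpi sX).
Local Notation nX := (snorm sdot).
Local Notation nD := (snorm form_dot).

(** The equation (A - l) u = w in weak form, for the operator A associated with [a]. *)
Definition form_res l w u :=
  [/\ D u, X (l *: u + w) & forall v, D v -> a u v = sdot (l *: u + w) v].

Lemma snorm_le_form_norm u : D u -> nX u <= nD u.
Proof.
move=> Du; rewrite -(ler_pXn2r (n := 2)) ?nnegrE ?snorm_ge0//.
by rewrite (snorm2 sX (DX Du)) (snorm2 sD Du) cReD lerDl a_ge0.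
Qed.

(** Riesz representation in the form domain, whose norm dominates that of [X], solves (A + 1) u = w
    weakly. The functional vanishes on form-null vectors, so it depends on the class only. [X w]
    stands under the existential to make the solution a total function of [w]. *)
Lemma form_riesz w : exists u, X w -> D u /\ forall v, D v -> form_dot u v = sdot w v.
Proof.
have [Xw|] := pselect (X w); last by move=> h; exists 0 => /h.
pose phi (h : hquot sD) := sdot (hrep h) w.
have DH h : D (@hrep _ _ _ _ sD h) by exact: hrepX.
have XH h : X (@hrep _ _ _ _ sD h) by exact: DX.
have null u : D u -> @hpi _ _ _ _ sD u = 0 -> sdot u w = 0.
  move=> Du u0; have nu : nD u = 0.
    by rewrite -(hnorm_hpi sD Du) u0 hnorm0//; exact: hilbert_hdot.
  apply: eq0_normc; apply/eqP; rewrite eq_le normc_ge0 andbT.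
  apply: le_trans (snorm_cauchy_schwarz sX (DX Du) Xw) _.
  have := snorm_le_form_norm Du; rewrite nu => h.
  have -> : nX u = 0 by apply/eqP; rewrite eq_le h snorm_ge0.
  by rewrite mul0r.
have eq_pi u v : D u -> D v -> hpi sD u = hpi sD v -> sdot u w = sdot v w.
  move=> Du Dv uv; apply/eqP; rewrite -subr_eq0; apply/eqP.
  have <- : sdot (u - v) w = sdot u w - sdot v w.
    rewrite -scaleN1r (sdotDl sX) ?(sdotZl sX)//; try exact: DX.
      by rewrite mulN1r.
    by apply: (shZ sX); exact: DX.
  apply: null; first exact: (shB sD).
  by rewrite hpiB// uv subrr.
have [|||u0 hu0] := @riesz _ _ _ (hilbert_hdot sD) phi (nX w).
- move=> h k; rewrite /phi -(sdotDl sX)//; apply: eq_pi => //; first exact: (shD sD).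
  by rewrite hpiD// !hrepK.
- move=> c h; rewrite /phi -(sdotZl sX)//; apply: eq_pi => //; first exact: (shZ sD).
  by rewrite hpiZ// !hrepK.
- move=> h; rewrite mulrC; apply: le_trans (snorm_cauchy_schwarz sX (XH h) Xw) _.
  rewrite ler_wpM2r ?snorm_ge0//; apply: le_trans (snorm_le_form_norm (DH h)) _.
  by rewrite -(hnorm_hpi sD (DH h)) hrepK.
exists (hrep u0) => _; split=> // v Dv.
rewrite (sdotC sD Dv (DH u0)) (sdotC sX (DX Dv) Xw); congr conjc.
rewrite -(hdotE sD Dv (DH u0)) hrepK -hu0 /phi.
by apply: eq_pi => //; rewrite hrepK.
Qed.

Definition form_sol w : F := projT1 (cid (form_riesz w)).

Lemma form_solD w : X w -> D (form_sol w).
Proof. by move=> Xw; rewrite /form_sol; case: cid => u /= /(_ Xw)[]. Qed.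

Lemma form_solE w v : X w -> D v -> form_dot (form_sol w) v = sdot w v.
Proof. by move=> Xw; rewrite /form_sol; case: cid => u /= /(_ Xw)[_]; exact. Qed.

Lemma form_sol_uniq w u : X w -> D u ->
  (forall v, D v -> form_dot u v = sdot w v) -> pi u = pi (form_sol w).
Proof.
move=> Xw Du uw; have Dw := form_solD Xw; apply/(hpi_eqP sX); try exact: DX.
have DB : D (u - form_sol w) by exact: (shB sD).
apply/eqP; rewrite eq_le snorm_ge0 andbT; apply: le_trans (snorm_le_form_norm DB) _.
rewrite le_eqVlt; apply/orP; left; rewrite -sqrf_eq0 (snorm2 sD DB).
rewrite -{1}scaleN1r (sdotDl sD) ?(sdotZl sD)//; last exact: (shZ sD).
by rewrite uw// form_solE// mulN1r subrr.
Qed.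

(* (A + 1)^-1, where A is the operator associated with the form a *)
Definition form_T (h : H) : H := pi (form_sol (hrep h)).

Lemma hrep_sdotE w v : X w -> X v -> sdot (hrep (pi w)) v = sdot w v.
Proof. by move=> Xw Xv; apply: (hpi_inj (hrepX _) Xw Xv); exact: hrepK. Qed.

Lemma form_T_pi w u : X w -> D u ->
  (forall v, D v -> form_dot u v = sdot w v) -> form_T (pi w) = pi u.
Proof.
move=> Xw Du uw; apply/esym/form_sol_uniq => //; first exact: hrepX.
by move=> v Dv; rewrite uw// hrep_sdotE//; exact: DX.
Qed.

Lemma form_T_is_linear : linear form_T.
Proof.
move=> c h k; set x := hrep h; set y := hrep k.
have [Xx Xy] : X x /\ X y by split; exact: hrepX.
have [Dx Dy] := (form_solD Xx, form_solD Xy).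
have -> : c *: h + k = pi (c *: x + y).
  by rewrite hpiD ?hpiZ ?hrepK//; exact: (shZ sX).
rewrite (form_T_pi (u := c *: form_sol x + form_sol y)).
- by rewrite hpiD ?hpiZ//; [exact: DX|apply: (shZ sX)|]; exact: DX.
- by apply: (shD sX) => //; exact: (shZ sX).
- by apply: (shD sD) => //; exact: (shZ sD).
- move=> v Dv; rewrite (sdotDl sD)//; last exact: (shZ sD).
  rewrite (sdotZl sD)// !form_solE// (sdotDl sX)//; [|exact: (shZ sX)|exact: DX].
  by rewrite (sdotZl sX)//; exact: DX.
Qed.

HB.instance Definition _ := GRing.isLinear.Build R[i] H H *:%R form_T form_T_is_linear.

Lemma form_TD h k : form_T (h + k) = form_T h + form_T k.
Proof. exact: (linearD form_T). Qed.

Lemma form_TZ c h : form_T (c *: h) = c *: form_T h.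
Proof. exact: (linearZZ form_T). Qed.

Local Notation hn := (hnorm (@hdot _ _ _ _ sX)).
Let hH := hilbert_hdot sX.

Lemma form_T_dot h k : hdot (form_T h) k = sdot (form_sol (hrep h)) (hrep k).
Proof.
have Dx := form_solD (hrepX h).
by rewrite -[in LHS](hrepK k) hdotE//; [exact: DX|exact: hrepX].
Qed.

(** The product of [form_T h] with [k] is the form product of the two solutions, which is
    Hermitian. *)
Lemma form_T_sa h k : hdot (form_T h) k = hdot h (form_T k).
Proof.
have [Xx Xy] : X (hrep h) /\ X (hrep k) by split; exact: hrepX.
have [Dx Dy] := (form_solD Xx, form_solD Xy).
rewrite (dotC hH (form_T k)) !form_T_dot -(sdotC sX (DX Dy) Xx).
by rewrite (sdotC sX Xy (DX Dx)) -form_solE// -(sdotC sD Dy Dx) form_solE.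
Qed.

Lemma form_T_ge h : complex.Re (hdot (form_T h) h) = nD (form_sol (hrep h)) ^+ 2.
Proof.
have Xx : X (hrep h) by exact: hrepX.
have Dx := form_solD Xx.
rewrite (snorm2 sD Dx) form_solE// form_T_dot.
by rewrite (sdotC sX Xx (DX Dx)) cRe_conj.
Qed.

Lemma form_sol_bound w : X w -> nD (form_sol w) <= nX w.
Proof.
move=> Xw; have Dw := form_solD Xw.
have : nD (form_sol w) ^+ 2 <= nX w * nD (form_sol w).
  rewrite (snorm2 sD Dw) form_solE//; apply: le_trans (ler_norm _) _.
  apply: le_trans (ler_Re_normc _) _.
  apply: le_trans (snorm_cauchy_schwarz sX Xw (DX Dw)) _.
  by rewrite ler_wpM2l ?snorm_ge0// snorm_le_form_norm.
have := snorm_ge0 form_dot (form_sol w); rewrite le_eqVlt => /predU1P[<-|n0].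
  by rewrite snorm_ge0.
by rewrite expr2 ler_pM2r.
Qed.

Lemma form_T_le1 h : hn (form_T h) <= hn h.
Proof.
have Xx : X (hrep h) by exact: hrepX.
have Dx := form_solD Xx.
rewrite -{2}(hrepK h) !hnorm_hpi//; last exact: DX.
by apply: le_trans (snorm_le_form_norm Dx) (form_sol_bound Xx).
Qed.

(** Adding [sdot u v] to both sides rewrites (A - l) u = w as (A + 1) u = (1 + l) u + w. *)
Lemma form_resP l w u : X w -> D u -> form_res l w u <->
  forall v, D v -> form_dot u v = sdot ((1 + l) *: u + w) v.
Proof.
move=> Xw Du; have Xu := DX Du.
have Xl : X (l *: u + w) by apply: (shD sX) => //; exact: (shZ sX).
have E v : D v -> sdot ((1 + l) *: u + w) v = sdot u v + sdot (l *: u + w) v.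
  move=> Dv; rewrite -(sdotDl sX)//; last exact: DX.
  by rewrite scalerDl scale1r addrA.
split=> [[_ _ h] v Dv|h].
  by rewrite E// -h.
split=> // v Dv; have := h v Dv; rewrite E// /form_dot => /addrI.
exact.
Qed.

Lemma form_res_T l w u : X w -> form_res l w u ->
  pi u = form_T ((1 + l) *: pi u + pi w).
Proof.
move=> Xw ru; have [Du _ _] := ru; have Xu := DX Du.
have Xl : X ((1 + l) *: u) by exact: (shZ sX).
rewrite -hpiZ// -hpiD//; apply/esym/form_T_pi => //; first exact: (shD sX).
exact/form_resP.
Qed.

(** A class determines a function only up to null vectors, while the equation needs one in [D]; the
    solution given by [form_sol] is such a representative. *)
Lemma T_form_res l w h : X w -> h = form_T ((1 + l) *: h + pi w) ->
  exists2 u, form_res l w u & pi u = h.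
Proof.
move=> Xw hT; set k := (1 + l) *: h + pi w in hT.
have Xk : X (hrep k) by exact: hrepX.
have Du := form_solD Xk; have Xu := DX Du.
have uh : pi (form_sol (hrep k)) = h by rewrite [RHS]hT.
exists (form_sol (hrep k)) => //; apply/form_resP => // v Dv.
rewrite form_solE//; apply: (hpi_inj (sH := sX)) => //; last 2 first.
- exact: DX.
- rewrite hrepK /k hpiD ?hpiZ ?uh//.
  exact: (shZ sX).
- by apply: (shD sX) => //; exact: (shZ sX).
Qed.

Definition form_resolvent l :=
  (forall w, X w -> exists u, form_res l w u) /\
  (exists M, forall w u, X w -> form_res l w u -> nX u <= M * nX w).

Definition form_eigen l u := form_res l 0 u.

Lemma form_eigen_T l u : form_eigen l u -> pi u = (1 + l) *: form_T (pi u).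
Proof.
move=> /form_res_T; rewrite hpi0 addr0 -form_TZ; apply.
exact: (sh0 sX).
Qed.

Lemma T_form_eigen l h : h = (1 + l) *: form_T h ->
  exists2 u, form_eigen l u & pi u = h.
Proof.
move=> hT; apply: T_form_res; first exact: (sh0 sX).
by rewrite hpi0 addr0 form_TZ.
Qed.

Lemma form_resolventN1 : form_resolvent (-1).
Proof.
split=> [w Xw|].
  have [|u ru _] := @T_form_res (-1) w (form_T (pi w)) Xw; last by exists u.
  by rewrite subrr scale0r add0r.
exists 1 => w u Xw ru; have [Du _ _] := ru.
have := form_res_T Xw ru; rewrite subrr scale0r add0r mul1r => uT.
by rewrite -(hnorm_hpi sX (DX Du)) -(hnorm_hpi sX Xw) uT form_T_le1.
Qed.

(** [nD u ^+ 2] is the product of [(1 + l) *: u + w] with [u], so the resolvent bound in [X]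
    improves to a bound in the form norm, where compactness of the embedding applies. *)
Lemma form_res_bounded l (w u : nat -> F) : form_resolvent l ->
  (forall n, X (w n)) -> (forall n, form_res l (w n) (u n)) ->
  (exists M, forall n, nX (w n) <= M) -> exists M, forall n, nD (u n) <= M.
Proof.
move=> [_ [K hK]] Xw ru [M hM]; pose L := `|K| * M.
have M0 : 0 <= M := le_trans (snorm_ge0 sdot _) (hM 0%N).
have L0 : 0 <= L by rewrite mulr_ge0.
have uL n : nX (u n) <= L.
  apply: le_trans (hK _ _ (Xw n) (ru n)) _; apply: le_trans (ler_norm _) _.
  by rewrite normrM ler_pM// ger0_norm ?snorm_ge0.
pose B := normc (1 + l) * L + M.
have B0 : 0 <= B by rewrite addr_ge0// mulr_ge0// normc_ge0.
exists (Num.sqrt (B * L)) => n; have [Du _ _] := ru n; have Xu := DX Du.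
have Xl : X ((1 + l) *: u n) by exact: (shZ sX).
have Xlw : X ((1 + l) *: u n + w n) by exact: (shD sX).
rewrite /snorm ler_sqrt ?mulr_ge0//.
rewrite ((form_resP l (Xw n) Du).1 (ru n))//.
apply: le_trans (ler_norm _) _; apply: le_trans (ler_Re_normc _) _.
apply: le_trans (snorm_cauchy_schwarz sX Xlw Xu) _.
apply: ler_pM; rewrite ?snorm_ge0//.
apply: le_trans (snormD sX Xl (Xw n)) _; rewrite lerD// (snormZ sX)// ler_wpM2l ?normc_ge0//.
Qed.

Section Compact.
Hypothesis D_compact : forall f : nat -> F, (forall n, D (f n)) ->
  (exists M, forall n, nD (f n) <= M) ->
  exists2 s : nat -> nat, {homo s : i j / (i < j)%N} &
  exists2 g, X g & forall e : R, 0 < e -> exists N, forall n, (N <= n)%N -> nX (f (s n) - g) < e.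

(** [form_sol] maps sequences bounded in [X] to sequences bounded in the form norm. *)
Lemma form_T_compact : hcompact (@hdot _ _ _ _ sX) form_T.
Proof.
move=> h [M hM]; pose f n := form_sol (hrep (h n)).
have Xh n : X (hrep (h n)) by exact: hrepX.
have Df n : D (f n) by exact: form_solD.
have [|s hs [g Xg fg]] := D_compact Df.
  exists M => n; apply: le_trans (form_sol_bound (Xh n)) _.
  by rewrite -(hnorm_hpi sX (Xh n)) hrepK.
exists s => //; exists (pi g) => e /fg[N hN]; exists N => n /hN.
have Xf : X (f (s n)) by exact: DX.
by rewrite /= -hpiB// hnorm_hpi//; exact: (shB sX).
Qed.

Let Tc := form_T_compact.

(** The Fredholm alternative for 1 - (1 + l) T: on classes, (A - l) u = w reads u - (1 + l) T u = T
    w. *)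
Lemma form_fredholm l : (forall u, form_eigen l u -> nX u = 0) -> form_resolvent l.
Proof.
move=> noeig.
have noT (h : H) : eig form_T (1 + l) h -> h = 0.
  move=> /T_form_eigen[u eu <-]; apply: (hnorm_eq0 hH).
  by have [Du _ _] := eu; rewrite hnorm_hpi ?noeig//; exact: DX.
have surj := fredholm_surjective hH form_T_sa form_T_le1 Tc noT.
have [K hK] := fredholm_bounded hH form_T_le1 Tc noT.
split=> [w Xw|].
  have [h] := surj (form_T (pi w)); rewrite -[GRing.Linear.sort _ h]/(form_T h) => hw.
  have [|u ru _] := @T_form_res l w h Xw; last by exists u.
  by rewrite form_TD hw form_TZ addrC subrK.
exists `|K| => w u Xw ru; have [Du _ _] := ru.
rewrite -(hnorm_hpi sX (DX Du)) -(hnorm_hpi sX Xw).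
have uT := form_res_T Xw ru.
have E : pi u - (1 + l) *: form_T (pi u) = form_T (pi w).
  by rewrite {1}uT form_TD form_TZ addrC addKr.
apply: le_trans (hK _) _; rewrite E; apply: le_trans (ler_norm _) _.
rewrite normrM ler_wpM2l// ger0_norm ?hnorm_ge0//; exact: form_T_le1.
Qed.

Lemma form_eigen_isolated l : exists2 e : R, 0 < e & forall z, normc (z - l) < e ->
  (exists2 u, form_eigen z u & nX u != 0) -> z = l.
Proof.
have [e e0 he] := eig_isolated hH form_T_sa form_T_le1 Tc (1 + l).
exists e => // z zl [u eu nu]; apply: (addrI 1); apply: he.
  by rewrite opprD addrACA subrr add0r.
exists (pi u); first exact: form_eigen_T.
move=> u0; have [Du _ _] := eu; move: nu.
by rewrite -(hnorm_hpi sX (DX Du)) u0 hnorm0// eqxx.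
Qed.

Lemma form_eigen_finite l : exists n (b : 'I_n -> F), (forall i, form_eigen l (b i)) /\
  forall u, form_eigen l u -> exists c : 'I_n -> R[i],
    nX (u - \sum_(i < n) c i *: b i) = 0.
Proof.
have [n [b [eb hb]]] := eig_finite_dim hH form_T_le1 Tc (1 + l).
have /choice[b' hb'] : forall i : 'I_n, exists u, form_eigen l u /\ pi u = b i.
  by move=> i; have [u eu ub] := T_form_eigen (eb i); exists u.
exists n, b'; split=> [i|u eu]; first by case: (hb' i).
have [c uc] := hb _ (form_eigen_T eu); exists c.
have Xb i : X (b' i) by have [[/DX]] := hb' i.
have [Xs piS] := hpi_sum sX (index_enum 'I_n) (fun i => shZ sX (c i) (Xb i)).
have [/DX Xu _ _] := eu; apply/(hpi_eqP sX Xu Xs).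
rewrite uc piS; apply: eq_bigr => i _; rewrite hpiZ//.
by have [_ ->] := hb' i.
Qed.

End Compact.

(** If A - l has a bounded inverse at l = 1 / s - 1, then T h is its value at g = h - T h / s, and g
    is T h - s h up to the factor - 1 / s. Hence T h - s h controls T h, and so s h as well. *)
Lemma form_approx_spectrum (s : R) : 0 < s ->
  approx_spectrum (@hdot _ _ _ _ sX) form_T s -> ~ form_resolvent ((s^-1 - 1)%:C).
Proof.
move=> s0 Ss [_ [M hM]]; apply: Ss.
set l := (s^-1 - 1)%:C in hM.
have l1 : 1 + l = s^-1%:C by rewrite /l rmorphB rmorph1 addrC subrK.
pose K := `|M| + 1; have K0 : 0 < K by rewrite ltr_wpDl.
have sC : s%:C != 0 by rewrite -(rmorph0 (real_complex R)) (inj_eq (@complexI R)) gt_eqF.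
have key (h : H) : hn (form_T h) <= K / s * hn (form_T h - s%:C *: h).
  pose g := h - s^-1%:C *: form_T h; pose w := hrep g.
  have Xw : X w by exact: hrepX.
  have gE : g = - (s^-1%:C *: (form_T h - s%:C *: h)).
    by rewrite scalerBr scalerA -rmorphM mulVf ?gt_eqF// rmorph1 scale1r opprB.
  have [|u ru uh] := @T_form_res l w (form_T h) Xw.
    by rewrite /w hrepK /g l1 addrC subrK.
  have := hM w u Xw ru; have [Du _ _] := ru.
  rewrite -(hnorm_hpi sX (DX Du)) uh -(hnorm_hpi sX Xw) hrepK gE hnormN// hnormZ//.
  rewrite normc_real ger0_norm ?invr_ge0 ?(ltW s0)// mulrA => /le_trans; apply.
  rewrite ler_wpM2r ?hnorm_ge0// ler_wpM2r ?invr_ge0 ?(ltW s0)//.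
  by rewrite /K; have := ler_norm M; lra.
exists (s / (K / s + 1)).
  by rewrite divr_gt0// ltr_wpDl// divr_ge0// ltW.
move=> h; rewrite poly_appXsub mulrAC ler_pdivrMr; last first.
  by rewrite ltr_wpDl// divr_ge0// ltW.
have a1 := key h; have a2 := ler_hnormB hH (s%:C *: h) (form_T h).
move: a2; rewrite (hnormB hH (_ *: _)) hnormZ// normc_real (@ger0_norm _ s) ?(ltW s0)//.
rewrite ler_norml => /andP[_ a2].
by rewrite mulrDr mulr1 mulrC; lra.
Qed.

Lemma dot_orthogonal_sum (V : lmodType R[i]) (dot : V -> V -> R[i]) (h : hilbert dot)
    (g : nat -> V) n (c : 'I_n -> R[i]) :
  (forall i j, i != j -> dot (g i) (g j) = 0) ->
  hnorm dot (\sum_(i < n) c i *: g i) ^+ 2 = \sum_(i < n) normc (c i) ^+ 2 * hnorm dot (g i) ^+ 2.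
Proof.
move=> go; rewrite hnorm2// dot_suml// (big_morph _ (@cReD R) (erefl : complex.Re 0 = 0)).
apply: eq_bigr => i _; rewrite dotZl// dot_sumr// (bigD1 i)//= dotZr// big1 ?addr0.
  by rewrite mulrA [c i * _]mulrC mul_conjc cReZ -hnorm2.
by move=> j ji; rewrite dotZr// go ?mulr0// (inj_eq val_inj) eq_sym.
Qed.

(** For a combination Y of the [f n], orthogonality in both products gives
    [nD Y ^+ 2 <= (M + 1) * nX Y ^+ 2]. Since [nX Y ^+ 2] is the form product of the solution for Y
    with Y, Cauchy-Schwarz in the form norm bounds the form of T below by [(M + 1)^-1] on the span.
    The spectral point s of T that results is carried over by l = 1 / s - 1. *)
Lemma form_essential (f : nat -> F) (M : R) :
  (forall n, D (f n)) ->
  (forall m n, sdot (f m) (f n) = (m == n)%:R) ->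
  (forall m n, m != n -> a (f m) (f n) = 0) ->
  (forall n, complex.Re (a (f n) (f n)) <= M) ->
  exists2 l, ~ form_resolvent l & ~ [/\
    exists2 e : R, 0 < e & forall z, ~ form_resolvent z -> normc (z - l) < e -> z = l,
    exists2 u, form_eigen l u & nX u != 0 &
    exists n (b : 'I_n -> F), (forall i, form_eigen l (b i)) /\
      forall u, form_eigen l u -> exists c : 'I_n -> R[i],
      nX (u - \sum_(i < n) c i *: b i) = 0].
Proof.
move=> Df fo af aM; have Xf n := DX (Df n).
have M0 : 0 <= M by apply: le_trans (aM 0%N); exact: a_ge0.
pose g n : H := pi (f n).
have go m n : hdot (g m) (g n) = (m == n)%:R by rewrite hdotE.
have gT n (c : 'I_n -> R[i]) : let y := \sum_(i < n) c i *: g i in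
    (M + 1)^-1 * hn y ^+ 2 <= complex.Re (hdot (form_T y) y).
  move=> y; rewrite ler_pdivrMl; last by lra.
  pose cf i := c i *: f i.
  have Dcf i : D (cf i) by exact: (shZ sD).
  have Xcf i : X (cf i) by exact: DX.
  have [XY piY] := hpi_sum sX (index_enum 'I_n) Xcf.
  have [DY piDY] := hpi_sum sD (index_enum 'I_n) Dcf.
  set Y := \sum_(i <- _) _ in XY piY DY piDY.
  have yY : y = pi Y by rewrite piY; apply: eq_bigr => i _; rewrite hpiZ.
  have nY : hn y = nX Y by rewrite yY hnorm_hpi.
  have Y2 : nD Y ^+ 2 <= (M + 1) * hn y ^+ 2.
    rewrite -(hnorm_hpi sD DY) piDY.
    have -> : \sum_(i < n) hpi sD (cf i) = \sum_(i < n) c i *: hpi sD (f i).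
      by apply: eq_bigr => i _; rewrite hpiZ.
    rewrite (@dot_orthogonal_sum _ _ (hilbert_hdot sD) (fun i => hpi sD (f i))).
      rewrite (@dot_orthogonal_sum _ _ hH g); last first.
        by move=> i j ij; rewrite go (negbTE ij).
      rewrite mulr_sumr; apply: ler_sum => i _; rewrite [leRHS]mulrCA ler_wpM2l ?sqr_ge0//.
      rewrite hnorm_hpi// (snorm2 sD)// (hnorm2 hH) go eqxx cReD fo eqxx /= mulr1.
      by rewrite addrC lerD2r.
    by move=> i j ij; rewrite hdotE// /form_dot fo af// (negbTE ij) addr0.
  set S := form_sol (hrep y).
  have Xy : X (hrep y) by exact: hrepX.
  have DS : D S by exact: form_solD.
  have : hn y ^+ 2 <= nD S * nD Y.
    rewrite nY (snorm2 sX XY); apply: le_trans (ler_norm _) _.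
    apply: le_trans (ler_Re_normc _) _.
    have <- : form_dot S Y = sdot Y Y by rewrite form_solE// yY hrep_sdotE.
    exact: (snorm_cauchy_schwarz sD).
  rewrite form_T_ge -/S => h.
  have [y0|y0] := eqVneq (hn y) 0; first by rewrite y0 expr0n mulr_ge0 ?sqr_ge0// addr_ge0.
  have yp : 0 < hn y ^+ 2 by rewrite exprn_gt0// lt_neqAle eq_sym y0 hnorm_ge0.
  rewrite -(ler_pM2r yp) -expr2.
  apply: (@le_trans _ _ ((nD S * nD Y) ^+ 2)).
    by rewrite ler_pXn2r ?nnegrE ?(ltW yp) ?mulr_ge0 ?snorm_ge0.
  rewrite exprMn [(M + 1) * _]mulrC -[leRHS]mulrA.
  by apply: ler_wpM2l Y2; rewrite sqr_ge0.
have M1 : 0 < (M + 1)^-1 by rewrite invr_gt0; lra.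
have [s s0 [Ss hs]] := no_isolated_spectrum hH form_T_sa form_T_le1 M1 go gT.
exists (s^-1 - 1)%:C; first exact: form_approx_spectrum.
move=> [[e e0 he] _ [n [b [eb hb]]]]; apply: hs; split.
(* The first bound gives t > s / 2, and the second then gives |1 / t - 1 / s| = |t - s| / (t s) <
   e. *)
- exists (Num.min (s / 2) (e * s ^+ 2 / 2)).
    by rewrite lt_min !(divr_gt0, mulr_gt0, exprn_gt0).
  move=> t St; rewrite lt_min => /andP[ts1 ts2].
  have t2 : s / 2 < t by move: ts1; rewrite ltr_norml => /andP[]; lra.
  have t0 : 0 < t by apply: lt_trans t2; rewrite divr_gt0.
  have : (t^-1 - 1)%:C = (s^-1 - 1)%:C.
    apply: he; first exact: form_approx_spectrum.
    rewrite -rmorphB normc_real opprB addrA subrK.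
    have -> : t^-1 - s^-1 = (s - t) / (t * s) by field; rewrite !gt_eqF.
    have ts0 : 0 < t * s by rewrite mulr_gt0.
    rewrite normrM distrC [`|(t * s)^-1|]ger0_norm ?invr_ge0 ?(ltW ts0)//.
    rewrite ltr_pdivrMr//; apply: lt_le_trans ts2 _.
    rewrite -mulrA ler_wpM2l ?(ltW e0)// expr2 mulrAC ler_wpM2r ?ltW//.
  by move=> -[] /addIr /invr_inj.
- have l1 : 1 + (s^-1 - 1)%:C = s^-1%:C by rewrite rmorphB rmorph1 addrC subrK.
  have sC : s%:C * s^-1%:C = 1 :> R[i] by rewrite -rmorphM divff ?gt_eqF.
  have Xb i : X (b i) by have [/DX] := eb i.
  exists n, (fun i => pi (b i)); split=> [i /=|h /= hT].
    by rewrite [in RHS](form_eigen_T (eb i)) l1 scalerA sC scale1r.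
  have [|u eu uh] := @T_form_eigen (s^-1 - 1)%:C h.
    by rewrite hT l1 scalerA mulrC sC scale1r.
  have [c uc] := hb u eu; exists c.
  have [Xs piS] := hpi_sum sX (index_enum 'I_n) (fun i => shZ sX (c i) (Xb i)).
  have [/DX Xu _ _] := eu; rewrite -uh; have /(hpi_eqP sX Xu Xs) -> := uc.
  by rewrite piS; apply: eq_bigr => i _; rewrite hpiZ.
Qed.

End FormOperator.

(** * The complex L2 space *)

Section L2Space.
Context d (T : measurableType d) (R : realType).
Variable mu : {measure set T -> \bar R}.
Implicit Types (f g h : T -> R[i]).

Definition cmeasurable f := measurable_fun setT (fun x => complex.Re (f x)) /\
  measurable_fun setT (fun x => complex.Im (f x)).

Lemma measurable_normc2 f : cmeasurable f ->
  measurable_fun setT (fun x => normc (f x) ^+ 2).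
Proof.
move=> [mRe mIm].
rewrite (_ : (fun _ => _) = (fun x => complex.Re (f x) ^+ 2 + complex.Im (f x) ^+ 2)).
  by apply: measurable_funD; exact: measurable_funX.
by apply/funext => x; rewrite normcE2.
Qed.

Lemma Lfun2P (f : T -> R) : (f \in Lfun mu 2%:E) <->
  measurable_fun setT f /\ mu.-integrable setT (fun x => (f x ^+ 2)%:E).
Proof.
split=> [fL|[mf intf]].
  split; last exact: Lfun2_integrable_sqr fL.
  by move: fL; rewrite inE => /andP[+ _]; rewrite inE.
rewrite inE; apply/andP; split; first by rewrite inE.
rewrite inE /= /finite_norm; apply: (@lty_poweRy _ _ 2) => //.
rewrite powR_Lnorm//; move/integrableP : intf => [_]; apply: le_lt_trans.
rewrite le_eqVlt; apply/orP; left; apply/eqP; apply: eq_integral => x _.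
by rewrite /= powR_mulrn// [`|_ ^+ 2|]ger0_norm ?sqr_ge0// real_normK ?num_real.
Qed.

Lemma L2P f : L2 mu f <->
  cmeasurable f /\ mu.-integrable setT (fun x => (normc (f x) ^+ 2)%:E).
Proof.
have E : (fun x => (normc (f x) ^+ 2)%:E) = (fun x => (complex.Re (f x) ^+ 2)%:E) \+
     (fun x => (complex.Im (f x) ^+ 2)%:E) :> (T -> \bar R).
  by apply/funext => x; rewrite normcE2.
split=> [[/Lfun2P[mRe iRe] /Lfun2P[mIm iIm]]|[[mRe mIm] intf]].
  by split=> //; rewrite E; exact: integrableD.
by split; apply/Lfun2P; split=> //; apply: le_integrable intf => //;
  [exact/measurable_EFinP/measurable_funX| |exact/measurable_EFinP/measurable_funX|];
  move=> x _; rewrite lee_fin !ger0_norm ?sqr_ge0// normcE2 ?lerDl ?lerDr sqr_ge0.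
Qed.

Lemma L2_dominated f (g : T -> R) : cmeasurable f ->
  mu.-integrable setT (fun x => (g x)%:E) -> (forall x, normc (f x) ^+ 2 <= g x) -> L2 mu f.
Proof.
move=> mf ig fg; apply/L2P; split=> //; apply: le_integrable ig => //.
  exact/measurable_EFinP/measurable_normc2.
move=> x _; rewrite lee_fin ger0_norm ?sqr_ge0//.
exact: le_trans (fg x) (ler_norm _).
Qed.

Lemma cmeasurableD f g : cmeasurable f -> cmeasurable g -> cmeasurable (f + g).
Proof.
move=> [f1 f2] [g1 g2]; split.
  rewrite (_ : (fun _ => _) = (fun x => complex.Re (f x) + complex.Re (g x))).
    exact: measurable_funD.
  by apply/funext => x; rewrite -cReD.
rewrite (_ : (fun _ => _) = (fun x => complex.Im (f x) + complex.Im (g x))).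
  exact: measurable_funD.
by apply/funext => x; rewrite fctE; case: (f x); case: (g x).
Qed.

Lemma cmeasurableM f g : cmeasurable f -> cmeasurable g -> cmeasurable (fun x => f x * g x).
Proof.
move=> [f1 f2] [g1 g2]; split.
  rewrite (_ : (fun _ => _) = (fun x => complex.Re (f x) * complex.Re (g x) -
      complex.Im (f x) * complex.Im (g x))).
    by apply: measurable_funB; exact: measurable_funM.
  by apply/funext => x; case: (f x); case: (g x).
rewrite (_ : (fun _ => _) = (fun x => complex.Re (f x) * complex.Im (g x) +
    complex.Im (f x) * complex.Re (g x))).
  by apply: measurable_funD; exact: measurable_funM.
by apply/funext => x; case: (f x); case: (g x).
Qed.

Lemma cmeasurable_cst (c : R[i]) : cmeasurable (fun=> c).
Proof. by split; exact: measurable_cst. Qed.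

Lemma cmeasurableC f : cmeasurable f -> cmeasurable (fun x => conjc (f x)).
Proof.
move=> [f1 f2]; split.
  by under eq_fun do rewrite cRe_conj.
rewrite (_ : (fun _ => _) = (fun x => - complex.Im (f x))).
  exact: measurable_funN.
by apply/funext => x; case: (f x).
Qed.

Lemma L2D f g : L2 mu f -> L2 mu g -> L2 mu (f + g).
Proof.
move=> /L2P[mf jf] /L2P[mg jg].
apply: (@L2_dominated _ (fun x => 2 * normc (f x) ^+ 2 + 2 * normc (g x) ^+ 2)).
- exact: cmeasurableD.
- rewrite (_ : (fun _ => _) = (fun x => 2%:E * (normc (f x) ^+ 2)%:E)%E \+
      (fun x => 2%:E * (normc (g x) ^+ 2)%:E)%E) //.
  by apply: integrableD => //; exact: integrableZl.
- move=> x; have := normcD (f x) (g x); have := normc_ge0 (f x + g x).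
  have := normc_ge0 (f x); have := normc_ge0 (g x); rewrite fctE => a b c h.
  have : 0 <= (normc (f x) - normc (g x)) ^+ 2 by rewrite sqr_ge0.
  have : normc (f x + g x) ^+ 2 <= (normc (f x) + normc (g x)) ^+ 2.
    by rewrite ler_pXn2r ?nnegrE ?addr_ge0.
  by nra.
Qed.

Lemma L2Z (c : R[i]) f : L2 mu f -> L2 mu (c *: f).
Proof.
move=> /L2P[mf jf].
apply: (@L2_dominated _ (fun x => normc c ^+ 2 * normc (f x) ^+ 2)).
- by apply: (cmeasurableM (cmeasurable_cst c)).
- exact: (integrableZl _ (normc c ^+ 2) jf).
- by move=> x; rewrite fctE normcM exprMn.
Qed.

Lemma L20 : L2 mu 0.
Proof.
apply: (@L2_dominated _ (fun=> 0)).
- exact: (cmeasurable_cst 0).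
- exact: integrable0.
- by move=> x; rewrite [normc _]normc0 expr0n.
Qed.

Lemma L2_dot_integrable f g : L2 mu f -> L2 mu g ->
  mu.-integrable setT (fun x => (complex.Re (f x * conjc (g x)))%:E) /\
  mu.-integrable setT (fun x => (complex.Im (f x * conjc (g x)))%:E).
Proof.
move=> /L2P[mf jf] /L2P[mg jg].
have [m1 m2] := cmeasurableM mf (cmeasurableC mg).
have int2 : mu.-integrable setT (fun x => (normc (f x) ^+ 2 + normc (g x) ^+ 2)%:E).
  by rewrite (_ : (fun _ => _) = (fun x => (normc (f x) ^+ 2)%:E) \+
    (fun x => (normc (g x) ^+ 2)%:E)) //; exact: integrableD.
have bnd x : normc (f x * conjc (g x)) <= normc (f x) ^+ 2 + normc (g x) ^+ 2.
  rewrite normcM normc_conj; have := normc_ge0 (f x); have := normc_ge0 (g x) => a b.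
  have : 0 <= (normc (f x) - normc (g x)) ^+ 2 by rewrite sqr_ge0.
  by have := mulr_ge0 a b; nra.
split; apply: le_integrable int2 => //; try exact/measurable_EFinP.
  move=> x _; rewrite lee_fin [leRHS]ger0_norm ?addr_ge0 ?sqr_ge0//.
  exact: le_trans (ler_Re_normc _) (bnd x).
move=> x _; rewrite lee_fin [leRHS]ger0_norm ?addr_ge0 ?sqr_ge0//.
exact: le_trans (ler_Im_normc _) (bnd x).
Qed.

Lemma cintegralD D f g : measurable D ->
  mu.-integrable D (fun x => (complex.Re (f x))%:E) ->
  mu.-integrable D (fun x => (complex.Im (f x))%:E) ->
  mu.-integrable D (fun x => (complex.Re (g x))%:E) ->
  mu.-integrable D (fun x => (complex.Im (g x))%:E) ->
  cintegral mu D (fun x => f x + g x) = cintegral mu D f + cintegral mu D g.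
Proof.
move=> mD f1 f2 g1 g2; rewrite /cintegral.
rewrite -[RHS]/((_ + _) +i* (_ + _)); congr (_ +i* _); rewrite -RintegralD//.
  by apply: eq_Rintegral => x _; rewrite cReD.
by apply: eq_Rintegral => x _; case: (f x); case: (g x).
Qed.

Lemma cintegralZ D (c : R[i]) f : measurable D ->
  mu.-integrable D (fun x => (complex.Re (f x))%:E) ->
  mu.-integrable D (fun x => (complex.Im (f x))%:E) ->
  cintegral mu D (fun x => c * f x) = c * cintegral mu D f.
Proof.
case: c => a b mD f1 f2; rewrite /cintegral.
rewrite -[RHS]/((_ - _) +i* (_ + _)); congr (_ +i* _).
  rewrite -!RintegralZl// -RintegralB//; last 2 first.
  - exact: (integrableZl _ a f1).
  - exact: (integrableZl _ b f2).
  by apply: eq_Rintegral => x _; case: (f x).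
rewrite -!RintegralZl// -RintegralD//; last 2 first.
- exact: (integrableZl _ a f2).
- exact: (integrableZl _ b f1).
by apply: eq_Rintegral => x _; case: (f x).
Qed.

Lemma L2dotDl f g h : L2 mu f -> L2 mu g -> L2 mu h ->
  L2dot mu (f + g) h = L2dot mu f h + L2dot mu g h.
Proof.
move=> Lf Lg Lh; have [f1 f2] := L2_dot_integrable Lf Lh.
have [g1 g2] := L2_dot_integrable Lg Lh.
rewrite /L2dot -cintegralD//; congr (cintegral _ _ _).
by apply/funext => x; rewrite fctE mulrDl.
Qed.

Lemma L2dotZl (c : R[i]) f h : L2 mu f -> L2 mu h ->
  L2dot mu (c *: f) h = c * L2dot mu f h.
Proof.
move=> Lf Lh; have [f1 f2] := L2_dot_integrable Lf Lh.
rewrite /L2dot -cintegralZ//; congr (cintegral _ _ _).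
by apply/funext => x; rewrite fctE -mulrA.
Qed.

Lemma L2dotC f h : L2 mu f -> L2 mu h -> L2dot mu h f = conjc (L2dot mu f h).
Proof.
move=> Lf Lh; have [f1 f2] := L2_dot_integrable Lf Lh.
rewrite /L2dot /cintegral -[RHS]/(_ -i* _); congr (_ +i* _).
  by apply: eq_Rintegral => x _; case: (f x) (h x) => a b [e c] /=; ring.
rewrite -mulN1r -RintegralZl//.
by apply: eq_Rintegral => x _; case: (f x) (h x) => a b [e c] /=; ring.
Qed.

Lemma Re_L2dot f : complex.Re (L2dot mu f f) = \int[mu]_x (normc (f x) ^+ 2).
Proof.
by apply: eq_Rintegral => x _; rewrite mulrC mul_conjc.
Qed.

Lemma L2norm_snorm f : L2norm mu f = snorm (L2dot mu) f.
Proof. by rewrite /L2norm /snorm Re_L2dot. Qed.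

Lemma L2norm_ge0 f : 0 <= L2norm mu f.
Proof. exact: sqrtr_ge0. Qed.

Lemma L2norm2_Rintegral f : L2norm mu f ^+ 2 = \int[mu]_x (normc (f x) ^+ 2).
Proof. by rewrite sqr_sqrtr//; apply: Rintegral_ge0 => x _; exact: sqr_ge0. Qed.

Lemma L2norm2 f : L2 mu f ->
  (L2norm mu f ^+ 2)%:E = (\int[mu]_x (normc (f x) ^+ 2)%:E)%E.
Proof.
move=> /L2P[_ jf]; rewrite L2norm2_Rintegral /Rintegral fineK//.
exact: integrable_fin_num.
Qed.

Lemma L2norm_le f (e : R) : cmeasurable f -> 0 <= e ->
  (\int[mu]_x (normc (f x) ^+ 2)%:E <= (e ^+ 2)%:E)%E -> L2 mu f /\ L2norm mu f <= e.
Proof.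
move=> mf e0 fe.
have Lf : L2 mu f.
  apply/L2P; split=> //; apply/integrableP; split.
    exact/measurable_EFinP/measurable_normc2.
  under eq_integral do rewrite gee0_abs ?lee_fin ?sqr_ge0//.
  by apply: le_lt_trans fe _; rewrite ltry.
split=> //; rewrite -(ler_pXn2r (n := 2)) ?nnegrE ?L2norm_ge0//.
by rewrite -lee_fin L2norm2.
Qed.

Lemma L2_ae_eq0 f : L2 mu f -> L2norm mu f = 0 -> {ae mu, forall x, f x = 0}.
Proof.
move=> /[dup] Lf /L2P[mf _] f0; have := L2norm2 Lf; rewrite f0 expr0n/= => /esym i0.
have : (\int[mu]_x `|(normc (f x) ^+ 2)%:E| = 0)%E.
  by rewrite -[RHS]i0; apply: eq_integral => x _; rewrite gee0_abs// lee_fin sqr_ge0.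
move/(ae_eq_integral_abs mu measurableT) => h.
have {}h := h ((measurable_EFinP _ _).2 (measurable_normc2 mf)).
apply: filterS h => x /(_ I) /= [] /eqP; rewrite sqrf_eq0 => /eqP.
exact: eq0_normc.
Qed.

Lemma ae_eq0_L2norm f : cmeasurable f -> {ae mu, forall x, f x = 0} ->
  L2 mu f /\ L2norm mu f = 0.
Proof.
move=> mf f0.
have [||Lf Lf0] := @L2norm_le f 0 mf => //.
  rewrite expr0n/= (ae_eq_integral (cst 0%E))//.
  - by rewrite integral_cst// mul0e.
  - exact/measurable_EFinP/measurable_normc2.
  - by apply: filterS f0 => x fx _ /=; rewrite fx normc0 expr0n.
by split=> //; apply/eqP; rewrite eq_le Lf0 L2norm_ge0.
Qed.

Definition ccvg (u : nat -> R[i]) (l : R[i]) :=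
  forall e : R, 0 < e -> exists N : nat, forall n, (N <= n)%N -> normc (u n - l) < e.

Lemma ccvg_Re u l : ccvg u l -> (fun n => complex.Re (u n)) @ \oo --> complex.Re l.
Proof.
move=> ul; apply/cvgrPdist_lt => e /ul[N hN]; exists N => // n /= /hN.
apply: le_lt_trans; rewrite -cReN -cReD; apply: le_trans (ler_Re_normc _) _.
by rewrite normcB.
Qed.

Lemma cImB (a b : R[i]) : complex.Im (a - b) = complex.Im a - complex.Im b.
Proof. by case: a; case: b. Qed.

Lemma ccvg_Im u l : ccvg u l -> (fun n => complex.Im (u n)) @ \oo --> complex.Im l.
Proof.
move=> ul; apply/cvgrPdist_lt => e /ul[N hN]; exists N => // n /= /hN.
apply: le_lt_trans; rewrite -cImB; apply: le_trans (ler_Im_normc _) _.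
by rewrite normcB.
Qed.

Lemma ccvg_normc2 u l c : ccvg u l ->
  (fun n => normc (c - u n) ^+ 2) @ \oo --> normc (c - l) ^+ 2.
Proof.
move=> ul; rewrite normcE2; under eq_fun do rewrite normcE2.
rewrite cReD cReN cImB; under eq_fun do rewrite cReD cReN cImB.
by apply: cvgD; rewrite expr2; under eq_fun do rewrite expr2;
  apply: cvgM; apply: cvgB; try exact: cvg_cst; first [exact: ccvg_Re|exact: ccvg_Im].
Qed.

Lemma cmeasurable_cvg (u : nat -> T -> R[i]) g : (forall n, cmeasurable (u n)) ->
  (forall x, ccvg (u^~ x) (g x)) -> cmeasurable g.
Proof.
move=> mu_ ug; split.
- apply: (@measurable_fun_cvg _ _ _ _ (fun n x => complex.Re (u n x))) => //.
    by move=> n; case: (mu_ n).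
  by move=> x _; exact: ccvg_Re.
- apply: (@measurable_fun_cvg _ _ _ _ (fun n x => complex.Im (u n x))) => //.
    by move=> n; case: (mu_ n).
  by move=> x _; exact: ccvg_Im.
Qed.

Lemma cmeasurableN f : cmeasurable f -> cmeasurable (- f).
Proof.
by move=> mf; rewrite -scaleN1r; exact: (cmeasurableM (cmeasurable_cst _)).
Qed.

Lemma L2B f g : L2 mu f -> L2 mu g -> L2 mu (f - g).
Proof. by move=> Lf Lg; apply: L2D => //; rewrite -scaleN1r; exact: L2Z. Qed.

Definition L2_cauchy (u : nat -> T -> R[i]) :=
  forall e : R, 0 < e -> exists N, forall m n, (N <= m)%N -> (N <= n)%N ->
    L2norm mu (u m - u n) < e.

(** Fatou: for fixed [n], the integral of |u_n - g|^2 is at most the lower limit in [k] of that of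
    |u_n - u_k|^2. *)
Lemma L2_pointwise_limit (u : nat -> T -> R[i]) g : (forall n, L2 mu (u n)) ->
  L2_cauchy u -> (forall x, ccvg (u^~ x) (g x)) ->
  L2 mu g /\ forall e : R, 0 < e -> exists N, forall n, (N <= n)%N -> L2norm mu (u n - g) < e.
Proof.
move=> Lu cu ug.
have mu_ n : cmeasurable (u n) by have /L2P[] := Lu n.
have mg : cmeasurable g by apply: cmeasurable_cvg ug.
have key e : 0 < e -> exists N, forall n, (N <= n)%N ->
    L2 mu (u n - g) /\ L2norm mu (u n - g) <= e.
  move=> e0; have [N hN] := cu _ e0; exists N => n Nn.
  apply: L2norm_le; [exact: cmeasurableD (mu_ n) (cmeasurableN mg)|exact: ltW|].
  pose F k x := (normc (u n x - u k x) ^+ 2)%:E.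
  have F0 k x : setT x -> (0 <= F k x)%E by rewrite lee_fin sqr_ge0.
  have mF k : measurable_fun setT (F k).
    apply/measurable_EFinP; apply: (@measurable_normc2 (fun x => u n x - u k x)).
    exact: cmeasurableD (mu_ n) (cmeasurableN (mu_ k)).
  have := fatou mu measurableT mF F0.
  have -> : (\int[mu]_x limn_einf (F^~ x) = \int[mu]_x (normc ((u n - g) x) ^+ 2)%:E)%E.
    apply: eq_integral => x _; rewrite is_cvg_limn_einfE.
      apply: cvg_lim => //; apply/fine_cvgP; split; first exact: nearW.
      exact: ccvg_normc2.
    apply/cvg_ex; exists (normc ((u n - g) x) ^+ 2)%:E.
    apply/fine_cvgP; split; first exact: nearW.
    exact: ccvg_normc2.
  move=> /le_trans; apply; rewrite limn_einf_lim.
  apply: lime_le; first exact: is_cvg_einfs.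
  exists N => // k /= Nk; apply: (@le_trans _ _ (\int[mu]_x F k x)%E).
    by apply: ereal_inf_lbound; exists k => //=.
  have Lnk : L2 mu (u n - u k) by exact: L2B.
  rewrite -[leLHS](L2norm2 Lnk) lee_fin ler_pXn2r ?nnegrE ?L2norm_ge0 ?(ltW e0)//.
  exact/ltW/hN.
split.
  have [N hN] := key 1 ltr01; have [LN _] := hN N (leqnn _).
  have -> : g = u N - (u N - g) by rewrite opprB addrC subrK.
  exact: L2B.
move=> e e0; have e2 : 0 < e / 2 by rewrite divr_gt0.
have [N hN] := key _ e2; exists N => n /hN[_]; lra.
Qed.

End L2Space.

(** * Completeness of L^2 *)

Lemma real_cauchy_cvg (R : realType) (a : nat -> R) :
  (forall e : R, 0 < e -> exists N : nat, forall n, (N <= n)%N -> `|a N - a n| < e) ->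
  exists l : R, forall e : R, 0 < e -> exists N : nat, forall n, (N <= n)%N -> `|a n - l| < e.
Proof.
move=> ca; have /R_complete/cvg_ex[l al] : cauchy (a @ \oo).
  apply: cauchy_exP => e /ca[N hN]; exists (a N); by exists N => // n /= /hN.
exists l => e e0; move/cvgrPdist_lt : al => /(_ _ e0)[N _ hN]; exists N => n Nn.
by rewrite distrC; exact: hN.
Qed.

Lemma complex_cauchy_cvg (R : realType) (a : nat -> R[i]) :
  (forall e : R, 0 < e -> exists N : nat, forall n, (N <= n)%N -> normc (a N - a n) < e) ->
  exists l, ccvg a l.
Proof.
move=> ca.
have [|x hx] := @real_cauchy_cvg R (fun n => complex.Re (a n)).
  move=> e /ca[N hN]; exists N => n /hN; apply: le_lt_trans.
  by rewrite -cReN -cReD; exact: ler_Re_normc.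
have [|y hy] := @real_cauchy_cvg R (fun n => complex.Im (a n)).
  move=> e /ca[N hN]; exists N => n /hN; apply: le_lt_trans.
  by rewrite -cImB; exact: ler_Im_normc.
exists (x +i* y) => e e0; have e2 : 0 < e / 2 by rewrite divr_gt0.
have [N hN] := hx _ e2; have [M hM] := hy _ e2.
exists (maxn N M) => n; rewrite geq_max => /andP[/hN h1 /hM h2].
apply: le_lt_trans (normc_ReIm _) _.
rewrite cImB cReD cReN /= in h1 h2 *; lra.
Qed.

Lemma complex_geometric_cvg (R : realType) (a : nat -> R[i]) (K : R) :
  (forall k, normc (a k.+1 - a k) <= K / 2 ^+ k) -> exists l, ccvg a l.
Proof.
move=> aK; apply: complex_cauchy_cvg => e e0.
have K0 : 0 <= K by have := le_trans (normc_ge0 _) (aK 0%N); rewrite expr0 divr1.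
have p2 n : 0 < (2 ^+ n)^-1 :> R by rewrite invr_gt0 exprn_gt0.
have bound N j : normc (a N - a (N + j)%N) <= 2 * K * ((2 ^+ N)^-1 - (2 ^+ (N + j))^-1).
  elim: j => [|j ih]; first by rewrite addn0 !subrr normc0 mulr0.
  have -> : a N - a (N + j.+1)%N = (a N - a (N + j)%N) + - (a (N + j).+1 - a (N + j)%N).
    by rewrite opprB addnS addrA subrK.
  apply: le_trans (normcD _ _) _; rewrite normcN addnS.
  have := aK (N + j)%N; have -> : (2 ^+ (N + j).+1)^-1 = (2 ^+ (N + j))^-1 / 2 :> R.
    by rewrite exprSr invfM.
  lra.
have [N hN] := archi_inv (divr_gt0 e0 (ltr_wpDl (mulr_ge0 (ler0n R 2) K0) ltr01)).
exists N => n Nn; rewrite -(subnKC Nn); apply: le_lt_trans (bound _ _) _.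
apply: (@le_lt_trans _ _ (2 * K * (2 ^+ N)^-1)).
  by rewrite ler_wpM2l ?mulr_ge0// lerBlDr lerDl ltW.
have h : (2 ^+ N)^-1 <= N.+1%:R^-1 :> R.
  by rewrite lef_pV2 ?posrE ?exprn_gt0// -natrX ler_nat ltn_expl.
have := hN N (leqnn _); rewrite ltr_pdivlMr; last first.
  by rewrite ltr_wpDl ?mulr_ge0.
have := p2 N; have : 2 * K * (2 ^+ N)^-1 <= 2 * K * N.+1%:R^-1 by rewrite ler_wpM2l ?mulr_ge0.
have : 0 < N.+1%:R^-1 :> R by rewrite invr_gt0 ltr0n.
set q := N.+1%:R^-1; set z := (2 ^+ N)^-1 => q0 h1 z0; lra.
Qed.

Section L2Complete.
Context d (T : measurableType d) (R : realType).
Variable mu : {measure set T -> \bar R}.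
Implicit Types (f g h : T -> R[i]).

(** Stands in for the triangle inequality, which is obtained from the Hilbert structure and thus
    only after completeness. *)
Lemma L2norm_quasi f g : L2 mu f -> L2 mu g ->
  L2norm mu (f + g) ^+ 2 <= 2 * L2norm mu f ^+ 2 + 2 * L2norm mu g ^+ 2.
Proof.
move=> Lf Lg; have Lfg := L2D Lf Lg.
rewrite -lee_fin EFinD (EFinM 2 (L2norm mu f ^+ 2)) (EFinM 2 (L2norm mu g ^+ 2)) !L2norm2//.
have mE h : L2 mu h -> measurable_fun setT (fun x => (normc (h x) ^+ 2)%:E).
  by move=> /L2P[/measurable_normc2 mh _]; exact/measurable_EFinP.
have i0 h x : setT x -> (0 <= (normc (h x) ^+ 2)%:E)%E by rewrite lee_fin sqr_ge0.
rewrite -!ge0_integralZl_EFin//; try exact: mE; try exact: (i0 _).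
rewrite -ge0_integralD//; last 4 first.
- by move=> x _; rewrite mule_ge0// lee_fin sqr_ge0.
- by apply: measurable_funeM; exact: mE.
- by move=> x _; rewrite mule_ge0// lee_fin sqr_ge0.
- by apply: measurable_funeM; exact: mE.
apply: ge0_le_integral => //.
- by move=> x _; rewrite lee_fin sqr_ge0.
- exact: mE.
- by apply: emeasurable_funD; apply: measurable_funeM; exact: mE.
move=> x _; rewrite -!EFinM -EFinD lee_fin fctE.
have := normcD (f x) (g x); have := normc_ge0 (f x + g x).
have := normc_ge0 (f x); have := normc_ge0 (g x) => a b c hh.
have : 0 <= (normc (f x) - normc (g x)) ^+ 2 by rewrite sqr_ge0.
have : normc (f x + g x) ^+ 2 <= (normc (f x) + normc (g x)) ^+ 2.
  by rewrite ler_pXn2r ?nnegrE ?addr_ge0.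
by nra.
Qed.

(** Riesz-Fischer: along a fast subsequence the weighted series [W] of squared increments is
    integrable. Where it is finite the increments decay like 1 / 2^k. Setting the functions to 0 on
    the null set where it is infinite gives a sequence that converges everywhere, as
    [L2_pointwise_limit] requires. *)
Lemma L2_complete (u : nat -> T -> R[i]) : (forall n, L2 mu (u n)) -> L2_cauchy mu u ->
  exists2 l, L2 mu l & forall e : R, 0 < e -> exists N, forall n, (N <= n)%N ->
    L2norm mu (u n - l) < e.
Proof.
move=> Lu cu.
(* With this size, 4^k times the squared norm of the k-th increment is at most 1 / 2^(k+1), a series
   of sum 1. *)
have e0 k : 0 < (4 ^+ k)^-1 / 2 :> R by rewrite divr_gt0// invr_gt0 exprn_gt0.
have /choice[N hN] := fun k => cu _ (e0 k).
(* Partial sums make [s] monotone, with [s k] above both [N k] and [k]. *)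
pose s k := (\sum_(i < k.+1) (N i).+1)%N.
have sN k : (N k <= s k)%N by rewrite /s big_ord_recr /= addnS ltnW// ltnS leq_addl.
have sS k : (s k <= s k.+1)%N by rewrite /s [leqRHS]big_ord_recr leq_addr.
have sge k : (k <= s k)%N.
  elim: k => // k ih; apply: leq_ltn_trans ih _.
  by rewrite /s [ltnRHS]big_ord_recr /= addnS ltnS leq_addr.
pose v k := u (s k.+1) - u (s k).
have Lv k : L2 mu (v k) by exact: L2B.
have nv k : L2norm mu (v k) ^+ 2 <= (4 ^+ k)^-1 * (4 ^+ k)^-1 / 2.
  have h := ltW (hN k (s k.+1) (s k) (leq_trans (sN k) (sS k)) (sN k)).
  have h2 : L2norm mu (v k) ^+ 2 <= ((4 ^+ k)^-1 / 2) ^+ 2.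
    by rewrite ler_pXn2r ?nnegrE ?L2norm_ge0// ltW.
  apply: le_trans h2 _; have : 0 < (4 ^+ k)^-1 :> R by rewrite invr_gt0 exprn_gt0.
  by nra.
pose W x := (\sum_(k <oo) (4 ^+ k * normc (v k x) ^+ 2)%:E)%E.
have mv k : measurable_fun setT (fun x => (normc (v k x) ^+ 2)%:E).
  by have /L2P[/measurable_normc2 mh _] := Lv k; exact/measurable_EFinP.
have mvk k : measurable_fun setT (fun x => (4 ^+ k * normc (v k x) ^+ 2)%:E).
  by under eq_fun do rewrite EFinM; apply: measurable_funeM.
have v0 k x : (0 <= (4 ^+ k * normc (v k x) ^+ 2)%:E)%E.
  by rewrite lee_fin mulr_ge0 ?sqr_ge0// exprn_ge0.
have W0 x : (0 <= W x)%E by apply: nneseries_ge0 => k _ _; exact: v0.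
have mW : measurable_fun setT W.
  exact: ge0_emeasurable_sum.
have intW : (\int[mu]_x W x <= 1%:E)%E.
  rewrite integral_nneseries//; apply: (@le_trans _ _ (\sum_(k <oo) (1 / (2 ^ k.+1)%:R)%:E)%E).
    apply: lee_nneseries => [k _ _|k _]; first by apply: integral_ge0 => x _; exact: v0.
    under eq_integral do rewrite EFinM.
    rewrite ge0_integralZl_EFin ?exprn_ge0//; last by move=> x _; rewrite lee_fin sqr_ge0.
    rewrite -(L2norm2 (Lv k)) -EFinM lee_fin.
    have p4 : 0 < (4 ^+ k : R) by rewrite exprn_gt0.
    apply: (@le_trans _ _ (4 ^+ k * ((4 ^+ k)^-1 * (4 ^+ k)^-1 / 2))).
      by rewrite ler_wpM2l// ltW.
    rewrite -!mulrA mulVKf ?gt_eqF// div1r natrX exprSr invfM ler_wpM2r ?invr_ge0//.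
    by rewrite lef_pV2 ?posrE ?exprn_gt0// lerXn2r ?nnegrE// ler_nat.
  exact: (epsilon_trick0 xpredT ler01).
have iW : mu.-integrable setT W.
  apply/integrableP; split=> //; under eq_integral do rewrite gee0_abs//.
  by apply: le_lt_trans intW _; rewrite ltry.
have aeW := integrable_ae measurableT iW.
pose B := [set x | W x = +oo%E].
have mB : measurable (~` B).
  apply: measurableC; rewrite -[B]setTI.
  exact: (mW measurableT [set +oo%E] (emeasurable_set1 _)).
pose ind x : R := \1_(~` B) x.
have cind : cmeasurable (fun x => (ind x)%:C).
  by split; [exact: measurable_indic|exact: measurable_cst].
pose w k x := (ind x)%:C * u (s k) x.
have normind x : normc (ind x)%:C ^+ 2 <= 1.
  by rewrite normc_real /ind indicE; case: (_ \in _); rewrite ?normr1 ?normr0 ?expr1n ?expr0n.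
have Lind h : L2 mu h -> L2 mu (fun x => (ind x)%:C * h x) /\
    L2norm mu (fun x => (ind x)%:C * h x) <= L2norm mu h.
  move=> Lh; have /L2P[mh jh] := Lh.
  have mih := cmeasurableM cind mh.
  apply: L2norm_le => //; first exact: L2norm_ge0.
  rewrite L2norm2//; apply: ge0_le_integral => //.
  - by move=> x _; rewrite lee_fin sqr_ge0.
  - exact/measurable_EFinP/measurable_normc2.
  - exact/measurable_EFinP/measurable_normc2.
  - move=> x _; rewrite lee_fin normcM exprMn; have := normind x.
    by have := sqr_ge0 (normc (h x)); nra.
have Lw k : L2 mu (w k) by have [] := Lind _ (Lu (s k)).
have wE j k : w j - w k = (fun x => (ind x)%:C * (u (s j) - u (s k)) x).
  by apply/funext => x; rewrite /w !fctE mulrBr.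
have cw : L2_cauchy mu w.
  move=> e /cu[M hM]; exists M => j k Mj Mk; rewrite wE.
  apply: le_lt_trans (Lind _ (L2B (Lu _) (Lu _))).2 _.
  by apply: hM; [exact: leq_trans Mj (sge _)|exact: leq_trans Mk (sge _)].
have wcvg x : exists l, ccvg (w^~ x) l.
  have [xB|xB] := pselect (B x).
    exists 0 => e ee; exists 0%N => n _.
    by rewrite /w /ind indicE memNset// ?mul0r ?subrr ?normc0//= => h; exact: h.
  have Wfin : W x \is a fin_num by rewrite ge0_fin_numE// lt_neqAle leey andbT; exact/eqP.
  (* The increment times 2^k has square at most [fine (W x)], hence is at most [fine (W x) + 1]. *)
  apply: (@complex_geometric_cvg _ _ (fine (W x) + 1)) => k.
  rewrite /w -mulrBr normcM normc_real /ind indicE mem_set// normr1 mul1r -/(v k x).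
  rewrite ler_pdivlMr ?exprn_gt0//.
  have h : 4 ^+ k * normc (v k x) ^+ 2 <= fine (W x).
    rewrite -lee_fin fineK//.
    apply: le_trans (nneseries_lim_ge (P := xpredT) k.+1 _) => [|n _ _]; last exact: v0.
    by rewrite big_nat_recr//= leeDr// sume_ge0.
  have h2 : (normc (v k x) * 2 ^+ k) ^+ 2 <= fine (W x).
    by rewrite exprMn mulrC -exprM mulnC exprM (_ : 2 ^+ 2 = 4) //; ring.
  have := fine_ge0 (W0 x); have : 0 <= normc (v k x) * 2 ^+ k.
    by rewrite mulr_ge0 ?normc_ge0 ?exprn_ge0.
  rewrite -[normc (u (s k.+1) x - _)]/(normc (v k x)).
  by set z := normc _ * _ in h2 *; nra.
have /choice[l wl] := wcvg.
have [Ll wlim] := L2_pointwise_limit Lw cw wl.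
exists l => // e ee; have e4 : 0 < e / 4 by rewrite divr_gt0.
have [M1 h1] := cu _ e4; have [M2 h2] := wlim _ e4.
exists M1 => n M1n; pose k := maxn M1 M2.
have Lk := Lu (s k).
have usw : L2norm mu (u (s k) - w k) = 0.
  have Luw : L2 mu (u (s k) - w k) by exact: L2B.
  have [||_ //] := @ae_eq0_L2norm _ _ _ mu (u (s k) - w k).
    by have /L2P[] := Luw.
  apply: filterS aeW => x /(_ I) xfin; rewrite !fctE /w /ind indicE mem_set ?mul1r ?subrr//.
  by move=> xB; move: xfin; rewrite xB.
have d1 := L2norm_quasi (L2B (Lu n) Lk) (L2B Lk Ll).
have d2 := L2norm_quasi (L2B Lk (Lw k)) (L2B (Lw k) Ll).
have E1 : u n - u (s k) + (u (s k) - l) = u n - l by rewrite addrA subrK.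
have E2 : u (s k) - w k + (w k - l) = u (s k) - l by rewrite addrA subrK.
rewrite E1 in d1; rewrite E2 usw expr0n mulr0 add0r in d2.
have a1 := h1 n (s k) M1n (leq_trans (leq_maxl _ _) (sge k)).
have a2 := h2 k (leq_maxr _ _).
rewrite -(ltr_pXn2r (n := 2)) ?nnegrE ?L2norm_ge0 ?(ltW ee)//.
have b1 : L2norm mu (u n - u (s k)) ^+ 2 < (e / 4) ^+ 2.
  by rewrite ltr_pXn2r ?nnegrE ?L2norm_ge0 ?(ltW e4).
have b2 : L2norm mu (w k - l) ^+ 2 < (e / 4) ^+ 2.
  by rewrite ltr_pXn2r ?nnegrE ?L2norm_ge0 ?(ltW e4).
have : 0 < e ^+ 2 by rewrite exprn_gt0.
have E3 : (e / 4) ^+ 2 = e ^+ 2 / 16 by rewrite expr_div_n; congr (_ / _); ring.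
rewrite E3 in b1 b2; lra.
Qed.

Lemma L2_semi_hilbert : semi_hilbert (L2 mu) (L2dot mu).
Proof.
split.
- exact: L20.
- exact: L2D.
- exact: L2Z.
- exact: L2dotDl.
- exact: L2dotZl.
- exact: L2dotC.
- move=> f _; rewrite Re_L2dot; apply: Rintegral_ge0 => x _; exact: sqr_ge0.
- move=> u Lu cu; have [|l Ll ul] := @L2_complete u Lu; last first.
    by exists l => // e /ul[N hN]; exists N => n /hN; rewrite L2norm_snorm.
  by move=> e /cu[N hN]; exists N => m n Nm Nn; rewrite L2norm_snorm; exact: hN.
Qed.

End L2Complete.

(** * Spectral statements for operators of forms on L^2 *)

Section SpectralTheory.
Context d (T : measurableType d) (R : realType).
Variable mu : {measure set T -> \bar R}.
Local Notation F := (T -> R[i]).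
Variables (D : set F) (a : F -> F -> R[i]) (Dnorm : F -> R).
Local Notation A := (form_operator mu D a).
Hypothesis sD : semi_hilbert D (form_dot (L2dot mu) a).
Hypothesis DL2 : D `<=` L2 mu.
Hypothesis a_ge0 : forall u, D u -> 0 <= complex.Re (a u u).
Hypothesis DnormE : forall u, D u -> Dnorm u = snorm (form_dot (L2dot mu) a) u.

Let sX := L2_semi_hilbert mu.

Lemma L2_cvg_subseqP (f : nat -> F) : L2_cvg_subseq mu f <->
  exists2 s : nat -> nat, {homo s : i j / (i < j)%N} &
  exists2 g, L2 mu g & forall e : R, 0 < e -> exists N, forall n, (N <= n)%N ->
    snorm (L2dot mu) (f (s n) - g) < e.
Proof.
split=> -[s hs [g Lg fg]]; exists s => //; exists g => //.
  move=> e e0; move/cvgrPdist_lt : fg => /(_ _ e0)[N _ hN]; exists N => n Nn.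
  have := hN n Nn; rewrite /= sub0r normrN ger0_norm ?L2norm_ge0//.
  by rewrite L2norm_snorm.
apply/cvgrPdist_lt => e /fg[N hN]; exists N => // n /= /hN.
by rewrite sub0r normrN ger0_norm ?L2norm_ge0// L2norm_snorm.
Qed.

Lemma eigenfunctionE l u : eigenfunction A l u = form_eigen (L2 mu) (L2dot mu) D a l u.
Proof. by rewrite /form_eigen /form_res addr0. Qed.

Lemma resolvent_setP l :
  resolvent_set mu A l <-> form_resolvent (L2 mu) (L2dot mu) D a l.
Proof.
split=> -[h [M hM]]; split=> //; exists M => w u Lw ru.
  by rewrite -!L2norm_snorm; exact: hM.
by rewrite !L2norm_snorm; exact: hM.
Qed.

Lemma eigenvalueP l : eigenvalue mu A l <->
  exists2 u, form_eigen (L2 mu) (L2dot mu) D a l u & snorm (L2dot mu) u != 0.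
Proof.
by split=> -[u eu nu]; exists u; rewrite ?L2norm_snorm// -?L2norm_snorm//;
  move: eu; rewrite eigenfunctionE.
Qed.

Lemma finite_multiplicityP l : finite_multiplicity mu A l <->
  exists n (b : 'I_n -> F), (forall i, form_eigen (L2 mu) (L2dot mu) D a l (b i)) /\
    forall u, form_eigen (L2 mu) (L2dot mu) D a l u -> exists c : 'I_n -> R[i],
      snorm (L2dot mu) (u - \sum_(i < n) c i *: b i) = 0.
Proof.
have key n (b : 'I_n -> F) u (c : 'I_n -> R[i]) x :
    (u - \sum_(i < n) c i *: b i) x = u x - \sum_(i < n) c i * b i x.
  by rewrite !fctE fct_sumE.
have LD n (b : 'I_n -> F) u (c : 'I_n -> R[i]) :
    (forall i, eigenfunction A l (b i)) -> eigenfunction A l u ->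
    L2 mu (u - \sum_(i < n) c i *: b i).
  move=> eb [/DL2 Lu _ _]; apply: L2B => //.
  elim/big_ind: _ => [||i _]; [exact: L20|exact: L2D|].
  by apply: L2Z; have [/DL2] := eb i.
split=> -[n [b [eb hb]]]; exists n, b; split=> [i|u eu].
- by rewrite -eigenfunctionE.
- rewrite -eigenfunctionE in eu; have [c uc] := hb _ eu; exists c.
  rewrite -L2norm_snorm; have [||] // := @ae_eq0_L2norm _ _ _ mu (u - \sum_(i < n) c i *: b i).
    by have /L2P[] := LD _ _ _ c eb eu.
  by apply: filterS uc => x ux; rewrite key ux subrr.
- by rewrite eigenfunctionE.
- have eu' := eu; rewrite eigenfunctionE in eu'; have [c uc] := hb _ eu'; exists c.
  have eb' i : eigenfunction A l (b i).
    by rewrite eigenfunctionE; exact: eb.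
  rewrite -L2norm_snorm in uc.
  have := L2_ae_eq0 (LD _ _ _ c eb' eu) uc.
  by apply: filterS => x; rewrite key => /eqP; rewrite subr_eq0 => /eqP.
Qed.

Lemma compact_embedding_form : compactly_embedded mu D Dnorm ->
  forall f : nat -> F, (forall n, D (f n)) ->
  (exists M, forall n, snorm (form_dot (L2dot mu) a) (f n) <= M) ->
  exists2 s : nat -> nat, {homo s : i j / (i < j)%N} &
  exists2 g, L2 mu g & forall e : R, 0 < e -> exists N, forall n, (N <= n)%N ->
    snorm (L2dot mu) (f (s n) - g) < e.
Proof.
move=> [_ cD] f Df [M hM]; apply/L2_cvg_subseqP; apply: cD => //.
by exists M => n; rewrite DnormE.
Qed.

Lemma compact_resolvent_form : compactly_embedded mu D Dnorm -> compact_resolvent mu A.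
Proof.
move=> [_ cD]; split.
  by exists (-1); apply/resolvent_setP; exact: form_resolventN1 sX sD DL2 a_ge0.
move=> l /resolvent_setP rl w u Lw ru [M wM]; apply: cD.
  by move=> n; have [] := ru n.
have [|K uK] := form_res_bounded sX DL2 rl Lw ru.
  by exists M => n; rewrite -L2norm_snorm.
by exists K => n; rewrite DnormE//; have [] := ru n.
Qed.

(** A spectral point that is no eigenvalue would be in the resolvent set by the Fredholm
    alternative. As the spectrum consists of eigenvalues, isolation among these is isolation in the
    spectrum. *)
Lemma compact_purely_discrete : compactly_embedded mu D Dnorm ->
  purely_discrete_spectrum mu A.
Proof.
move=> /compact_embedding_form cD; apply/seteqP; split=> // l [Sl nd]; apply: nd.
have spec_eig z : spectrum mu A z ->
    exists2 u, form_eigen (L2 mu) (L2dot mu) D a z u & snorm (L2dot mu) u != 0.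
  move=> Sz; apply: contrapT => h; apply: Sz; apply/resolvent_setP.
  apply: (form_fredholm sX sD DL2 a_ge0 cD) => u eu; apply/eqP.
  by apply: contrapT => /negP nu; apply: h; exists u.
split.
- split=> //; have [e e0 he] := form_eigen_isolated sX sD DL2 a_ge0 cD l.
  by exists e => // z /spec_eig ez zl; exact: he.
- exact/eigenvalueP/spec_eig.
- exact/finite_multiplicityP/(form_eigen_finite sX sD DL2 a_ge0 cD).
Qed.

Lemma essential_spectrum_form (f : nat -> F) (M : R) :
  (forall n, D (f n)) -> L2_orthonormal mu f ->
  (forall m n, m != n -> a (f m) (f n) = 0) ->
  (forall n, Dnorm (f n) <= M) -> essential_spectrum mu A !=set0.
Proof.
move=> Df fo fa fM.
have aM n : complex.Re (a (f n) (f n)) <= M ^+ 2.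
  have M0 : 0 <= M by apply: le_trans (fM n); rewrite DnormE ?snorm_ge0.
  apply: (@le_trans _ _ (Dnorm (f n) ^+ 2)); last first.
    by rewrite ler_pXn2r ?nnegrE// DnormE ?snorm_ge0.
  rewrite DnormE// (snorm2 sD)// cReD lerDr.
  exact: (sdot_ge0 sX (DL2 (Df n))).
have [l nl dl] := form_essential sX sD DL2 a_ge0 Df fo fa aM.
exists l; split=> [/resolvent_setP//|[[_ [e e0 he]] /eigenvalueP el /finite_multiplicityP fl]].
apply: dl; split=> //; exists e => // z nz; apply: he.
by move=> /resolvent_setP.
Qed.

End SpectralTheory.

(** * Restricted integrals and Cauchy-Schwarz *)

Lemma integral_mrestr (R : realType) d (T : measurableType d)
    (m : {measure set T -> \bar R}) (D : set T) (mD : measurable D) (f : T -> \bar R) :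
  measurable_fun setT f -> (forall x, (0 <= f x)%E) ->
  (\int[mrestr m mD]_x f x = \int[m]_(x in D) f x)%E.
Proof.
move=> mf f0.
rewrite (@ge0_negligible_integral _ _ _ (mrestr m mD) setT (~` D))//.
- rewrite setTD setCK; apply: eq_measure_integral => A mA AD /=.
  transitivity (m (A `&` D)); first by [].
  by rewrite setIidl.
- exact: measurableC.
- transitivity (m (~` D `&` D)); first by [].
  by rewrite setICl measure0.
Qed.

Lemma integrable_cst_lty (R : realType) d (T : measurableType d)
    (m : {measure set T -> \bar R}) (D : set T) (c : R) :
  measurable D -> (m D < +oo)%E ->
  m.-integrable D (EFin \o (fun=> c)).
Proof.
move=> mD Dy; apply/integrableP; split; first exact: measurable_cst.
rewrite (eq_integral (cst `|c|%:E))// integral_cst//.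
by rewrite lte_mul_pinfty// lee_fin.
Qed.

Lemma cauchy_schwarz_Rintegral (R : realType) d (T : measurableType d)
    (m : {measure set T -> \bar R}) (D : set T) (h : T -> R) (L : R) :
  measurable D -> m D = L%:E ->
  m.-integrable D (EFin \o h) ->
  m.-integrable D (fun x => (h x ^+ 2)%:E) ->
  (\int[m]_(x in D) h x) ^+ 2 <=
  L * \int[m]_(x in D) (h x ^+ 2).
Proof.
move=> mD DL ih ih2.
have L0 : 0 <= L by rewrite -lee_fin -DL measure_ge0.
have ic (c : R) : m.-integrable D (EFin \o (fun=> c)).
  by apply: integrable_cst_lty => //; rewrite DL ltry.
apply: discriminant => // t.
have : 0 <= \int[m]_(x in D) (h x + t) ^+ 2.
  by apply: Rintegral_ge0 => x _; exact: sqr_ge0.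
have -> : \int[m]_(x in D) (h x + t) ^+ 2 =
   \int[m]_(x in D) ((h x ^+ 2 + (2 * t) * h x) + t ^+ 2).
  by apply: eq_Rintegral => x _; ring.
have i2 : m.-integrable D (EFin \o (fun x => 2 * t * h x)).
  exact: (integrableZl mD (2 * t) ih).
rewrite RintegralD//; last first.
  rewrite (_ : (EFin \o _) = (fun x => (h x ^+ 2)%:E) \+ (EFin \o (fun x => 2 * t * h x))) //.
  exact: integrableD.
rewrite RintegralD// RintegralZl// Rintegral_cst// DL /=.
set a := \int[_]_(_ in _) _; set b := \int[_]_(_ in _) _.
by rewrite [t ^+ 2 * L]mulrC; lra.
Qed.

(** * Functions on the comb *)

Section Comb.
Variables (R : realType) (alpha : R).
Hypothesis alpha_gt0 : 0 < alpha.
Local Notation sv := (shaft_vertex alpha).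
Local Notation ep := (edge_point alpha).
Local Notation len := (edge_length alpha).
Local Notation mu := (comb_measure alpha).
Local Notation leb := (@lebesgue_measure R).
Implicit Types (f g : plane R -> R[i]).

Lemma vertex_gt0 n : 0 < sv n.
Proof. by rewrite /shaft_vertex powR_gt0. Qed.

Lemma vertex_lt m n : (m < n)%N -> sv n < sv m.
Proof.
move=> mn; rewrite /shaft_vertex !powRN ltf_pV2 ?posrE ?powR_gt0//.
by rewrite gt0_ltr_powR ?nnegrE// ltr_nat ltnS.
Qed.

Lemma vertex_le m n : (m <= n)%N -> sv n <= sv m.
Proof. by rewrite leq_eqVlt => /predU1P[->//|/vertex_lt/ltW]. Qed.

Lemma vertex0 : sv 0 = 1.
Proof. by rewrite /shaft_vertex powR1. Qed.

Lemma vertex_le1 n : sv n <= 1.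
Proof. by rewrite -vertex0; exact: vertex_le. Qed.

Lemma vertex_small (e : R) : 0 < e -> exists N : nat, forall n, (N <= n)%N -> sv n < e.
Proof.
move=> e0; have e1 : 0 < e `^ (alpha^-1) by rewrite powR_gt0.
have [N hN] := archi_inv e1; exists N => n /hN h.
rewrite /shaft_vertex powRN -powR_inv1 ?ler0n// powR_inv1 ?powR_ge0//.
have -> : e = (e `^ (alpha^-1)) `^ alpha.
  by rewrite -powRrM mulVf ?gt_eqF// powRr1// ltW.
rewrite -powRN.
have -> : n.+1%:R `^ (- alpha) = (n.+1%:R^-1) `^ alpha :> R.
  by rewrite -[in RHS]powR_inv1 ?ler0n// -powRrM mulN1r.
by rewrite gt0_ltr_powR ?nnegrE ?invr_ge0 ?ler0n ?powR_ge0.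
Qed.

Lemma edge_length_gt0 e : 0 < len e.
Proof. by case: e => n /=; rewrite ?subr_gt0 ?vertex_lt ?vertex_gt0. Qed.

Lemma edge_length_le1 e : len e <= 1.
Proof. by case: e => n /=; have := vertex_le1 n; have := vertex_gt0 n.+1; lra. Qed.

Lemma comb_integral (F : plane R -> \bar R) :
  measurable_fun setT F -> (forall p, (0 <= F p)%E) ->
  (\int[mu]_p F p = \sum_(n <oo)
     (\int[leb]_(t in `[0%R, len (inl n)]) F (ep (inl n) t) +
      \int[leb]_(t in `[0%R, len (inr n)]) F (ep (inr n) t)))%E.
Proof.
move=> mF F0; rewrite /comb_measure ge0_integral_measure_series//.
apply: eq_eseriesr => n _; rewrite ge0_integral_measure_add//.
have E e : (\int[edge_measure alpha e]_x F x =
    \int[leb]_(t in `[0%R, len e]) F (ep e t))%E.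
  rewrite ge0_integral_pushforward//; last exact: measurable_edge_point.
  rewrite preimage_setT integral_mrestr//; last by move=> x; exact: F0.
  by apply: measurableT_comp => //; exact: measurable_edge_point.
by congr (_ + _)%E; exact: E.
Qed.

Lemma cmeasurable_edge f e : cmeasurable f -> cmeasurable (fun t : measurableTypeR R => f (ep e t)).
Proof.
by move=> [f1 f2]; split; [exact: (measurableT_comp f1 (measurable_edge_point _ e))|
  exact: (measurableT_comp f2 (measurable_edge_point _ e))].
Qed.

(** The squared L^2-norm over one edge: the mass there when taken of the function, the energy when
    taken of its derivative. *)
Definition edge_energy f e : R := fine (\int[leb]_(t in `[0%R, len e]) (normc (f (ep e t)) ^+ 2)%:E)%E.

Lemma edge_energy_ge0 f e : 0 <= edge_energy f e.
Proof. by rewrite fine_ge0// integral_ge0// => t _; rewrite lee_fin sqr_ge0. Qed.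

Lemma edge_integral_le f e : L2 mu f ->
  (\int[leb]_(t in `[0%R, len e]) (normc (f (ep e t)) ^+ 2)%:E <= (L2norm mu f ^+ 2)%:E)%E.
Proof.
move=> /[dup] Lf /L2P[mf _]; rewrite L2norm2//.
have mF : measurable_fun setT (fun p => (normc (f p) ^+ 2)%:E).
  exact/measurable_EFinP/measurable_normc2.
have F0 p : (0 <= (normc (f p) ^+ 2)%:E)%E by rewrite lee_fin sqr_ge0.
rewrite comb_integral//.
have G0 k : (0 <= \int[leb]_(t in `[0%R, len (inl k)]) (normc (f (ep (inl k) t)) ^+ 2)%:E +
      \int[leb]_(t in `[0%R, len (inr k)]) (normc (f (ep (inr k) t)) ^+ 2)%:E)%E.
  by rewrite adde_ge0// integral_ge0.
have key n : (\int[leb]_(t in `[0%R, len (inl n)]) (normc (f (ep (inl n) t)) ^+ 2)%:E +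
      \int[leb]_(t in `[0%R, len (inr n)]) (normc (f (ep (inr n) t)) ^+ 2)%:E <=
   \sum_(n <oo) (\int[leb]_(t in `[0%R, len (inl n)]) (normc (f (ep (inl n) t)) ^+ 2)%:E +
      \int[leb]_(t in `[0%R, len (inr n)]) (normc (f (ep (inr n) t)) ^+ 2)%:E))%E.
  apply: le_trans (nneseries_lim_ge (P := xpredT) n.+1 _) => [|k _ _]; last exact: G0.
  by rewrite big_nat_recr//= leeDr//; apply: sume_ge0 => i _; exact: G0.
case: e => n; apply: le_trans (key n).
  by rewrite leeDl// integral_ge0.
by rewrite leeDr// integral_ge0.
Qed.

Lemma edge_energyE f e : L2 mu f ->
  (edge_energy f e)%:E = (\int[leb]_(t in `[0%R, len e]) (normc (f (ep e t)) ^+ 2)%:E)%E.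
Proof.
move=> Lf; rewrite fineK// ge0_fin_numE; last by apply: integral_ge0 => t _; rewrite lee_fin sqr_ge0.
by apply: le_lt_trans (edge_integral_le e Lf) _; rewrite ltry.
Qed.

Lemma edge_energy_le f e : L2 mu f -> edge_energy f e <= L2norm mu f ^+ 2.
Proof. by move=> Lf; rewrite -lee_fin edge_energyE// edge_integral_le. Qed.

Lemma L2norm2_edges f : L2 mu f ->
  (L2norm mu f ^+ 2)%:E = (\sum_(n <oo) (edge_energy f (inl n) + edge_energy f (inr n))%:E)%E.
Proof.
move=> /[dup] Lf /L2P[mf _]; rewrite L2norm2// comb_integral//.
- by apply: eq_eseriesr => n _; rewrite EFinD !edge_energyE.
- exact/measurable_EFinP/measurable_normc2.
- by move=> p; rewrite lee_fin sqr_ge0.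
Qed.

Lemma edge_integrable f e : L2 mu f ->
  [/\ leb.-integrable `[0, len e] (fun t => (normc (f (ep e t)) ^+ 2)%:E),
      leb.-integrable `[0, len e] (EFin \o (fun t => complex.Re (f (ep e t)))) &
      leb.-integrable `[0, len e] (EFin \o (fun t => complex.Im (f (ep e t))))].
Proof.
move=> /[dup] Lf /L2P[mf _]; have [me1 me2] := cmeasurable_edge e mf.
have i2 : leb.-integrable `[0, len e] (fun t => (normc (f (ep e t)) ^+ 2)%:E).
  apply/integrableP; split.
    apply/measurable_EFinP; apply: measurable_funTS.
    exact: (measurable_normc2 (cmeasurable_edge e mf)).
  under eq_integral do rewrite gee0_abs ?lee_fin ?sqr_ge0//.
  by apply: le_lt_trans (edge_integral_le e Lf) _; rewrite ltry.
have i1 : leb.-integrable `[0, len e] (fun t => (normc (f (ep e t)) ^+ 2 + 1)%:E).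
  rewrite (_ : (fun _ => _) = (fun t => (normc (f (ep e t)) ^+ 2)%:E) \+ (fun=> 1%:E)) //.
  apply: integrableD => //; apply: (@integrable_cst_lty _ _ _ _ _ 1) => //.
  by rewrite /= lebesgue_measure_itv/=; case: ifP => _; rewrite ?ltry// -EFinB ltry.
split=> //; apply: le_integrable i1 => //; try exact/measurable_EFinP/measurable_funTS.
- move=> t _; rewrite /= lee_fin [leRHS]ger0_norm ?addr_ge0 ?sqr_ge0//.
  apply: le_trans (ler_Re_normc _) _; have := sqr_ge0 (normc (f (ep e t)) - 1).
  by have := normc_ge0 (f (ep e t)); nra.
- move=> t _; rewrite /= lee_fin [leRHS]ger0_norm ?addr_ge0 ?sqr_ge0//.
  apply: le_trans (ler_Im_normc _) _; have := sqr_ge0 (normc (f (ep e t)) - 1).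
  by have := normc_ge0 (f (ep e t)); nra.
Qed.

(** Cauchy-Schwarz on []s, t]] for the real and imaginary parts separately; their squares add up to
    the energy. *)
Lemma edge_cintegral_bound g e s t : L2 mu g -> 0 <= s -> s <= t -> t <= len e ->
  normc (cintegral leb `[0, t] (fun x => g (ep e x)) -
         cintegral leb `[0, s] (fun x => g (ep e x))) ^+ 2 <= (t - s) * edge_energy g e.
Proof.
move=> Lg s0 st tl.
have [i2 iR iI] := edge_integrable e Lg.
have sub : `]s, t] `<=` `[0, len e].
  by move=> x /=; rewrite !in_itv/= => /andP[a b]; rewrite (le_trans s0 (ltW a)) (le_trans b).
have sub0 : `[0, t] `<=` `[0, len e].
  by move=> x /=; rewrite !in_itv/= => /andP[a b]; rewrite a (le_trans b).
have intB (h : R -> R) : leb.-integrable `[0, len e] (EFin \o h) ->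
    \int[leb]_(x in `[0, t]) h x - \int[leb]_(x in `[0, s]) h x =
    \int[leb]_(x in `]s, t]) h x.
  by move=> ih; apply: Rintegral_itvB; rewrite ?bnd_simp//; exact: integrableS ih.
have L : leb `]s, t] = (t - s)%:E.
  rewrite lebesgue_measure_itv/= lte_fin; case: ltP => // ts.
  by have /eqP -> : t == s; [rewrite eq_le ts st|rewrite subrr].
have i2S : leb.-integrable `]s, t] (fun t => (normc (g (ep e t)) ^+ 2)%:E).
  exact: integrableS i2.
have sq (h : R -> R) : leb.-integrable `[0, len e] (EFin \o h) ->
    (forall x, `|h x| <= normc (g (ep e x))) ->
    leb.-integrable `]s, t] (fun x => (h x ^+ 2)%:E).
  move=> ih hg; apply: le_integrable i2S => //.
    move/integrableP : ih => [/measurable_EFinP mh _].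
    apply/measurable_EFinP/measurable_funX.
    exact: measurable_funS mh.
  move=> x _; rewrite lee_fin !ger0_norm ?sqr_ge0// -[leLHS]real_normK ?num_real//.
  by rewrite ler_pXn2r ?nnegrE ?normc_ge0.
have iR2 := sq _ iR (fun x => ler_Re_normc _).
have iI2 := sq _ iI (fun x => ler_Im_normc _).
rewrite normcE2 cReD cReN cImB /cintegral /= !intB//.
have iRS : leb.-integrable `]s, t] (EFin \o (fun t => complex.Re (g (ep e t)))).
  exact: integrableS iR.
have iIS : leb.-integrable `]s, t] (EFin \o (fun t => complex.Im (g (ep e t)))).
  exact: integrableS iI.
have cR := @cauchy_schwarz_Rintegral _ _ _ leb `]s, t]%classic _ (t - s)
  (measurable_itv _) L iRS iR2.
have cI := @cauchy_schwarz_Rintegral _ _ _ leb `]s, t]%classic _ (t - s)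
  (measurable_itv _) L iIS iI2.
apply: le_trans (lerD cR cI) _.
rewrite -mulrDr ler_wpM2l ?subr_ge0// -RintegralD//.
have -> : \int[leb]_(x in `]s, t]) (complex.Re (g (ep e x)) ^+ 2 + complex.Im (g (ep e x)) ^+ 2) =
   fine (\int[leb]_(x in `]s, t]) (normc (g (ep e x)) ^+ 2)%:E)%E.
  by congr fine; apply: eq_integral => x _; rewrite normcE2.
apply: fine_le.
- exact: integrable_fin_num i2S.
- exact: integrable_fin_num i2.
apply: ge0_subset_integral => //.
  by move/integrableP : i2 => [].
by move=> x _; rewrite lee_fin sqr_ge0.
Qed.

Lemma edge_holder f g e s t : L2 mu g -> is_comb_derivative alpha f g ->
  0 <= s -> s <= t -> t <= len e ->
  normc (f (ep e t) - f (ep e s)) ^+ 2 <= (t - s) * edge_energy g e.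
Proof.
move=> Lg fg s0 st tl.
rewrite (fg e t) ?tl ?(le_trans s0)// (fg e s) ?s0 ?(le_trans st)//.
by rewrite opprD addrACA subrr add0r; exact: edge_cintegral_bound.
Qed.

End Comb.

(** Cauchy-Schwarz in the plane. It joins Hoelder estimates on adjacent pieces into one whose length
    and energy are the sums, with no loss in the constant. *)
Lemma sqr_split_le (R : realType) (a b L1 L2 A1 A2 : R) :
  0 <= a -> 0 <= b -> 0 <= L1 -> 0 <= L2 -> 0 <= A1 -> 0 <= A2 ->
  a ^+ 2 <= L1 * A1 -> b ^+ 2 <= L2 * A2 -> (a + b) ^+ 2 <= (L1 + L2) * (A1 + A2).
Proof.
move=> a0 b0 L10 L20 A10 A20 ha hb.
have h : a * b *+ 2 <= L1 * A2 + L2 * A1.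
  have c0 : 0 <= L1 * A2 + L2 * A1 by rewrite addr_ge0 ?mulr_ge0.
  rewrite -(ler_pXn2r (n := 2)) ?nnegrE ?mulrn_wge0 ?mulr_ge0//.
  apply: (@le_trans _ _ (4 * ((L1 * A1) * (L2 * A2)))).
    rewrite -mulr_natl !exprMn -natrX ler_wpM2l// ler_pM ?sqr_ge0//.
  by have := sqr_ge0 (L1 * A2 - L2 * A1); lra.
by rewrite sqrrD; lra.
Qed.

(** * Pointwise estimates on the comb *)

Section CombEstimates.
Variables (R : realType) (alpha : R).
Hypothesis alpha_gt0 : 0 < alpha.
Local Notation sv := (shaft_vertex alpha).
Local Notation ep := (edge_point alpha).
Local Notation len := (edge_length alpha).
Local Notation mu := (comb_measure alpha).
Local Notation leb := (@lebesgue_measure R).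
Local Notation cdist := (@comb_dist R).
Implicit Types (f g : plane R -> R[i]) (p q : plane R).

(** Negative [c] is allowed for the sake of [comb_sup_bound], where the lower bound for |f|^2 may be
    negative. *)
Lemma edge_energy_lower f e (c : R) : L2 mu f ->
  (forall t, 0 <= t <= len e -> c <= normc (f (ep e t)) ^+ 2) ->
  c * len e <= edge_energy alpha f e.
Proof.
move=> Lf fc; have [c0|c0] := leP 0 c; last first.
  apply: le_trans (edge_energy_ge0 _ _ _).
  by rewrite nmulr_rle0// ltW// edge_length_gt0.
have l0 := edge_length_gt0 alpha_gt0 e.
rewrite -lee_fin edge_energyE//.
have -> : (c * len e)%:E = (\int[leb]_(t in `[0%R, len e]) c%:E)%E.
  rewrite integral_cst//= lebesgue_measure_itv/= lte_fin l0 -EFinB subr0.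
  by rewrite -EFinM.
apply: ge0_le_integral => //.
by have [/integrableP[+ _] _ _] := edge_integrable e Lf; exact.
Qed.

Lemma edge_energy_upper f e (c : R) : L2 mu f ->
  (forall t, 0 <= t <= len e -> normc (f (ep e t)) ^+ 2 <= c) ->
  edge_energy alpha f e <= c * len e.
Proof.
move=> Lf fc; have l0 := edge_length_gt0 alpha_gt0 e.
have c0 : 0 <= c.
  by apply: le_trans (fc 0 _); rewrite ?sqr_ge0// lexx ltW.
rewrite -lee_fin edge_energyE//.
have -> : (c * len e)%:E = (\int[leb]_(t in `[0%R, len e]) c%:E)%E.
  rewrite integral_cst//= lebesgue_measure_itv/= lte_fin l0 -EFinB subr0.
  by rewrite -EFinM.
apply: ge0_le_integral => //.
- by move=> t _; rewrite lee_fin sqr_ge0.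
- have [/integrableP[+ _] _ _] := edge_integrable e Lf; exact.
Qed.

Lemma edge_energy_sum f N : L2 mu f ->
  \sum_(0 <= k < N) (edge_energy alpha f (inl k) + edge_energy alpha f (inr k)) <=
  L2norm mu f ^+ 2.
Proof.
move=> Lf; rewrite -lee_fin L2norm2_edges// -sumEFin.
apply: nneseries_lim_ge => k _ _.
by rewrite lee_fin addr_ge0// edge_energy_ge0.
Qed.

Lemma comb_shaft (x : R) : 0 < x <= 1 -> comb alpha (x, 0).
Proof. by move=> x01; left. Qed.

Lemma comb_edge e t : 0 <= t <= len e -> comb alpha (ep e t).
Proof.
case: e => n /= /andP[t0 tl]; last by right; exists n => //=; rewrite t0 tl.
left; split=> //=; have := vertex_gt0 alpha n.+1; have := vertex_le1 alpha_gt0 n; lra.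
Qed.

Lemma combP p : comb alpha p -> [/\ 0 < p.1 <= 1, 0 <= p.2, p.2 <= p.1 &
  p.2 = 0 \/ exists2 n, p.1 = sv n & p.2 <= sv n].
Proof.
move=> [[/andP[a b] c]|[n a /andP[b c]]].
  by split; rewrite ?a ?c//; [exact: ltW|left].
by split; rewrite ?a ?vertex_gt0 ?vertex_le1//; right; exists n.
Qed.

Lemma comb_foot p : comb alpha p -> comb alpha (p.1, 0).
Proof. by move=> /combP[p1 _ _ _]; exact: comb_shaft. Qed.

Lemma shaft_edge (x : R) : 0 < x <= 1 -> exists n, sv n.+1 <= x <= sv n.
Proof.
move=> /andP[x0 x1].
have [N hN] := vertex_small alpha_gt0 x0.
have ex : exists n, sv n < x by exists N; exact: hN.
case: (ex_minnP ex) => -[|m] hm mmin; first by move: hm; rewrite vertex0; lra.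
exists m; rewrite (ltW hm)/= leNgt; apply/negP => /mmin.
by rewrite ltnn.
Qed.

Section Holder.
Variables (f g : plane R -> R[i]).
Hypothesis Lg : L2 mu g.
Hypothesis fg : is_comb_derivative alpha f g.
Local Notation W := (L2norm mu g).

Lemma edge_holder_sqrt e s t : 0 <= s <= len e -> 0 <= t <= len e ->
  normc (f (ep e t) - f (ep e s)) <= Num.sqrt `|t - s| * W.
Proof.
wlog st : s t / s <= t.
  move=> h hs ht; have [st|ts] := leP s t; first exact: h.
  by rewrite normcB distrC; apply: h => //; exact: ltW.
move=> /andP[s0 _] /andP[_ tl].
have W0 := L2norm_ge0 mu g.
rewrite -(ler_pXn2r (n := 2)) ?nnegrE ?normc_ge0 ?mulr_ge0 ?sqrtr_ge0//.
rewrite exprMn sqr_sqrtr// ger0_norm ?subr_ge0//.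
apply: le_trans (edge_holder Lg fg s0 st tl) _.
by rewrite ler_wpM2l ?subr_ge0// edge_energy_le.
Qed.

(** Induction over the edges with [sqr_split_le]: the constant stays 1 for any number of vertices in
    between. *)
Lemma vertex_holder2 m n : (m <= n)%N ->
  normc (f (sv m, 0) - f (sv n, 0)) ^+ 2 <=
  (sv m - sv n) * \sum_(m <= k < n) edge_energy alpha g (inl k).
Proof.
elim: n => [|n ih].
  by rewrite leqn0 => /eqP ->; rewrite subrr normc0 expr0n/= subrr mul0r.
rewrite leq_eqVlt => /predU1P[->|]; first by rewrite subrr normc0 expr0n/= subrr mul0r.
rewrite ltnS => mn; rewrite big_nat_recr//=.
have -> : f (sv m, 0) - f (sv n.+1, 0) =
   (f (sv m, 0) - f (sv n, 0)) + (f (sv n, 0) - f (sv n.+1, 0)).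
  by rewrite addrA subrK.
have -> : sv m - sv n.+1 = (sv m - sv n) + (sv n - sv n.+1) by rewrite addrA subrK.
apply: (@le_trans _ _ ((normc (f (sv m, 0) - f (sv n, 0)) +
    normc (f (sv n, 0) - f (sv n.+1, 0))) ^+ 2)).
  by rewrite ler_pXn2r ?nnegrE ?addr_ge0 ?normc_ge0// normcD.
have l0 := edge_length_gt0 alpha_gt0 (inl n).
apply: sqr_split_le; rewrite ?normc_ge0 ?subr_ge0 ?vertex_le//.
- by apply: sumr_ge0 => k _; exact: edge_energy_ge0.
- exact: edge_energy_ge0.
- exact: ih.
have := edge_holder Lg fg (lexx 0) (ltW l0) (lexx _).
by rewrite /edge_point /= addr0 subr0 (_ : sv n.+1 + (sv n - sv n.+1) = sv n); last ring.
Qed.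

Lemma vertex_holder m n : (m <= n)%N ->
  normc (f (sv m, 0) - f (sv n, 0)) <= Num.sqrt (sv m - sv n) * W.
Proof.
move=> mn; have W0 := L2norm_ge0 mu g.
rewrite -(ler_pXn2r (n := 2)) ?nnegrE ?normc_ge0 ?mulr_ge0 ?sqrtr_ge0//.
rewrite exprMn sqr_sqrtr ?subr_ge0 ?vertex_le//.
apply: le_trans (vertex_holder2 mn) _; rewrite ler_wpM2l ?subr_ge0 ?vertex_le//.
apply: le_trans (edge_energy_sum n Lg).
rewrite [leRHS](big_cat_nat (leq0n m) mn)/=; apply: ler_wpDl.
  by apply: sumr_ge0 => k _; rewrite addr_ge0// edge_energy_ge0.
by apply: ler_sum => k _; rewrite lerDl edge_energy_ge0.
Qed.

(** The 3 counts the pieces between the two points: a partial edge on each side and a run between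
    vertices, none longer than the distance. *)
Lemma shaft_holder x y : 0 < x <= 1 -> 0 < y <= 1 ->
  normc (f (y, 0) - f (x, 0)) <= 3 * Num.sqrt `|y - x| * W.
Proof.
wlog xy : x y / x <= y.
  move=> h hx hy; have [xy|yx] := leP x y; first exact: h.
  by rewrite normcB distrC; apply: h => //; exact: ltW.
move=> /shaft_edge[n /andP[n1 n2]] /shaft_edge[m /andP[m1 m2]].
have W0 := L2norm_ge0 mu g.
have on k (z : R) : (z, 0) = ep (inl k) (z - sv k.+1) by rewrite /= addrC subrK.
rewrite (@ger0_norm _ (y - x)) ?subr_ge0//.
have mon d : d <= y - x -> Num.sqrt d * W <= Num.sqrt (y - x) * W.
  move=> h; rewrite ler_wpM2r//; have [d0|d0] := leP 0 d; first by rewrite ler_sqrt ?subr_ge0.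
  by rewrite ltr0_sqrtr// sqrtr_ge0.
have nn : 0 <= Num.sqrt (y - x) * W by rewrite mulr_ge0 ?sqrtr_ge0.
have xp : 0 <= x - sv n.+1 <= len (inl n) by rewrite /= subr_ge0 n1 lerB.
have yp : 0 <= y - sv m.+1 <= len (inl m) by rewrite /= subr_ge0 m1 lerB.
have [mn|nm] := ltnP m n; last first.
  have [n_eq|n_lt] : n = m \/ (n < m)%N.
    by move: nm; rewrite leq_eqVlt => /predU1P[|]; [left|right].
  - subst m; have := edge_holder_sqrt xp yp; rewrite -!on.
    rewrite opprB addrA subrK ger0_norm ?subr_ge0// => h.
    by apply: le_trans h _; rewrite -mulrA; lra.
  (* Here [y] lies on an edge nearer to the end than that of [x <= y], so both are the vertex common
     to the two edges. *)
  - have := vertex_le alpha_gt0 n_lt => h.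
    have -> : y = x by lra.
    by rewrite !subrr normc0 sqrtr0 mulr0 mul0r.
have h1 := @edge_holder_sqrt (inl m) 0 (y - sv m.+1); rewrite -on in h1.
have h3 := @edge_holder_sqrt (inl n) (x - sv n.+1) (len (inl n)); rewrite -!on in h3.
have h2 := vertex_holder mn.
have l0 e : 0 <= (0 : R) <= len e by rewrite lexx ltW ?edge_length_gt0.
have ll e : 0 <= len e <= len e by rewrite lexx ltW ?edge_length_gt0.
move: {h1}(h1 (l0 _) yp) {h3}(h3 xp (ll _)).
rewrite /edge_point /= addr0 subr0.
rewrite (_ : sv n - sv n.+1 - (x - sv n.+1) = sv n - x); last by ring.
rewrite !ger0_norm ?subr_ge0//.
have svmn := vertex_le alpha_gt0 mn.
move=> h1 h3.
have k1 := mon (y - sv m.+1) _; have k2 := mon (sv m.+1 - sv n) _.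
have k3 := mon (sv n - x) _.
have -> : f (y, 0) - f (x, 0) = (f (y, 0) - f (sv m.+1, 0)) +
   (f (sv m.+1, 0) - f (sv n, 0)) + (f (sv n, 0) - f (x, 0)).
  by rewrite !addrA !subrK.
apply: le_trans (normcD _ _) _; apply: le_trans (lerD (normcD _ _) (lexx _)) _.
rewrite -mulrA.
have {}k1 := k1 ltac:(lra). have {}k2 := k2 ltac:(lra). have {}k3 := k3 ltac:(lra).
lra.
Qed.

Lemma vertical_holder p q : comb alpha p -> comb alpha q -> p.1 = q.1 ->
  normc (f p - f q) <= Num.sqrt `|p.2 - q.2| * W.
Proof.
case: p q => [x y] [x' z] /combP[/= x01 y0 yx hy] /combP[/= _ z0 zx hz] xx'.
move: xx' zx hz => <- zx hz.
have [yz|yz] := eqVneq y z; first by rewrite yz !subrr normc0 normr0 sqrtr0 mul0r.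
have [n xn] : exists n, x = sv n.
  case: hy => [y00|[n -> _]]; last by exists n.
  case: hz => [z00|[n -> _]]; last by exists n.
  by move: yz; rewrite y00 z00 eqxx.
subst x; have on t : (sv n, t) = ep (inr n) t by [].
by rewrite !on; apply: edge_holder_sqrt; rewrite /= ?y0 ?z0.
Qed.

(** 5 = 1 + 3 + 1: down a tooth, along the shaft, up a tooth, each over at most the distance of the
    points. *)
Lemma comb_holder p q : comb alpha p -> comb alpha q ->
  normc (f p - f q) <= 5 * Num.sqrt (cdist p q) * W.
Proof.
move=> cp cq; have W0 := L2norm_ge0 mu g; rewrite /comb_dist.
have [p1q1|p1q1] := eqVneq p.1 q.1.
  apply: le_trans (vertical_holder cp cq p1q1) _.
  by rewrite ler_wpM2r// ler_peMl ?sqrtr_ge0// ler1n.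
have [p01 p20 _ _] := combP cp; have [q01 q20 _ _] := combP cq.
have h1 := vertical_holder cp (comb_foot cp) erefl.
have h2 := shaft_holder q01 p01.
have h3 := vertical_holder (comb_foot cq) cq erefl.
rewrite /= subr0 ger0_norm// in h1; rewrite /= sub0r normrN ger0_norm// in h3.
set d := p.2 + _ + _.
have mon c : c <= d -> Num.sqrt c * W <= Num.sqrt d * W.
  have d0 : 0 <= d by rewrite !addr_ge0.
  move=> h; rewrite ler_wpM2r//; have [c0|c0] := leP 0 c; first by rewrite ler_sqrt.
  by rewrite ltr0_sqrtr// sqrtr_ge0.
have n0 := normr_ge0 (p.1 - q.1).
have k1 : Num.sqrt p.2 * W <= Num.sqrt d * W by apply: mon; rewrite /d; lra.
have k2 : Num.sqrt `|p.1 - q.1| * W <= Num.sqrt d * W by apply: mon; rewrite /d; lra.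
have k3 : Num.sqrt q.2 * W <= Num.sqrt d * W by apply: mon; rewrite /d; lra.
have -> : f p - f q = (f p - f (p.1, 0)) + (f (p.1, 0) - f (q.1, 0)) + (f (q.1, 0) - f q).
  by rewrite !addrA !subrK.
apply: le_trans (normcD _ _) _; apply: le_trans (lerD (normcD _ _) (lexx _)) _.
rewrite -mulrA in h2; rewrite -mulrA; lra.
Qed.

Lemma comb_holder_continuous : comb_continuous alpha f.
Proof.
move=> p cp e e0; have W0 := L2norm_ge0 mu g.
pose K := 5 * W + 1; have K0 : 0 < K by rewrite /K; lra.
exists ((e / K) ^+ 2); first by rewrite exprn_gt0// divr_gt0.
move=> q cq pq; rewrite normcB; apply: le_lt_trans (comb_holder cp cq) _.
have s : Num.sqrt (cdist p q) <= e / K.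
  rewrite -[leRHS]ger0_norm ?divr_ge0 ?(ltW e0) ?(ltW K0)// -sqrtr_sqr.
  by rewrite ler_sqrt ?sqr_ge0// ltW.
have : Num.sqrt (cdist p q) * K <= e by rewrite -ler_pdivlMr.
have := sqrtr_ge0 (cdist p q); set z := Num.sqrt _ => z0 h.
have [z00|z00] := eqVneq z 0; first by rewrite z00 mulr0 mul0r.
have : 0 < z by rewrite lt_neqAle eq_sym z00.
by move: h; rewrite /K; nra.
Qed.

Lemma comb_dist_le p q : comb alpha p -> comb alpha q -> cdist p q <= p.1 + p.2 + (q.1 + q.2).
Proof.
move=> /combP[/andP[p0 p1] p20 _ _] /combP[/andP[q0 q1] q20 _ _]; rewrite /comb_dist.
case: ifP => _.
  by have : `|p.2 - q.2| <= p.2 + q.2; [rewrite ler_norml; apply/andP; split; lra|lra].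
by have : `|p.1 - q.1| <= p.1 + q.1; [rewrite ler_norml; apply/andP; split; lra|lra].
Qed.

(** [p] is compared with the points of the longest tooth, which has length 1. They are at distance
    at most 4 from [p], so the values differ by at most [10 * W], and integrating over the tooth
    bounds |f(p)|^2 by twice the mass there plus 2 (10 W)^2. *)
Lemma comb_sup_bound p : L2 mu f -> comb alpha p ->
  normc (f p) ^+ 2 <= 2 * L2norm mu f ^+ 2 + 200 * W ^+ 2.
Proof.
move=> Lf cp.
have : (normc (f p) ^+ 2 / 2 - 100 * W ^+ 2) * len (inr 0%N) <= edge_energy alpha f (inr 0%N).
  apply: edge_energy_lower => // t tl; have ce := comb_edge tl.
  have h := comb_holder cp ce; set q := ep _ t in ce h *.
  have d4 : cdist p q <= 4.
    apply: le_trans (comb_dist_le cp ce) _.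
    have [/andP[_ a] _ b _] := combP cp; have [/andP[_ c] _ d _] := combP ce; lra.
  have s2 : Num.sqrt (cdist p q) <= 2.
    rewrite -[leRHS]ger0_norm// -sqrtr_sqr ler_sqrt ?sqr_ge0//.
    by apply: le_trans d4 _; lra.
  have W0 := L2norm_ge0 mu g.
  have {}h : normc (f p - f q) <= 10 * W.
    by apply: le_trans h _; rewrite ler_wpM2r//; lra.
  have := normcD (f p - f q) (f q); rewrite subrK.
  have := normc_ge0 (f p); have := normc_ge0 (f q); have := normc_ge0 (f p - f q).
  set a := normc (f p); set b := normc (f q); set c := normc _ in h * => c0 b0 a0 ab.
  have : a ^+ 2 <= (c + b) ^+ 2 by rewrite ler_pXn2r ?nnegrE ?addr_ge0.
  have : c ^+ 2 <= (10 * W) ^+ 2 by rewrite ler_pXn2r ?nnegrE// mulr_ge0.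
  have := sqr_ge0 (c - b); rewrite !exprMn; lra.
have := edge_energy_le (inr 0%N) Lf.
by rewrite /= vertex0 mulr1; lra.
Qed.

End Holder.
End CombEstimates.

(** Lebesgue differentiation: [k], extended by 0, is almost everywhere the derivative of its
    primitive, which is constant on the interval. *)
Lemma indefinite_integral_eq0 (R : realType) (k : R -> R) (L : R) :
  (@lebesgue_measure R).-integrable `[0, L] (EFin \o k) ->
  (forall t, 0 <= t <= L -> \int[@lebesgue_measure R]_(s in `[0, t]) k s = 0) ->
  {ae @lebesgue_measure R, forall x, 0 < x < L -> k x = 0}.
Proof.
move=> ik k0; pose k' := k \_ `[0, L].
have ik' : (@lebesgue_measure R).-integrable setT (EFin \o k').
  by rewrite /k' -restrict_EFin -integrable_mkcond.
have lk' : locally_integrable setT k' by exact: integrable_locally.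
have iky y : (@lebesgue_measure R).-integrable [set` Interval (BLeft 0) (BRight y)] (EFin \o k').
  exact: integrableS ik'.
have := FTC1 iky lk'.
apply: filterS; first exact: (ae_filter_ringOfSetsType (@lebesgue_measure R)).
move=> x /= + /andP[x0 xL].
rewrite lte_fin => /(_ x0)[_].
set F := fun y : R => _; have k'k y : 0 <= y <= L -> k' y = k y.
  by move=> h; rewrite /k' patchE mem_set//= in_itv.
rewrite k'k; last by rewrite !ltW.
move=> <-; rewrite derive1E.
have near0 : \near x, F x = cst 0 x.
  near=> y; rewrite /F /=.
  have y0 : 0 < y by near: y; exact: lt_nbhsr.
  have yL : y < L by near: y; exact: lt_nbhsl.
  rewrite -[RHS](k0 y); last by rewrite !ltW.
  apply: eq_Rintegral => z; rewrite inE/= in_itv/= => /andP[z0 zy].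
  by rewrite k'k// z0 (le_trans zy)// ltW.
by rewrite (near_eq_derive _ near0) derive_cst.
Unshelve. all: by end_near. Qed.

(** * Derivatives on the comb: linearity and uniqueness *)

Section Derivative.
Variables (R : realType) (alpha : R).
Hypothesis alpha_gt0 : 0 < alpha.
Local Notation ep := (edge_point alpha).
Local Notation len := (edge_length alpha).
Local Notation mu := (comb_measure alpha).
Local Notation leb := (@lebesgue_measure R).
Local Notation cder := (is_comb_derivative alpha).
Implicit Types (f g : plane R -> R[i]) (p q : plane R).

Lemma edge_integrableS f e t : L2 mu f -> t <= len e ->
  leb.-integrable `[0, t] (EFin \o (fun t => complex.Re (f (ep e t)))) /\
  leb.-integrable `[0, t] (EFin \o (fun t => complex.Im (f (ep e t)))).
Proof.
move=> Lf tl; have [_ i1 i2] := edge_integrable e Lf.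
have sub : `[0, t] `<=` `[0, len e].
  by move=> x /=; rewrite !in_itv/= => /andP[-> b]; rewrite (le_trans b).
by split; [exact: integrableS i1|exact: integrableS i2].
Qed.

Lemma comb_derivativeD f1 f2 g1 g2 : L2 mu g1 -> L2 mu g2 ->
  cder f1 g1 -> cder f2 g2 -> cder (f1 + f2) (g1 + g2).
Proof.
move=> L1 L2' d1 d2 e t /andP[t0 tl].
have [i1 i2] := edge_integrableS L1 tl; have [i3 i4] := edge_integrableS L2' tl.
rewrite !fctE (d1 e t) ?t0// (d2 e t) ?t0// addrACA; congr (_ + _).
by rewrite -cintegralD.
Qed.

Lemma comb_derivativeZ (c : R[i]) f g : L2 mu g -> cder f g -> cder (c *: f) (c *: g).
Proof.
move=> L1 d1 e t /andP[t0 tl].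
have [i1 i2] := edge_integrableS L1 tl.
rewrite !fctE (d1 e t) ?t0// scalerDr; congr (_ + _).
by rewrite -[c *: _]/(c * _) -cintegralZ.
Qed.

Lemma comb_derivative0_eq0 h : L2 mu h ->
  (forall e t, 0 <= t <= len e -> cintegral leb `[0, t] (fun s => h (ep e s)) = 0) ->
  L2norm mu h = 0.
Proof.
move=> Lh h0.
have E0 e : edge_energy alpha h e = 0.
  have [i2 i1 i3] := edge_integrable e Lh.
  have r0 : {ae leb, forall x, 0 < x < len e -> complex.Re (h (ep e x)) = 0}.
    by apply: indefinite_integral_eq0 => // t /(h0 e t) [].
  have m0 : {ae leb, forall x, 0 < x < len e -> complex.Im (h (ep e x)) = 0}.
    by apply: indefinite_integral_eq0 => // t /(h0 e t) [].
  have m2 : measurable_fun `[0, len e] (fun t => (normc (h (ep e t)) ^+ 2)%:E).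
    by move/integrableP : i2 => [].
  have sub : `]0, len e[ `<=` `[0, len e].
    by move=> x /=; rewrite !in_itv/= => /andP[/ltW -> /ltW ->].
  have m2' : measurable_fun `]0, len e[ (fun t => (normc (h (ep e t)) ^+ 2)%:E).
    exact: measurable_funS m2.
  rewrite /edge_energy integral_itv_bndoo// (ae_eq_integral (cst 0%E))//.
    by rewrite integral_cst// mul0e.
  apply: (@filterS2 _ _ (ae_filter_ringOfSetsType leb)) r0 m0 => x h1 h2; rewrite /= in_itv/= => xI.
  by rewrite normcE2 (h1 xI) (h2 xI) expr0n/= addr0.
apply/eqP; rewrite -sqrf_eq0; apply/eqP/EFin_inj.
rewrite L2norm2_edges//; apply: eseries0 => n _ _.
by rewrite !E0 addr0.
Qed.

Lemma comb_derivative_uniq f g1 g2 : L2 mu g1 -> L2 mu g2 ->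
  cder f g1 -> cder f g2 -> L2norm mu (g1 - g2) = 0.
Proof.
move=> L1 L2' d1 d2; apply: comb_derivative0_eq0; first exact: L2B.
move=> e t tl.
have d : cder 0 (g1 - g2).
  have -> : 0 = f + (-1) *: f by rewrite scaleN1r subrr.
  rewrite -[- g2]scaleN1r; apply: comb_derivativeD => //; first exact: L2Z.
  exact: comb_derivativeZ.
have := d e t tl; have -> : (0 : plane R -> R[i]) (ep e t) = 0 by [].
by rewrite add0r => <-.
Qed.

Lemma H1_derivative f : H1 alpha f ->
  L2 mu (comb_derivative alpha f) /\ cder f (comb_derivative alpha f).
Proof.
move=> [_ _ [g Lg fg]]; rewrite /comb_derivative.
by case: xgetP => [h -> []//|/(_ g)]; case.
Qed.

(** Continuity is supplied by the Hoelder estimate. *)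
Lemma H1I f g : L2 mu f -> L2 mu g -> cder f g -> H1 alpha f.
Proof.
move=> Lf Lg fg; split=> //; last by exists g.
exact: comb_holder_continuous fg.
Qed.

Lemma comb_derivativeE f g : L2 mu g -> cder f g -> H1 alpha f ->
  L2norm mu (comb_derivative alpha f - g) = 0.
Proof.
move=> Lg fg Hf; have [Ld fd] := H1_derivative Hf.
exact: comb_derivative_uniq fg.
Qed.

End Derivative.

Section L2Norm.
Context d (T : measurableType d) (R : realType).
Variable mu : {measure set T -> \bar R}.
Implicit Types (f g h : T -> R[i]).
Let sX := L2_semi_hilbert mu.

Lemma L2normZ (c : R[i]) f : L2 mu f -> L2norm mu (c *: f) = normc c * L2norm mu f.
Proof. by move=> Lf; rewrite !L2norm_snorm; exact: (snormZ sX). Qed.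

Lemma L2norm_eq f g : L2 mu f -> L2 mu g -> L2norm mu (f - g) = 0 -> L2norm mu f = L2norm mu g.
Proof.
move=> Lf Lg; rewrite !L2norm_snorm => /(hpi_eqP sX Lf Lg) fg.
by rewrite -(hnorm_hpi sX Lf) -(hnorm_hpi sX Lg) fg.
Qed.

Lemma L2dot_eql f g h : L2 mu f -> L2 mu g -> L2 mu h -> L2norm mu (f - g) = 0 ->
  L2dot mu f h = L2dot mu g h.
Proof.
move=> Lf Lg Lh; rewrite L2norm_snorm => /(hpi_eqP sX Lf Lg).
exact: (hpi_inj Lf Lg Lh).
Qed.

Lemma L2norm_le_pointwise f g : L2 mu f -> L2 mu g ->
  (forall x, normc (f x) <= normc (g x)) -> L2norm mu f <= L2norm mu g.
Proof.
move=> Lf Lg fg; have /L2P[mf _] := Lf; have /L2P[mg _] := Lg.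
apply: (L2norm_le mf (L2norm_ge0 _ _) _).2.
rewrite L2norm2//; apply: ge0_le_integral => //.
- by move=> x _; rewrite lee_fin sqr_ge0.
- exact/measurable_EFinP/measurable_normc2.
- exact/measurable_EFinP/measurable_normc2.
- by move=> x _; rewrite lee_fin ler_pXn2r ?nnegrE ?normc_ge0.
Qed.

End L2Norm.

(** * H^1 and its completeness *)

Section H1Space.
Variables (R : realType) (alpha : R).
Hypothesis alpha_gt0 : 0 < alpha.
Local Notation sv := (shaft_vertex alpha).
Local Notation ep := (edge_point alpha).
Local Notation len := (edge_length alpha).
Local Notation mu := (comb_measure alpha).
Local Notation leb := (@lebesgue_measure R).
Local Notation cder := (is_comb_derivative alpha).
Local Notation der := (comb_derivative alpha).
Local Notation fdot := (form_dot (L2dot mu) (dirichlet_form alpha)).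
Implicit Types (f g u v w : plane R -> R[i]) (p q : plane R).

Lemma measurable_comb : measurable (comb alpha).
Proof.
have -> : comb alpha = (`]0, 1]%classic `*` [set 0]) `|`
    \bigcup_n ([set sv n] `*` `[0, sv n]%classic).
  apply/seteqP; split=> p /=.
    move=> [[a b]|[n a b]]; first by left; split; rewrite /= ?in_itv.
    by right; exists n => //; split; rewrite /= ?in_itv.
  move=> [[/= a b]|[n _ [/= a b]]]; first by left; move: a; rewrite in_itv.
  by right; exists n => //; move: b; rewrite in_itv.
apply: measurableU; first by apply: measurableX => //; exact: measurable_set1.
apply: bigcup_measurable => n _; apply: measurableX => //; exact: measurable_set1.
Qed.

Lemma L2_eq0_on_comb f : L2 mu f -> (forall p, comb alpha p -> f p = 0) -> L2norm mu f = 0.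
Proof.
move=> Lf f0; apply/eqP; rewrite -sqrf_eq0; apply/eqP/EFin_inj.
rewrite L2norm2_edges//; apply: eseries0 => n _ _.
have E0 e : edge_energy alpha f e = 0.
  apply/eqP; rewrite eq_le edge_energy_ge0 andbT -[leRHS](mul0r (len e)).
  apply: edge_energy_upper => // t tl.
  by rewrite f0 ?normc0 ?expr0n//; exact: comb_edge.
by rewrite !E0 addr0.
Qed.

(** Values off the comb are arbitrary, so an H^1-convergent sequence converges pointwise only on the
    comb. Cutting off changes nothing in L^2 and makes it converge on the whole plane. *)
Definition comb_restrict f : plane R -> R[i] := fun p => (\1_(comb alpha) p)%:C * f p.

Lemma comb_restrictE f p : comb alpha p -> comb_restrict f p = f p.
Proof. by move=> cp; rewrite /comb_restrict indicE mem_set// mul1r. Qed.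

Lemma comb_restrictN f p : ~ comb alpha p -> comb_restrict f p = 0.
Proof. by move=> cp; rewrite /comb_restrict indicE memNset// mul0r. Qed.

Lemma cmeasurable_comb_restrict f : cmeasurable f -> cmeasurable (comb_restrict f).
Proof.
move=> mf; apply: cmeasurableM => //; split; last exact: measurable_cst.
exact: measurable_indic measurable_comb.
Qed.

Lemma normc_comb_restrict f p : normc (comb_restrict f p) <= normc (f p).
Proof.
have [cp|cp] := pselect (comb alpha p); first by rewrite comb_restrictE.
by rewrite comb_restrictN// normc0 normc_ge0.
Qed.

Lemma L2_comb_restrict f : L2 mu f -> L2 mu (comb_restrict f).
Proof.
move=> /L2P[mf jf]; apply: L2_dominated jf _; first exact: cmeasurable_comb_restrict.
by move=> p; rewrite ler_pXn2r ?nnegrE ?normc_ge0// normc_comb_restrict.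
Qed.

Lemma L2norm_comb_restrict f : L2 mu f -> L2norm mu (f - comb_restrict f) = 0.
Proof.
move=> Lf; apply: L2_eq0_on_comb; first exact: L2B (L2_comb_restrict Lf).
by move=> p cp; rewrite !fctE comb_restrictE// subrr.
Qed.

Lemma H1D f g : H1 alpha f -> H1 alpha g -> H1 alpha (f + g).
Proof.
move=> Hf Hg; have [L1 d1] := H1_derivative Hf; have [L2' d2] := H1_derivative Hg.
have [[_ Lf _] [_ Lg _]] := (Hf, Hg).
by apply: (H1I alpha_gt0 (L2D Lf Lg) (L2D L1 L2')); exact: comb_derivativeD.
Qed.

Lemma H1Z (c : R[i]) f : H1 alpha f -> H1 alpha (c *: f).
Proof.
move=> Hf; have [L1 d1] := H1_derivative Hf; have [_ Lf _] := Hf.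
by apply: (H1I alpha_gt0 (L2Z c Lf) (L2Z c L1)); exact: comb_derivativeZ.
Qed.

Lemma H1_zero : H1 alpha 0.
Proof.
apply: (H1I alpha_gt0 (L20 _) (L20 _)) => e t tl.
have r0 : \int[leb]_(s in `[0, t]) (0 : R) = 0 by rewrite /Rintegral integral0.
by rewrite /cintegral /= !r0 addr0.
Qed.

Lemma H1_L2 f : H1 alpha f -> L2 mu f.
Proof. by case. Qed.

Lemma derD f g : H1 alpha f -> H1 alpha g ->
  L2norm mu (der (f + g) - (der f + der g)) = 0.
Proof.
move=> Hf Hg; have [L1 d1] := H1_derivative Hf; have [L2' d2] := H1_derivative Hg.
apply: (comb_derivativeE (L2D L1 L2')); last exact: H1D.
exact: comb_derivativeD.
Qed.

Lemma derZ c f : H1 alpha f -> L2norm mu (der (c *: f) - c *: der f) = 0.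
Proof.
move=> Hf; have [L1 d1] := H1_derivative Hf.
apply: (comb_derivativeE (L2Z c L1)); last exact: H1Z.
exact: comb_derivativeZ.
Qed.

Lemma H1B f g : H1 alpha f -> H1 alpha g -> H1 alpha (f - g).
Proof. by move=> Hf Hg; apply: H1D => //; rewrite -scaleN1r; exact: H1Z. Qed.

Lemma derB f g : H1 alpha f -> H1 alpha g ->
  L2norm mu (der (f - g)) = L2norm mu (der f - der g).
Proof.
move=> Hf Hg; have [L1 d1] := H1_derivative Hf; have [L2' d2] := H1_derivative Hg.
have HB := H1B Hf Hg; have [LB _] := H1_derivative HB.
apply: (L2norm_eq LB (L2B L1 L2')).
apply: comb_derivativeE => //; first exact: L2B.
rewrite -[- g]scaleN1r -[- der _]scaleN1r.
by apply: comb_derivativeD => //; [exact: L2Z|exact: comb_derivativeZ].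
Qed.

Lemma H1normE f : H1norm alpha f = snorm fdot f.
Proof.
rewrite /H1norm /snorm /form_dot /dirichlet_form cReD !L2norm2_Rintegral.
by rewrite !Re_L2dot.
Qed.

Lemma H1norm2 f : H1norm alpha f ^+ 2 = L2norm mu f ^+ 2 + L2norm mu (der f) ^+ 2.
Proof. by rewrite sqr_sqrtr// addr_ge0 ?sqr_ge0. Qed.

Lemma H1norm_ge0 f : 0 <= H1norm alpha f.
Proof. exact: sqrtr_ge0. Qed.

Lemma L2norm_le_H1norm f : L2norm mu f <= H1norm alpha f.
Proof.
rewrite -(ler_pXn2r (n := 2)) ?nnegrE ?L2norm_ge0 ?H1norm_ge0//.
by rewrite H1norm2 lerDl sqr_ge0.
Qed.

Lemma L2norm_der_le_H1norm f : L2norm mu (der f) <= H1norm alpha f.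
Proof.
rewrite -(ler_pXn2r (n := 2)) ?nnegrE ?L2norm_ge0 ?H1norm_ge0//.
by rewrite H1norm2 lerDr sqr_ge0.
Qed.

Lemma H1norm_quasi f g : H1 alpha f -> H1 alpha g ->
  H1norm alpha (f - g) ^+ 2 <= 2 * H1norm alpha f ^+ 2 + 2 * H1norm alpha g ^+ 2.
Proof.
move=> Hf Hg; have [L1 d1] := H1_derivative Hf; have [L2' d2] := H1_derivative Hg.
have [Lf Lg] := (H1_L2 Hf, H1_L2 Hg).
have q1 := L2norm_quasi Lf (L2Z (-1) Lg); have q2 := L2norm_quasi L1 (L2Z (-1) L2').
have n1 : normc (-1 : R[i]) = 1 by rewrite normcN normc1.
rewrite L2normZ// n1 mul1r scaleN1r in q1; rewrite L2normZ// n1 mul1r scaleN1r in q2.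
have q3 : L2norm mu (der (f - g)) ^+ 2 <= 2 * L2norm mu (der f) ^+ 2 + 2 * L2norm mu (der g) ^+ 2.
  by rewrite (derB Hf Hg).
rewrite [leLHS](H1norm2 (f - g)); apply: le_trans (lerD q1 q3) _.
by rewrite [leLHS]addrACA -2!mulrDr -(H1norm2 f) -(H1norm2 g).
Qed.

(** 15 is the least integer whose square reaches the 200 of [comb_sup_bound]. *)
Lemma H1_sup_bound f p : H1 alpha f -> comb alpha p ->
  normc (f p) <= 15 * H1norm alpha f.
Proof.
move=> Hf cp; have [Ld d] := H1_derivative Hf.
rewrite -(ler_pXn2r (n := 2)) ?nnegrE ?normc_ge0 ?mulr_ge0 ?H1norm_ge0//.
rewrite exprMn H1norm2; have := comb_sup_bound alpha_gt0 Ld d (H1_L2 Hf) cp.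
have := sqr_ge0 (L2norm mu f); have := sqr_ge0 (L2norm mu (der f)).
by lra.
Qed.

(** The sup bound gives pointwise limits on the comb, completeness of L^2 a limit of the
    derivatives, and the integral representation passes to the limit. Pointwise convergence is part
    of the conclusion because the limit has to inherit zeros. *)
Lemma H1_complete (u : nat -> plane R -> R[i]) : (forall n, H1 alpha (u n)) ->
  (forall e : R, 0 < e -> exists N, forall m n, (N <= m)%N -> (N <= n)%N ->
     H1norm alpha (u m - u n) < e) ->
  exists l, [/\ H1 alpha l, forall p, comb alpha p -> ccvg (u^~ p) (l p) &
    forall e : R, 0 < e -> exists N, forall n, (N <= n)%N -> H1norm alpha (u n - l) < e].
Proof.
move=> Hu cu.
have Lu n := H1_L2 (Hu n).
have HuB m n : H1 alpha (u m - u n) by exact: H1B.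
have Ld n : L2 mu (der (u n)) by have [] := H1_derivative (Hu n).
have dd n : cder (u n) (der (u n)) by have [] := H1_derivative (Hu n).
have [|g Lg ug] := L2_complete Ld.
  move=> e /cu[N hN]; exists N => m n Nm Nn; rewrite -derB//.
  by apply: le_lt_trans (L2norm_der_le_H1norm _) (hN _ _ Nm Nn).
pose w n := comb_restrict (u n).
have Lw n : L2 mu (w n) by exact: L2_comb_restrict.
have cw : L2_cauchy mu w.
  move=> e /cu[N hN]; exists N => m n Nm Nn.
  apply: le_lt_trans (hN _ _ Nm Nn); apply: le_trans (L2norm_le_H1norm _).
  apply: L2norm_le_pointwise; [exact: L2B|exact: L2B|].
  move=> p; have -> : (w m - w n) p = comb_restrict (u m - u n) p.
    by rewrite /w /comb_restrict !fctE mulrBr.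
  exact: normc_comb_restrict.
have wcvg p : exists l, ccvg (w^~ p) l.
  have [cp|cp] := pselect (comb alpha p); last first.
    by exists 0 => e e0; exists 0%N => n _; rewrite /w comb_restrictN// subrr normc0.
  apply: complex_cauchy_cvg => e e0.
  (* [ltr0Sn R 14] is [0 < 15], for the constant of [H1_sup_bound]. *)
  have [N hN] := cu _ (divr_gt0 e0 (ltr0Sn R 14)).
  exists N => n Nn; rewrite /w !comb_restrictE//.
  apply: le_lt_trans (H1_sup_bound (HuB N n) cp) _.
  by rewrite mulrC -ltr_pdivlMr// hN.
have /choice[l wl] := wcvg.
have [Ll wlim] := L2_pointwise_limit Lw cw wl.
have ul p : comb alpha p -> ccvg (u^~ p) (l p).
  move=> cp e /(wl p)[N hN]; exists N => n /hN.
  by rewrite /w comb_restrictE.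
have dl : cder l g.
  move=> e t tl; have /andP[t0 tle] := tl.
  have ce : comb alpha (ep e t) by exact: comb_edge.
  have c0 : comb alpha (ep e 0).
    by apply: comb_edge => //; rewrite lexx ltW// edge_length_gt0.
  apply/eqP; rewrite -subr_eq0; apply/eqP/eq0_normc.
  apply/eqP; rewrite eq_le normc_ge0 andbT; apply/ler_addgt0Pr => r r0; rewrite add0r.
  have r3 : 0 < r / 3 by rewrite divr_gt0.
  have [N1 h1] := ul _ ce _ r3; have [N2 h2] := ul _ c0 _ r3; have [N3 h3] := ug _ r3.
  pose n := maxn N1 (maxn N2 N3).
  have {}h1 := h1 n (leq_maxl _ _).
  have {}h2 : normc (u n (ep e 0) - l (ep e 0)) < r / 3.
    by apply: h2; rewrite /n (leq_trans (leq_maxl N2 N3))// leq_maxr.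
  have {}h3 : L2norm mu (der (u n) - g) < r / 3.
    by apply: h3; rewrite /n (leq_trans (leq_maxr N2 N3))// leq_maxr.
  have LB : L2 mu (der (u n) - g) by exact: L2B.
  (* Cauchy-Schwarz from 0 to [t] for the difference of the derivatives; the edge has length at most
     1. *)
  have h4 : normc (cintegral leb `[0, t] (fun s => (der (u n) - g) (ep e s))) <= r / 3.
    have := edge_cintegral_bound LB (lexx 0) t0 tle.
    rewrite set_itv1 /cintegral !Rintegral_set1 -/(cintegral _ _ _) subr0.
    rewrite subr0 => h.
    rewrite -(ler_pXn2r (n := 2)) ?nnegrE ?normc_ge0 ?(ltW r3)//.
    apply: le_trans h _; apply: (@le_trans _ _ (1 * L2norm mu (der (u n) - g) ^+ 2)).
      apply: ler_pM => //; [exact: edge_energy_ge0| |exact: edge_energy_le].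
      exact: le_trans tle (edge_length_le1 alpha_gt0 e).
    by rewrite mul1r ler_pXn2r ?nnegrE ?L2norm_ge0 ?(ltW r3)// ltW.
  have [i1 i2] := edge_integrableS (Ld n) tle.
  have [i3 i4] := edge_integrableS (L2Z (-1) Lg) tle.
  have [i5 i6] := edge_integrableS Lg tle.
  have EB : cintegral leb `[0, t] (fun s => (der (u n) - g) (ep e s)) =
     cintegral leb `[0, t] (fun s => der (u n) (ep e s)) - cintegral leb `[0, t] (fun s => g (ep e s)).
    rewrite -[- cintegral _ _ _]mulN1r -cintegralZ// -cintegralD//.
    by congr (cintegral _ _ _); apply/funext => s; rewrite !fctE mulN1r.
  have := dd n e t tl => du.
  have -> : l (ep e t) - (l (ep e 0) + cintegral leb `[0, t] (fun s => g (ep e s))) =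
     - (u n (ep e t) - l (ep e t)) + (u n (ep e 0) - l (ep e 0)) +
       cintegral leb `[0, t] (fun s => (der (u n) - g) (ep e s)).
    by rewrite EB du; ring.
  apply: le_trans (normcD _ _) _; apply: le_trans (lerD (normcD _ _) h4) _.
  by rewrite normcN; lra.
have Hl : H1 alpha l by exact: H1I dl.
exists l; split=> // e e0; have e2 : 0 < e / 2 by rewrite divr_gt0.
have [N1 h1] := wlim _ e2; have [N2 h2] := ug _ e2.
exists (maxn N1 N2) => n; rewrite geq_max => /andP[/h1 a /h2 b].
have HB : H1 alpha (u n - l) by exact: H1B.
have E1 : L2norm mu (u n - l) = L2norm mu (w n - l).
  apply: L2norm_eq; [exact: L2B|exact: L2B|].
  have -> : u n - l - (w n - l) = u n - comb_restrict (u n).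
    by rewrite opprB addrA subrK.
  exact: L2norm_comb_restrict.
have E2 : L2norm mu (der (u n - l)) = L2norm mu (der (u n) - g).
  apply: L2norm_eq; [by have [] := H1_derivative HB|exact: L2B|].
  apply: comb_derivativeE => //; first exact: L2B.
  rewrite -[- l]scaleN1r -[- g]scaleN1r.
  by apply: comb_derivativeD => //; [exact: L2Z|exact: comb_derivativeZ].
rewrite -(ltr_pXn2r (n := 2)) ?nnegrE ?H1norm_ge0 ?(ltW e0)// H1norm2 E1 E2.
have a2 : L2norm mu (w n - l) ^+ 2 < (e / 2) ^+ 2.
  by rewrite ltr_pXn2r ?nnegrE ?L2norm_ge0 ?(ltW e2).
have b2 : L2norm mu (der (u n) - g) ^+ 2 < (e / 2) ^+ 2.
  by rewrite ltr_pXn2r ?nnegrE ?L2norm_ge0 ?(ltW e2).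
have : (e / 2) ^+ 2 = e ^+ 2 / 4 by rewrite expr_div_n; congr (_ / _); ring.
have : 0 < e ^+ 2 by rewrite exprn_gt0.
lra.
Qed.

End H1Space.

(** * Compactness of the embedding *)

Section UltraLimits.
Variables (R : realType) (U : set_system nat).
Hypothesis UU : UltraFilter U.

(** A bounded closed interval is compact, so the image ultrafilter has a cluster point, and an
    ultrafilter converges to its cluster points. *)
Lemma ultra_real_limit (a : nat -> R) (B : R) : (forall n, `|a n| <= B) ->
  exists l : R, forall e : R, 0 < e -> U [set n | `|a n - l| < e].
Proof.
move=> aB; have UB : U (a @^-1` `[- B, B]%classic).
  by apply: filterS filterT => n _ /=; rewrite in_itv/= -ler_norml.
have [l [_ cl]] := @segment_compact R (- B) B (a @ U) _ UB.
exists l => e e0.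
have [//|UC] := in_ultra_setVsetC [set n | `|a n - l| < e] UU.
have : (a @ U) (~` [set x | `|x - l| < e]) by exact: UC.
move=> aC; have [x [/= h1]] := cl (~` [set x | `|x - l| < e]) (ball l e) aC (nbhsx_ballx l e e0).
by rewrite -ball_normE /= distrC => /h1.
Qed.

Lemma ultra_complex_limit (a : nat -> R[i]) (B : R) : (forall n, normc (a n) <= B) ->
  exists l : R[i], forall e : R, 0 < e -> U [set n | normc (a n - l) < e].
Proof.
move=> aB.
have [|x hx] := @ultra_real_limit (fun n => complex.Re (a n)) B.
  by move=> n; exact: le_trans (ler_Re_normc _) (aB n).
have [|y hy] := @ultra_real_limit (fun n => complex.Im (a n)) B.
  by move=> n; exact: le_trans (ler_Im_normc _) (aB n).
exists (x +i* y) => e e0; have e2 : 0 < e / 2 by rewrite divr_gt0.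
apply: filterS (filterI (hx _ e2) (hy _ e2)) => n /= [h1 h2].
apply: le_lt_trans (normc_ReIm _) _.
by rewrite cImB cReD cReN /=; lra.
Qed.

Lemma filter_seq (I : eqType) (P : seq I) (A : I -> set nat) :
  (forall i, i \in P -> U (A i)) -> U [set n | forall i, i \in P -> A i n].
Proof.
elim: P => [|i P ih] h; first by apply: filterS filterT => n _ j; rewrite in_nil.
have UP : U [set n | forall j, j \in P -> A j n].
  by apply: ih => j jP; apply: h; rewrite inE jP orbT.
have Ui : U (A i) by apply: h; rewrite inE eqxx.
apply: filterS (filterI Ui UP) => n [Ain AP] j.
by rewrite inE => /predU1P[->|/AP].
Qed.

(** The way back from an ultrafilter to a subsequence: sets of diameter at most [k.+1%:R^-1] belong
    to [U], their finite intersections too, and these contain arbitrarily large indices; [s k] is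
    taken in the first k + 1 of them. *)
Lemma ultra_cauchy_subsequence (dist : nat -> nat -> R) :
  (forall N, U [set n | (N <= n)%N]) ->
  (forall e : R, 0 < e -> exists2 A, U A & forall m n, A m -> A n -> dist m n < e) ->
  exists2 s : nat -> nat, {homo s : i j / (i < j)%N} &
  forall e : R, 0 < e -> exists N, forall m n, (N <= m)%N -> (N <= n)%N ->
    dist (s m) (s n) < e.
Proof.
move=> Uoo hA.
have /choice[A hA'] : forall k : nat, exists A, U A /\
    forall m n, A m -> A n -> dist m n < k.+1%:R^-1.
  move=> k; have [|A UA hd] := hA k.+1%:R^-1; first by rewrite invr_gt0 ltr0n.
  by exists A.
have UB k : U [set n | forall j, (j <= k)%N -> A j n].
  elim: k => [|k ih].
    apply: filterS (hA' 0%N).1 => n An j; rewrite leqn0 => /eqP ->.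
    by [].
  apply: filterS (filterI ih (hA' k.+1).1) => n [h1 h2] j.
  by rewrite leq_eqVlt => /predU1P[->//|]; rewrite ltnS; exact: h1.
have /choice[F hF] : forall kn : nat * nat, exists m, (kn.2 < m)%N /\
    forall j, (j <= kn.1)%N -> A j m.
  move=> [k n] /=; have UI : U ([set m | forall j, (j <= k)%N -> A j m] `&` [set m | (n < m)%N]).
    by apply: filterI; [exact: UB|exact: Uoo].
  by have [m [h1 h2]] := filter_ex UI; exists m.
pose s := fix s (k : nat) : nat := if k is k'.+1 then F (k'.+1, s k') else F (0%N, 0%N).
have sA k j : (j <= k)%N -> A j (s k).
  move=> jk; case: k jk => [|k] jk.
    exact: (hF (0%N, 0%N)).2.
  exact: (hF (k.+1, s k)).2.
exists s.
  by apply: (homo_ltn ltn_trans) => k; exact: (hF (k.+1, s k)).1.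
move=> e e0; have [N hN] := archi_inv e0; exists N => m n Nm Nn.
by apply: lt_trans (hN N (leqnn _)); apply: (hA' N).2; exact: sA.
Qed.

End UltraLimits.

Section Compactness.
Variables (R : realType) (alpha : R).
Hypothesis alpha_gt0 : 0 < alpha.
Local Notation sv := (shaft_vertex alpha).
Local Notation len := (edge_length alpha).
Local Notation mu := (comb_measure alpha).
Local Notation cdist := (@comb_dist R).
Local Notation der := (comb_derivative alpha).
Implicit Types (f g : plane R -> R[i]) (p q : plane R).

(** A grid of mesh 1 / K, cut down to the comb. On the shaft it starts at 1 / K instead of 0, which
    is not a point of the comb; points closer to the end than that still have it within the mesh. *)
Lemma finite_net N K : (0 < K)%N -> exists P : seq (plane R),
  (forall q, q \in P -> comb alpha q) /\
  forall p, comb alpha p -> p.2 = 0 \/ (exists2 k, (k < N)%N & p.1 = sv k) ->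
    exists2 q, q \in P & cdist p q <= K%:R^-1.
Proof.
move=> K0; have KR : 0 < K%:R :> R by rewrite ltr0n.
pose P0 : seq (plane R) := [seq (j.+1%:R / K%:R, 0) | j <- iota 0 K] ++
   [seq (sv kj.1, kj.2%:R / K%:R) | kj <- [seq (k, j) | k <- iota 0 N, j <- iota 0 K.+1]].
exists [seq q <- P0 | `[< comb alpha q >]]; split.
  by move=> q; rewrite mem_filter => /andP[/asboolP].
have tr (x : R) : 0 <= x -> x <= 1 -> exists2 j, (j <= K)%N &
    j%:R / K%:R <= x /\ x - j%:R / K%:R <= K%:R^-1.
  move=> x0 x1; have xK0 : 0 <= x * K%:R by rewrite mulr_ge0// ltW.
  have /andP[a b] := truncn_itv xK0; set j := Num.truncn _ in a b.
  exists j.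
    by rewrite -(ler_nat R); apply: le_trans a _; rewrite ler_piMl// ltW.
  split; first by rewrite ler_pdivrMr.
  rewrite lerBlDr -[X in _ <= X + _]div1r -mulrDl ler_pdivlMr//.
  by rewrite addrC natr1 ltW.
move=> p cp; have [/andP[p10 p11] p20 p21 pt] := combP alpha_gt0 cp.
move=> [p2|[k kN p1]].
  have [j jK [h1 h2]] := tr _ (ltW p10) p11.
  have [j' j'K hj] : exists2 j', (j' < K)%N & `|p.1 - j'.+1%:R / K%:R| <= K%:R^-1.
    case: j jK h1 h2 => [|j] jK h1 h2; last first.
      by exists j => //; rewrite ger0_norm// subr_ge0.
    exists 0%N => //; rewrite mul0r subr0 in h2.
    by rewrite distrC ger0_norm ?div1r ?subr_ge0// lerBlDr lerDl ltW.
  exists (j'.+1%:R / K%:R, 0).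
    rewrite mem_filter; apply/andP; split.
      apply/asboolP; left; split=> //=; rewrite divr_gt0 ?ltr0n//=.
      by rewrite ler_pdivrMr// mul1r ler_nat.
    rewrite mem_cat; apply/orP; left; apply/mapP; exists j' => //.
    by rewrite mem_iota.
  rewrite /comb_dist p2 /= subrr normr0 add0r addr0.
  by case: ifP => // _; rewrite invr_ge0 ltW.
have p2sv : p.2 <= sv k by rewrite -p1.
have [j jK [h1 h2]] := tr _ p20 (le_trans p2sv (vertex_le1 alpha_gt0 k)).
exists (sv k, j%:R / K%:R).
  rewrite mem_filter; apply/andP; split.
    apply/asboolP; right; exists k => //=.
    by rewrite divr_ge0 ?ler0n//= (le_trans h1).
  rewrite mem_cat; apply/orP; right; apply/mapP; exists (k, j) => //.
  apply/allpairsP; exists (k, j); split; rewrite ?mem_iota ?add0n //=.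
by rewrite /comb_dist p1 /= eqxx ger0_norm ?subr_ge0.
Qed.

(** The shaft has length 1 and each tooth at most 1, whence the factor [N.+1]: one for the shaft and
    [N] for the first teeth. *)
Lemma L2norm_tail_bound f N (c t : R) : L2 mu f -> 0 <= c ->
  (forall p, comb alpha p -> p.2 = 0 \/ (exists2 k, (k < N)%N & p.1 = sv k) ->
     normc (f p) ^+ 2 <= c) ->
  (forall n, \sum_(N <= k < n) edge_energy alpha f (inr k) <= t) ->
  L2norm mu f ^+ 2 <= N.+1%:R * c + t.
Proof.
move=> Lf c0 fc ft.
have t0 : 0 <= t by apply: le_trans (ft N); rewrite big_geq.
have El k : edge_energy alpha f (inl k) <= c * (sv k - sv k.+1).
  apply: edge_energy_upper => // s sl; apply: fc; first exact: comb_edge.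
  by left.
have Er k : (k < N)%N -> edge_energy alpha f (inr k) <= c.
  move=> kN; apply: (@le_trans _ _ (c * len (inr k))); last first.
    by rewrite ler_piMr// edge_length_le1.
  apply: edge_energy_upper => // s sl; apply: fc; first exact: comb_edge.
  by right; exists k.
have Sl n : \sum_(0 <= k < n) edge_energy alpha f (inl k) <= c.
  apply: (@le_trans _ _ (\sum_(0 <= k < n) c * (sv k - sv k.+1))); first exact: ler_sum.
  rewrite -mulr_sumr; have -> : \sum_(0 <= k < n) (sv k - sv k.+1) = sv 0 - sv n.
    rewrite -opprB -telescope_sumr// -sumrN; apply: eq_bigr => k _.
    by rewrite opprB.
  by rewrite ler_piMr// vertex0; have := vertex_gt0 alpha n; lra.
have Sr n : \sum_(0 <= k < n) edge_energy alpha f (inr k) <= N%:R * c + t.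
  have Srn m : (m <= N)%N -> \sum_(0 <= k < m) edge_energy alpha f (inr k) <= N%:R * c.
    move=> mN; apply: (@le_trans _ _ (\sum_(0 <= k < m) c)).
      by apply: ler_sum_nat => k /andP[_ km]; apply: Er; exact: leq_trans km mN.
    by rewrite sumr_const_nat subn0 -[c *+ m]mulr_natl ler_wpM2r ?ler_nat.
  have [nN|Nn] := leqP n N; first by apply: le_trans (Srn _ nN) _; rewrite lerDl.
  by rewrite (big_cat_nat (leq0n N) (ltnW Nn))/= lerD// Srn.
rewrite -lee_fin L2norm2_edges//; apply: lime_le.
  by apply: is_cvg_nneseries => k _ _; rewrite lee_fin addr_ge0// edge_energy_ge0.
apply: nearW => n; rewrite sumEFin lee_fin big_split/= -natr1 mulrDl mul1r.
by have := Sl n; have := Sr n; lra.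
Qed.

(** The ultrafilter selects limits at all points of the comb at once, so the net may be chosen after
    [e], without a diagonal argument over nets. Only differences of members of the sequence are
    estimated, whence the closure of [D] under subtraction; the limit itself comes from completeness
    of L^2. *)
Lemma compactness_criterion (D : set (plane R -> R[i])) :
  D `<=` H1 alpha -> (forall f g, D f -> D g -> D (f - g)) ->
  (forall e : R, 0 < e -> exists N, forall f n, D f ->
     \sum_(N <= k < n) edge_energy alpha f (inr k) <= e * H1norm alpha f ^+ 2) ->
  compactly_embedded mu D (H1norm alpha).
Proof.
move=> DH1 DB tails; split; first by move=> f /DH1; exact: H1_L2.
move=> f Df [M fM].
have M0 : 0 <= M := le_trans (H1norm_ge0 _ _) (fM 0%N).
have [U [UU Uoo]] := @ultraFilterLemma nat \oo _.
have UN N : U [set n | (N <= n)%N] by apply: Uoo; exists N.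
have /choice[l hl] : forall p, exists l : R[i], comb alpha p ->
    forall e : R, 0 < e -> U [set n | normc (f n p - l) < e].
  move=> p; have [cp|] := pselect (comb alpha p); last by move=> h; exists 0 => /h.
  have [|l hl] := @ultra_complex_limit R U UU (fun n => f n p) (15 * M).
    move=> n; apply: le_trans (H1_sup_bound alpha_gt0 (DH1 _ (Df n)) cp) _.
    by rewrite ler_wpM2l.
  by exists l.
have fB m n : H1norm alpha (f m - f n) <= 2 * M.
  rewrite -(ler_pXn2r (n := 2)) ?nnegrE ?H1norm_ge0 ?mulr_ge0//.
  apply: le_trans (H1norm_quasi alpha_gt0 (DH1 _ (Df m)) (DH1 _ (Df n))) _.
  have sM k : H1norm alpha (f k) ^+ 2 <= M ^+ 2 by rewrite ler_pXn2r ?nnegrE ?H1norm_ge0.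
  rewrite exprMn (_ : 2 ^+ 2 * M ^+ 2 = 2 * M ^+ 2 + 2 * M ^+ 2); last by ring.
  by apply: lerD; rewrite ler_wpM2l.
have [|s hs cs] := @ultra_cauchy_subsequence R U UU (fun m n => L2norm mu (f m - f n)) UN.
  move=> e e0.
  (* Budget for the squared norm: [e ^+ 2 / 4] for the far teeth, [e ^+ 2 / 8] for the values on the
     net and [e ^+ 2 / 8] for the oscillation off the net. [M'] bounds the H^1-norm of differences
     and is positive even if [M] is 0. *)
  pose M' := 2 * M + 1; have M'0 : 0 < M' by rewrite /M'; lra.
  have e4 : 0 < e ^+ 2 / 4 / M' ^+ 2 by rewrite !divr_gt0// exprn_gt0.
  have [N hN] := tails _ e4.
  have N0 : 0 < N.+1%:R :> R by rewrite ltr0n.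
  (* 400 = 8 * 50, where 50 = 2 * 5^2 comes from squaring the Hoelder estimate. *)
  have d0 : 0 < e ^+ 2 / (400 * N.+1%:R * M' ^+ 2).
    by rewrite divr_gt0 ?mulr_gt0 ?exprn_gt0 ?ltr0n.
  have [K' hK] := archi_inv d0; pose K := K'.+1.
  have {}hK := hK K' (leqnn _); rewrite -/K in hK.
  have [P [Pc Pnet]] := finite_net N (ltn0Sn K').
  (* With this [r], the contribution [N.+1%:R * (2 * r ^+ 2)] is [e ^+ 2 / 8]. *)
  have r0 : 0 < e ^+ 2 / (16 * N.+1%:R) by rewrite divr_gt0 ?exprn_gt0// mulr_gt0.
  pose r := Num.sqrt (e ^+ 2 / (16 * N.+1%:R)).
  have rp : 0 < r by rewrite sqrtr_gt0.
  exists [set n | forall q, q \in P -> normc (f n q - l q) < r / 2].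
    by apply: filter_seq => q qP; apply: hl; [exact: Pc|rewrite divr_gt0].
  move=> m n Am An; pose h := f m - f n.
  have Dh : D h by exact: DB.
  have Hh := DH1 _ Dh; have Lh := H1_L2 Hh.
  have [Ld dh] := H1_derivative Hh.
  have WM : L2norm mu (der h) <= M'.
    apply: le_trans (L2norm_der_le_H1norm _ _) _; apply: le_trans (fB m n) _.
    by rewrite /M'; lra.
  have hq q : q \in P -> normc (h q) <= r.
    move=> qP; have a := Am _ qP; have b := An _ qP.
    have -> : h q = (f m q - l q) - (f n q - l q) by rewrite opprB addrA subrK.
    by apply: le_trans (normcD _ _) _; rewrite normcN; lra.
  have hp p : comb alpha p -> p.2 = 0 \/ (exists2 k, (k < N)%N & p.1 = sv k) ->
      normc (h p) ^+ 2 <= 2 * r ^+ 2 + 50 * K%:R^-1 * M' ^+ 2.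
    move=> cp pN; have [q qP dpq] := Pnet p cp pN.
    have := comb_holder alpha_gt0 Ld dh cp (Pc _ qP).
    have s2 : Num.sqrt (cdist p q) <= Num.sqrt K%:R^-1.
      by rewrite ler_sqrt ?invr_ge0.
    have := hq _ qP; have := normcD (h p - h q) (h q); rewrite subrK.
    have sK : Num.sqrt K%:R^-1 ^+ 2 = K%:R^-1 :> R by rewrite sqr_sqrtr// invr_ge0.
    have W0 := L2norm_ge0 mu (der h).
    have sd0 := sqrtr_ge0 (cdist p q); have sK0 := sqrtr_ge0 (K%:R^-1 : R).
    move=> i1 i2 i3.
    have i4 : normc (h p - h q) <= 5 * Num.sqrt K%:R^-1 * M'.
      by apply: le_trans i3 _; rewrite ler_pM ?mulr_ge0// ler_wpM2l.
    have i5 : normc (h p) <= r + 5 * Num.sqrt K%:R^-1 * M' by lra.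
    have i6 : normc (h p) ^+ 2 <= (r + 5 * Num.sqrt K%:R^-1 * M') ^+ 2.
      rewrite ler_pXn2r ?nnegrE ?normc_ge0//; apply: addr_ge0; first exact: ltW.
      by rewrite !mulr_ge0// ltW.
    have -> : 50 * K%:R^-1 * M' ^+ 2 = 2 * (5 * Num.sqrt K%:R^-1 * M') ^+ 2.
      by rewrite !exprMn sK; ring.
    have := sqr_ge0 (r - 5 * Num.sqrt K%:R^-1 * M'); lra.
  have c0 : 0 <= 2 * r ^+ 2 + 50 * K%:R^-1 * M' ^+ 2.
    apply: addr_ge0; first by rewrite mulr_ge0 ?sqr_ge0.
    by rewrite mulr_ge0 ?sqr_ge0// mulr_ge0 ?invr_ge0 ?ler0n.
  have := L2norm_tail_bound Lh c0 hp (fun n => hN h n Dh).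
  have t1 : e ^+ 2 / 4 / M' ^+ 2 * H1norm alpha h ^+ 2 <= e ^+ 2 / 4.
    rewrite mulrAC ler_pdivrMr ?exprn_gt0// ler_wpM2l ?divr_ge0 ?sqr_ge0//.
    rewrite ler_pXn2r ?nnegrE ?H1norm_ge0 ?(ltW M'0)//.
    by apply: le_trans (fB m n) _; rewrite /M'; lra.
  have t2 : N.+1%:R * (2 * r ^+ 2) = e ^+ 2 / 8.
    rewrite sqr_sqrtr ?(ltW r0)//; move: (N.+1%:R : R) N0 => w w0.
    by field; rewrite gt_eqF.
  have t3 : N.+1%:R * (50 * K%:R^-1 * M' ^+ 2) <= e ^+ 2 / 8.
    have q0 : 0 < N.+1%:R * M' ^+ 2 * 50 by rewrite !mulr_gt0// exprn_gt0.
    have := ltW hK; rewrite -(ler_pM2l q0).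
    have -> : N.+1%:R * M' ^+ 2 * 50 * (e ^+ 2 / (400 * N.+1%:R * M' ^+ 2)) = e ^+ 2 / 8.
      by move: (N.+1%:R : R) N0 => w w0; field; rewrite !gt_eqF.
    by apply: le_trans; rewrite le_eqVlt; apply/orP; left; apply/eqP; ring.
  rewrite mulrDr => h1; rewrite -(ltr_pXn2r (n := 2)) ?nnegrE ?L2norm_ge0 ?(ltW e0)//.
  have : 0 < e ^+ 2 by rewrite exprn_gt0.
  by rewrite -/h; lra.
have Lf n := H1_L2 (DH1 _ (Df n)).
have [g Lg fg] := L2_complete (fun n => Lf (s n)) cs.
apply/L2_cvg_subseqP; exists s => //; exists g => // e /fg[N hN]; exists N => n /hN.
by rewrite L2norm_snorm.
Qed.

End Compactness.

(** * The form domains *)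

Section FormDomain.
Variables (R : realType) (alpha : R) (V : set (plane R)).
Hypothesis alpha_gt0 : 0 < alpha.
Local Notation mu := (comb_measure alpha).
Local Notation fdot := (form_dot (L2dot mu) (dirichlet_form alpha)).
Implicit Types (f g u v w : plane R -> R[i]) (p q : plane R).

Lemma H10_H1 : H10 alpha V `<=` H1 alpha.
Proof. by move=> f []. Qed.

Lemma H10_zero : H10 alpha V 0.
Proof.
split=> //; first exact: H1_zero.
by move=> _ e e0; exists 1 => // p _ _; rewrite normc0.
Qed.

Lemma H10D f g : H10 alpha V f -> H10 alpha V g -> H10 alpha V (f + g).
Proof.
move=> [Hf f0 fe] [Hg g0 ge]; split; first exact: H1D.
  by move=> p Vp cp; rewrite !fctE f0// g0// addr0.
move=> /[dup] /fe{}fe /ge{}ge e e0; have e2 : 0 < e / 2 by rewrite divr_gt0.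
have [r1 r10 h1] := fe _ e2; have [r2 r20 h2] := ge _ e2.
exists (Num.min r1 r2); first by rewrite lt_min r10.
move=> p cp; rewrite lt_min => /andP[p1 p2].
apply: le_lt_trans (normcD _ _) _; have := h1 p cp p1; have := h2 p cp p2; lra.
Qed.

Lemma H10Z (c : R[i]) f : H10 alpha V f -> H10 alpha V (c *: f).
Proof.
move=> [Hf f0 fe]; split; first exact: H1Z.
  by move=> p Vp cp; rewrite !fctE f0// scaler0.
move=> /fe{}fe e e0; have c1 : 0 < normc c + 1 by have := normc_ge0 c; lra.
have [|r r0 h] := fe (e / (normc c + 1)); first by rewrite divr_gt0.
exists r => // p cp pr; have := h p cp pr; rewrite !fctE normcM ltr_pdivlMr// => h'.
apply: le_lt_trans h'; rewrite mulrC ler_wpM2l ?normc_ge0// lerDl.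
by [].
Qed.

Lemma H10B f g : H10 alpha V f -> H10 alpha V g -> H10 alpha V (f - g).
Proof. by move=> Hf Hg; apply: H10D => //; rewrite -scaleN1r; exact: H10Z. Qed.

Lemma dirichlet_formDl f g h : H1 alpha f -> H1 alpha g -> H1 alpha h ->
  dirichlet_form alpha (f + g) h = dirichlet_form alpha f h + dirichlet_form alpha g h.
Proof.
move=> Hf Hg Hh; have [Lf _] := H1_derivative Hf; have [Lg _] := H1_derivative Hg.
have [Lh _] := H1_derivative Hh; have [Ls _] := H1_derivative (H1D alpha_gt0 Hf Hg).
rewrite /dirichlet_form -(L2dotDl Lf Lg Lh).
by apply: L2dot_eql => //; [exact: L2D|exact: derD].
Qed.

Lemma dirichlet_formZl c f h : H1 alpha f -> H1 alpha h ->
  dirichlet_form alpha (c *: f) h = c * dirichlet_form alpha f h.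
Proof.
move=> Hf Hh; have [Lf _] := H1_derivative Hf.
have [Lh _] := H1_derivative Hh; have [Ls _] := H1_derivative (H1Z alpha_gt0 c Hf).
rewrite /dirichlet_form -(L2dotZl c Lf Lh).
by apply: L2dot_eql => //; [exact: L2Z|exact: derZ].
Qed.

Lemma dirichlet_form_ge0 f : 0 <= complex.Re (dirichlet_form alpha f f).
Proof. by rewrite /dirichlet_form Re_L2dot -L2norm2_Rintegral sqr_ge0. Qed.

Lemma H10_semi_hilbert : semi_hilbert (H10 alpha V) fdot.
Proof.
split.
- exact: H10_zero.
- exact: H10D.
- by move=> c f; exact: H10Z.
- move=> f g h /H10_H1 Hf /H10_H1 Hg /H10_H1 Hh; rewrite /form_dot.
  rewrite dirichlet_formDl// L2dotDl; try exact: H1_L2.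
  by rewrite addrACA.
- move=> c f h /H10_H1 Hf /H10_H1 Hh; rewrite /form_dot.
  rewrite dirichlet_formZl// L2dotZl; try exact: H1_L2.
  by rewrite mulrDr.
- move=> f h /H10_H1 Hf /H10_H1 Hh; rewrite /form_dot /dirichlet_form rmorphD.
  have [Lf _] := H1_derivative Hf; have [Lh _] := H1_derivative Hh.
  by congr (_ + _); apply: L2dotC => //; exact: H1_L2.
- move=> f _; rewrite /form_dot cReD addr_ge0 ?dirichlet_form_ge0//.
  by rewrite Re_L2dot -L2norm2_Rintegral sqr_ge0.
move=> u Hu cu.
have [|l [Hl lp lu]] := H1_complete alpha_gt0 (fun n => H10_H1 (Hu n)).
  move=> e /cu[N hN]; exists N => m n Nm Nn; rewrite H1normE; exact: hN.
exists l; last by move=> e /lu[N hN]; exists N => n Nn; rewrite -H1normE; exact: hN.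
split=> //.
  move=> p Vp cp; apply: eq0_normc; apply/eqP; rewrite eq_le normc_ge0 andbT.
  apply/ler_addgt0Pr => e /(lp p cp)[N hN]; rewrite add0r.
  have [_ u0 _] := Hu N; have := hN N (leqnn _).
  by rewrite u0// sub0r normcN => /ltW.
(* H^1-convergence is uniform on the comb with constant 15, and 15 * (e / 30) = e / 2, so vanishing
   at the end survives in the limit. *)
move=> Ve e e0; have e2 : 0 < e / 30 by rewrite divr_gt0.
have [N hN] := lu _ e2; have {hN}NN := hN N (leqnn _).
have [HuN _ /(_ Ve) uN] := Hu N; have e3 : 0 < e / 2 by rewrite divr_gt0.
have [r r0 hr] := uN _ e3; exists r => // p cp pr.
have h1 := hr p cp pr.
have h2 := H1_sup_bound alpha_gt0 (H1B alpha_gt0 HuN Hl) cp.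
have -> : l p = u N p - (u N - l) p by rewrite !fctE opprB addrC subrK.
by apply: le_lt_trans (normcD _ _) _; rewrite normcN; lra.
Qed.

End FormDomain.

(** Makes the Neumann case the one without Dirichlet points. *)
Lemma H10_set0 (R : realType) (alpha : R) : H10 alpha set0 = H1 alpha.
Proof. by apply/seteqP; split=> f; [case|split]. Qed.

(** * Spectral consequences on the comb *)

Section CompactOperators.
Variables (R : realType) (alpha : R).
Hypothesis alpha_gt0 : 0 < alpha.
Local Notation mu := (comb_measure alpha).

Lemma compact_dirichlet_laplacian V :
  compactly_embedded mu (H10 alpha V) (H1norm alpha) ->
  compact_resolvent mu (dirichlet_laplacian alpha V) /\
  purely_discrete_spectrum mu (dirichlet_laplacian alpha V).
Proof.
have sD := H10_semi_hilbert V alpha_gt0.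
have DL2 : H10 alpha V `<=` L2 mu by move=> f /H10_H1; exact: H1_L2.
have a0 u : H10 alpha V u -> 0 <= complex.Re (dirichlet_form alpha u u).
  by move=> _; exact: dirichlet_form_ge0.
have nE u : H10 alpha V u -> H1norm alpha u =
    snorm (form_dot (L2dot mu) (dirichlet_form alpha)) u by move=> _; exact: H1normE.
by move=> cD; split; [exact: (compact_resolvent_form sD DL2 a0 nE)|
  exact: (compact_purely_discrete sD DL2 a0 nE)].
Qed.

Lemma neumann_laplacianE : neumann_laplacian alpha = dirichlet_laplacian alpha set0.
Proof. by rewrite /neumann_laplacian /dirichlet_laplacian H10_set0. Qed.

Lemma neumann_essential_spectrum (f : nat -> plane R -> R[i]) (M : R) :
  (forall n, H1 alpha (f n)) -> L2_orthonormal mu f ->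
  (forall m n, m != n -> dirichlet_form alpha (f m) (f n) = 0) ->
  (forall n, H1norm alpha (f n) <= M) ->
  essential_spectrum mu (neumann_laplacian alpha) !=set0.
Proof.
have := H10_semi_hilbert set0 alpha_gt0; rewrite H10_set0 => sD.
apply: (essential_spectrum_form sD); first by move=> u; exact: H1_L2.
  by move=> u _; exact: dirichlet_form_ge0.
by move=> u _; exact: H1normE.
Qed.

End CompactOperators.

(** * Mass on the teeth *)

Section VertexSums.
Variable R : realType.

(** With a = k + 1 and b = k + 2, it amounts to (b / a)^d >= 1 + d / b, which follows from ln (b /
    a) >= 1 / b and exp x >= 1 + x. It serves twice: to sum tails and, for d = alpha, to bound the
    gaps between vertices from below. *)
Lemma shaft_vertex_telescope (d : R) k : 0 < d ->
  d * shaft_vertex (1 + d) k.+1 <= shaft_vertex d k - shaft_vertex d k.+1.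
Proof.
move=> d0; rewrite /shaft_vertex.
have a0 : 0 < k.+1%:R :> R by rewrite ltr0n.
have b0 : 0 < k.+2%:R :> R by rewrite ltr0n.
have ab : k.+2%:R = k.+1%:R + 1 :> R by rewrite natr1.
move: (k.+1%:R : R) (k.+2%:R : R) a0 b0 ab => a b a0 b0 ab.
have eb : b `^ (- (1 + d)) = b^-1 * b `^ (- d).
  rewrite opprD powRD ?powR_inv1 ?(ltW b0)//.
  by apply/implyP => _; rewrite gt_eqF.
have ea : a `^ (- d) = b `^ (- d) * expR (d * ln (b / a)).
  rewrite /powR !gt_eqF// -expRD ln_div//; congr expR; ring.
have l1 : b^-1 <= ln (b / a).
  rewrite -[b / a]invf_div lnV ?posrE ?divr_gt0// lerNr.
  have -> : a / b = 1 + - b^-1 by rewrite ab; field; rewrite -ab gt_eqF.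
  apply: le_ln1Dx; rewrite ltrN2 invf_lt1//; lra.
have := expR_ge1Dx (d * ln (b / a)); rewrite eb ea => l2.
have P0 : 0 < b `^ (- d) by rewrite powR_gt0.
have l3 : d * b^-1 <= expR (d * ln (b / a)) - 1.
  by have : d * b^-1 <= d * ln (b / a); [rewrite ler_pM2l|lra].
rewrite -[X in _ <= _ - X]mulr1 -mulrBr mulrA mulrC.
by rewrite ler_pM2l.
Qed.

Lemma shaft_vertex_sum_small (s e : R) : 1 < s -> 0 < e ->
  exists N, forall n, \sum_(N <= k < n) shaft_vertex s k <= e.
Proof.
move=> s1 e0; pose d := s - 1; have d0 : 0 < d by rewrite /d; lra.
have sd : s = 1 + d by rewrite /d; lra.
(* The sum beyond [N] telescopes to at most [shaft_vertex d N / d]. It starts at [N.+1] because the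
   bound for a term involves the preceding vertex. *)
have [N hN] := vertex_small d0 (mulr_gt0 d0 e0).
exists N.+1 => n; have [nN|Nn] := leqP n N.+1.
  by rewrite big_geq// ltW.
have hd := ltW (hN N (leqnn _)).
rewrite -(ler_pM2l d0) mulr_sumr; apply: le_trans hd.
apply: (@le_trans _ _ (\sum_(N.+1 <= k < n) (shaft_vertex d k.-1 - shaft_vertex d k))).
  apply: ler_sum_nat => -[//|k] _; rewrite sd; exact: shaft_vertex_telescope.
case: n Nn => // n; rewrite ltnS => Nn.
rewrite big_add1 /= -(opprK (\sum_(_ <= _ < _) _)) -sumrN.
rewrite (eq_bigr (fun k => shaft_vertex d k.+1 - shaft_vertex d k)); last first.
  by move=> k _; rewrite opprB.
rewrite telescope_sumr 1?ltnW// opprB.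
by have := vertex_gt0 d n; lra.
Qed.

Lemma shaft_vertex_sum_large (alpha B : R) N : 0 < alpha -> alpha <= 1 ->
  exists n, B < \sum_(N <= k < n) shaft_vertex alpha k.
Proof.
move=> a0 a1; apply: contrapT => h.
have hB n : \sum_(N <= k < n) shaft_vertex alpha k <= B.
  by rewrite leNgt; apply/negP => hn; apply: h; exists n.
have a01 : 0 <= alpha <= 1 by rewrite (ltW a0).
apply: (dvg_riemannR a01); apply: nondecreasing_is_cvgn.
  apply: nondecreasing_series => n _ _; exact/ltW/riemannR_gt0/ltW.
exists (\sum_(0 <= k < N) shaft_vertex alpha k + B) => _ [n _ <-].
have E m k : \sum_(m <= i < k) riemannR alpha i = \sum_(m <= i < k) shaft_vertex alpha i.
  by apply: eq_bigr => i _; rewrite /shaft_vertex powRN.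
have [nN|Nn] := leqP n N; rewrite /series /= E.
  rewrite (big_cat_nat _ nN)//= -addrA lerDl addr_ge0//.
    by apply: sumr_ge0 => k _; exact/ltW/vertex_gt0.
  by apply: le_trans (hB 0%N); rewrite big_geq.
by rewrite (big_cat_nat _ (ltnW Nn))//= lerD2l hB.
Qed.

Lemma shaft_vertex_sqr (alpha : R) k : shaft_vertex alpha k ^+ 2 = shaft_vertex (2 * alpha) k.
Proof. by rewrite /shaft_vertex -powR_mulrn ?powR_ge0// -powRrM; congr (_ `^ _); ring. Qed.

End VertexSums.

Section Tails.
Variables (R : realType) (alpha : R).
Hypothesis alpha_gt0 : 0 < alpha.
Local Notation sv := (shaft_vertex alpha).
Local Notation ep := (edge_point alpha).
Local Notation len := (edge_length alpha).
Local Notation mu := (comb_measure alpha).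
Local Notation der := (comb_derivative alpha).
Implicit Types (f g : plane R -> R[i]) (p q : plane R).

(* A larger value would persist near the end, on teeth of infinite total length. *)
Lemma end_decay f p : alpha <= 1 -> H1 alpha f -> comb alpha p ->
  normc (f p) <= 5 * Num.sqrt (p.1 + p.2) * L2norm mu (der f).
Proof.
move=> a1 Hf cp; have Lf := H1_L2 Hf; have [Lg fg] := H1_derivative Hf.
rewrite leNgt; apply/negP => h; set W := L2norm _ _ in h.
have W0 : 0 <= W := L2norm_ge0 _ _.
(* Half of the excess: on teeth close enough to the end |f| is still at least [eta]. *)
pose eta := (normc (f p) - 5 * Num.sqrt (p.1 + p.2) * W) / 2.
have eta0 : 0 < eta by rewrite /eta; lra.
(* On a tooth whose vertex is below [d], points are at distance at most 2 d from the end. This adds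
   at most [eta / (5 * W + 1)] to the square root, hence at most [eta] to the Hoelder bound. *)
pose d := (eta / (5 * W + 1)) ^+ 2 / 2.
have K0 : 0 < 5 * W + 1 by lra.
have d0 : 0 < d by rewrite divr_gt0// exprn_gt0// divr_gt0.
have [N hN] := vertex_small alpha_gt0 d0.
have low k : (N <= k)%N -> eta ^+ 2 * sv k <= edge_energy alpha f (inr k).
  move=> Nk; apply: (edge_energy_lower alpha_gt0 (e := inr k) Lf) => t tl.
  rewrite ler_pXn2r ?nnegrE ?normc_ge0 ?(ltW eta0)//.
  have cq := comb_edge alpha_gt0 tl.
  have := comb_holder alpha_gt0 Lg fg cp cq; rewrite -/W => h1.
  have h2 := comb_dist_le alpha_gt0 cp cq.
  have /andP[t0 ts] := tl; rewrite /= in t0 ts.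
  have [/andP[p10 _] p20 _ _] := combP alpha_gt0 cp.
  have h3 : Num.sqrt (comb_dist p (ep (inr k) t)) <=
      Num.sqrt (p.1 + p.2) + eta / (5 * W + 1).
    have e1 : 0 <= eta / (5 * W + 1) by rewrite divr_ge0 ?ltW.
    have s0 := sqrtr_ge0 (p.1 + p.2).
    rewrite -(ger0_norm (addr_ge0 s0 e1)) -sqrtr_sqr ler_wsqrtr//.
    apply: le_trans h2 _; rewrite sqrrD sqr_sqrtr /=; last lra.
    have m0 : 0 <= Num.sqrt (p.1 + p.2) * (eta / (5 * W + 1)) *+ 2 by rewrite mulrn_wge0// mulr_ge0.
    have : sv k + t <= (eta / (5 * W + 1)) ^+ 2.
      by have := hN k Nk; rewrite /d; lra.
    by move: m0; lra.
  have h4 : 5 * W * (eta / (5 * W + 1)) <= eta.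
    rewrite mulrA ler_pdivrMr// mulrC ler_pM2l//; lra.
  have h5 := normcD (f p - f (ep (inr k) t)) (f (ep (inr k) t)); rewrite subrK in h5.
  have h6 : 5 * Num.sqrt (comb_dist p (ep (inr k) t)) * W <=
      5 * Num.sqrt (p.1 + p.2) * W + eta.
    have : 5 * W * Num.sqrt (comb_dist p (ep (inr k) t)) <=
        5 * W * (Num.sqrt (p.1 + p.2) + eta / (5 * W + 1)) by rewrite ler_wpM2l// mulr_ge0.
    rewrite mulrDr; lra.
  have : 2 * eta = normc (f p) - 5 * Num.sqrt (p.1 + p.2) * W by rewrite /eta; lra.
  lra.
(* Teeth of total length above [L2norm mu f ^+ 2 / eta ^+ 2] would carry more mass than [f] has. *)
have [n] := shaft_vertex_sum_large (L2norm mu f ^+ 2 / eta ^+ 2) N alpha_gt0 a1.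
rewrite ltr_pdivrMr ?exprn_gt0//; apply/negP; rewrite -leNgt.
have [nN|Nn] := leqP n N; first by rewrite big_geq// mul0r sqr_ge0.
apply: le_trans (edge_energy_sum n Lf); rewrite mulrC mulr_sumr.
rewrite (big_cat_nat (leq0n N) (ltnW Nn))/= -[leLHS]add0r lerD//.
  by apply: sumr_ge0 => k _; rewrite addr_ge0 ?edge_energy_ge0.
apply: ler_sum_nat => k /andP[Nk _]; apply: le_trans (low k Nk) _.
by rewrite lerDr edge_energy_ge0.
Qed.

Lemma H1_tail (e : R) : 1 / 2 < alpha -> 0 < e -> exists N, forall f n, H1 alpha f ->
  \sum_(N <= k < n) edge_energy alpha f (inr k) <= e * H1norm alpha f ^+ 2.
Proof.
move=> ha e0.
suff [s s1 [C C0 hs]] : exists2 s : R, 1 < s & exists2 C : R, 0 < C &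
    forall f k, H1 alpha f ->
      edge_energy alpha f (inr k) <= C * H1norm alpha f ^+ 2 * shaft_vertex s k.
  have [|N hN] := @shaft_vertex_sum_small R s (e / C) s1; first by rewrite divr_gt0.
  exists N => f n Hf.
  apply: (@le_trans _ _ (\sum_(N <= k < n) C * H1norm alpha f ^+ 2 * shaft_vertex s k)).
    by apply: ler_sum => k _; exact: hs.
  rewrite -mulr_sumr; apply: le_trans (ler_wpM2l _ (hN n)) _.
    by rewrite mulr_ge0 ?sqr_ge0// ltW.
  by rewrite le_eqVlt; apply/orP; left; apply/eqP; field; rewrite gt_eqF.
have [a1|a1] := ltP 1 alpha.
  (* The sup bound, with constant 15, times the length of the tooth. *)
  exists alpha => //; exists (15 ^+ 2); first by rewrite exprn_gt0// ltr0n.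
  move=> f k Hf; apply: (edge_energy_upper alpha_gt0 (e := inr k) (H1_L2 Hf)) => t tl.
  rewrite -exprMn ler_pXn2r ?nnegrE ?normc_ge0 ?mulr_ge0 ?H1norm_ge0 ?ler0n//.
  exact: H1_sup_bound (comb_edge alpha_gt0 tl).
exists (2 * alpha); first lra.
(* 5^2 comes from [end_decay] and the 2 from p.1 + p.2 <= 2 x_k on the tooth; the length of the
   tooth is the second factor x_k. *)
exists (2 * 5 ^+ 2); first by rewrite mulr_gt0 ?exprn_gt0 ?ltr0n.
move=> f k Hf; rewrite -shaft_vertex_sqr [sv k ^+ 2]expr2 mulrA.
apply: (edge_energy_upper alpha_gt0 (e := inr k) (H1_L2 Hf)) => t tl.
have := end_decay a1 Hf (comb_edge alpha_gt0 tl).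
have /andP[t0 ts] := tl; rewrite /= in t0 ts; have s0 := vertex_gt0 alpha k.
have H0 := H1norm_ge0 alpha f; set q := ep _ _ => h.
have h1 : normc (f q) <= 5 * Num.sqrt (sv k + t) * H1norm alpha f.
  apply: le_trans h _; rewrite ler_wpM2l ?mulr_ge0//.
  exact: L2norm_der_le_H1norm.
have : normc (f q) ^+ 2 <= (5 * Num.sqrt (sv k + t) * H1norm alpha f) ^+ 2.
  by rewrite ler_pXn2r ?nnegrE ?normc_ge0// !mulr_ge0.
move=> /le_trans; apply; rewrite !exprMn sqr_sqrtr; last lra.
rewrite [leRHS]mulrAC ler_wpM2r ?sqr_ge0//; lra.
Qed.

Lemma tip_tail V (e : R) : tips alpha `<=` V -> 0 < e ->
  exists N, forall f n, H10 alpha V f ->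
  \sum_(N <= k < n) edge_energy alpha f (inr k) <= e * H1norm alpha f ^+ 2.
Proof.
move=> tV e0; have [N hN] := vertex_small alpha_gt0 e0; exists N => f n [Hf f0 _].
have [Lg fg] := H1_derivative Hf.
(* The estimate from the tip gives |f|^2 <= x_k E_k, with E_k the energy on the tooth, hence a mass
   at most x_k^2 E_k <= e E_k, by x_k <= 1 and x_k < e. The E_k are summable for every [alpha]. *)
have Ek k : (N <= k)%N -> edge_energy alpha f (inr k) <= e * edge_energy alpha (der f) (inr k).
  move=> Nk; have s0 := vertex_gt0 alpha k; have s1 := vertex_le1 alpha_gt0 k.
  apply: (@le_trans _ _ (sv k * edge_energy alpha (der f) (inr k) * len (inr k))).
    apply: (edge_energy_upper alpha_gt0 (e := inr k) (H1_L2 Hf)).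
    move=> t /andP[t0 tl].
    have := edge_holder Lg fg t0 tl (lexx _).
    have -> : f (ep (inr k) (len (inr k))) = 0.
      by apply: f0; [apply: tV; exists k|apply: comb_edge => //=; rewrite lexx ltW].
    rewrite sub0r normcN => /le_trans; apply; rewrite ler_wpM2r ?edge_energy_ge0//=.
    by rewrite lerBlDr lerDl.
  rewrite /= mulrAC ler_wpM2r ?edge_energy_ge0//; have /ltW := hN k Nk.
  by apply: le_trans; rewrite ler_piMr// ltW.
apply: (@le_trans _ _ (\sum_(N <= k < n) e * edge_energy alpha (der f) (inr k))).
  by apply: ler_sum_nat => k /andP[Nk _]; exact: Ek.
rewrite -mulr_sumr ler_wpM2l ?(ltW e0)//.
apply: (@le_trans _ _ (L2norm mu (der f) ^+ 2)); last first.
  by rewrite H1norm2 lerDr sqr_ge0.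
have [nN|Nn] := leqP n N; first by rewrite big_geq// sqr_ge0.
apply: le_trans (edge_energy_sum n Lg).
rewrite (big_cat_nat (leq0n N) (ltnW Nn))/= -[leLHS]add0r lerD//.
  by apply: sumr_ge0 => k _; rewrite addr_ge0 ?edge_energy_ge0.
by apply: ler_sum_nat => k _; rewrite lerDr edge_energy_ge0.
Qed.

End Tails.

(** Endpoints are null, so the values of a slope at the vertices do not matter. *)
Lemma Rintegral_cst_interior (R : realType) (h : R -> R) (c t : R) : 0 <= t ->
  (forall s, 0 < s < t -> h s = c) -> \int[@lebesgue_measure R]_(s in `[0, t]) h s = c * t.
Proof.
move=> t0 hc.
have mh : measurable_fun `]0, t[ (EFin \o h).
  apply: (eq_measurable_fun (cst c%:E)); last exact: measurable_cst.
  by move=> s /set_mem /=; rewrite in_itv/= => /hc ->.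
rewrite /Rintegral integral_itv_bndoo// (eq_integral (cst c%:E)); last first.
  by move=> s /set_mem /=; rewrite in_itv/= => /hc ->.
rewrite integral_cst//= lebesgue_measure_itv/= lte_fin; move: t0.
by rewrite le_eqVlt => /predU1P[<-|->]; rewrite ?ltxx ?mule0 ?mulr0//= oppr0 addr0.
Qed.

(** * An orthonormal sequence of bounded energy *)

Section Ramps.
Variables (R : realType) (alpha : R).
Hypothesis alpha_gt0 : 0 < alpha.
Local Notation sv := (shaft_vertex alpha).
Local Notation ep := (edge_point alpha).
Local Notation len := (edge_length alpha).
Local Notation mu := (comb_measure alpha).
Local Notation leb := (@lebesgue_measure R).
Local Notation cder := (is_comb_derivative alpha).
Implicit Types (f g : plane R -> R[i]) (p q : plane R).

(** Such a function lives on the first [N] shaft edges and teeth, each of length at most 1. *)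
Lemma L2_bounded f (B c : R) : cmeasurable f -> 0 < c -> 
  (forall p, normc (f p) ^+ 2 <= B) -> (forall p, p.1 < c -> f p = 0) -> L2 mu f.
Proof.
move=> mf c0 fB fc; have [N hN] := vertex_small alpha_gt0 c0.
have B0 : 0 <= B by apply: le_trans (fB (0, 0)); exact: sqr_ge0.
have mF : measurable_fun setT (fun p => (normc (f p) ^+ 2)%:E).
  exact/measurable_EFinP/measurable_normc2.
pose s := Num.sqrt (N%:R * (B + B)).
have s2 : s ^+ 2 = N%:R * (B + B) by rewrite sqr_sqrtr// mulr_ge0 ?addr_ge0.
apply: (L2norm_le (e := s) mf (sqrtr_ge0 _) _).1.
rewrite comb_integral//; last by move=> p; rewrite lee_fin sqr_ge0.
have E e : (\int[leb]_(t in `[0%R, len e]) (normc (f (ep e t)) ^+ 2)%:E <= B%:E)%E.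
  apply: (@le_trans _ _ (\int[leb]_(t in `[0%R, len e]) (cst B%:E) t)%E).
    apply: ge0_le_integral => //.
    - by move=> t _; rewrite lee_fin sqr_ge0.
    - exact: measurable_funS (measurableT_comp mF (measurable_edge_point _ e)).
    - by move=> t _; rewrite lee_fin.
  rewrite integral_cst//= lebesgue_measure_itv/= lte_fin edge_length_gt0// oppr0 addr0.
  by rewrite -EFinM lee_fin ler_piMr// edge_length_le1.
have z0 k : (N <= k)%N -> (\int[leb]_(t in `[0%R, len (inl k)]) (normc (f (ep (inl k) t)) ^+ 2)%:E +
   \int[leb]_(t in `[0%R, len (inr k)]) (normc (f (ep (inr k) t)) ^+ 2)%:E = 0)%E.
  move=> Nk; have hk := hN k Nk; rewrite !integral0_eq ?adde0// => t /=; rewrite in_itv/= => /andP[t0 t1].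
    by rewrite fc ?normc0 ?expr0n//=.
  by rewrite fc ?normc0 ?expr0n//=; lra.
rewrite s2; apply: lime_le.
  apply: is_cvg_nneseries => k _ _.
  by apply: adde_ge0; apply: integral_ge0 => t _; rewrite lee_fin sqr_ge0.
apply: nearW => n; rewrite /=.
apply: (@le_trans _ _ (\sum_(0 <= k < n | (k < N)%N) (B + B)%:E)%E).
  rewrite [leRHS]big_mkcond/=; apply: lee_sum => k _.
  case: ltnP => [_|/z0 ->]; last exact: lexx.
  rewrite EFinD; exact: leeD (E (inl k)) (E (inr k)).
rewrite sumEFin lee_fin.
have : \sum_(0 <= k < n | (k < N)%N) (B + B) <= \sum_(0 <= k < N) (B + B).
  have BB : 0 <= B + B by rewrite addr_ge0.
  have [nN|Nn] := leqP n N.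
    rewrite (big_cat_nat (leq0n n) nN)/= big_mkcond/=.
    rewrite -[leLHS]addr0 lerD ?sumr_ge0//.
    by apply: ler_sum => k _; case: ifP.
  rewrite (big_cat_nat (leq0n N) (ltnW Nn))/= [X in _ + X]big_nat_cond.
  rewrite [X in _ + X]big_pred0; last first.
    by move=> k; lia.
  by rewrite addr0 big_mkcond/=; apply: ler_sum => k _; case: ifP.
by rewrite [X in _ <= X]sumr_const_nat subn0 -[X in _ <= X]mulr_natl.
Qed.

(** A function of the shaft coordinate only, hence constant on each tooth. *)
Definition ramp (a b : R) p : R[i] := (Num.min (Num.max p.1 a) b - a)%:C.

(* The vertices are removed so that the slope vanishes identically on the teeth. *)
Definition slope_set (a b : R) : set (plane R) :=
  (`]a, b[%classic `\` range sv) `*` [set 0].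

Definition slope a b p : R[i] := (\1_(slope_set a b) p)%:C.

Lemma measurable_slope_set a b : measurable (slope_set a b).
Proof.
apply: measurableX; last exact: measurable_set1.
apply: measurableD => //; apply: countable_measurable; first exact: measurable_set1.
exact: sub_countable (card_image_le _ _) (countableP _).
Qed.

Lemma cmeasurable_slope a b : cmeasurable (slope a b).
Proof.
split; last exact: measurable_cst.
exact: measurable_indic (measurable_slope_set a b).
Qed.

Lemma cmeasurable_ramp a b : cmeasurable (ramp a b).
Proof.
split; last exact: measurable_cst.
apply: measurable_funB; last exact: measurable_cst.
apply: measurable_minr; last exact: measurable_cst.
by apply: measurable_maxr; [exact: measurable_fst|exact: measurable_cst].
Qed.

Lemma normc_slope a b p : normc (slope a b p) ^+ 2 <= 1.
Proof.
rewrite /slope normc_real indicE; case: (_ \in _).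
  by rewrite normr1 expr1n.
by rewrite normr0 expr0n ler01.
Qed.

Lemma slope_out a b p : ~ (a < p.1 < b) -> slope a b p = 0.
Proof.
move=> h; rewrite /slope indicE memNset// => -[[/= h1 _] _].
by apply: h; move: h1; rewrite in_itv.
Qed.

Lemma slope_tooth a b k t : slope a b (ep (inr k) t) = 0.
Proof. by rewrite /slope indicE memNset// => -[[/= _ +] _]; apply; exists k. Qed.

Lemma vertex_edge_interior k (x : R) : sv k.+1 < x < sv k -> ~ range sv x.
Proof.
move=> /andP[h1 h2] [j _ e]; rewrite -{}e in h1 h2.
have jk : (k < j)%N by rewrite ltnNge; apply/negP => /(vertex_le alpha_gt0); lra.
by have := vertex_le alpha_gt0 jk; lra.
Qed.

Lemma slope_shaft m n k t : (m <= n)%N -> 0 < t < len (inl k) ->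
  slope (sv n) (sv m) (ep (inl k) t) = (m <= k < n)%:R%:C.
Proof.
move=> mn /andP[t0 t1]; rewrite /= in t1; set p := ep _ _.
have kp : sv k.+1 < p.1 < sv k by rewrite /p /=; apply/andP; split; lra.
have [/andP[mk kn]|/negP h] := boolP (m <= k < n)%N.
  have h1 := vertex_le alpha_gt0 mk; have h2 := vertex_le alpha_gt0 kn.
  rewrite /slope indicE mem_set//; split=> //=; split; last exact: vertex_edge_interior kp.
  by rewrite /= in_itv/=; move: kp => /andP[]; rewrite /=; lra.
rewrite slope_out// => /andP[h1 h2]; apply: h; move: kp => /andP[k1 k2]; apply/andP; split.
  by rewrite leqNgt; apply/negP => /(vertex_le alpha_gt0); lra.
by rewrite ltnNge; apply/negP => /(vertex_le alpha_gt0); lra.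
Qed.

Lemma L2_slope a b : 0 < a -> L2 mu (slope a b).
Proof.
move=> a0; apply: (L2_bounded (cmeasurable_slope a b) a0 (B := 1)).
  exact: normc_slope.
by move=> p pa; apply: slope_out; lra.
Qed.

Lemma ramp_derivative m n : (m <= n)%N -> cder (ramp (sv n) (sv m)) (slope (sv n) (sv m)).
Proof.
move=> mn e t /andP[t0 tl].
have mn' := vertex_le alpha_gt0 mn.
have I (c : R) : (forall s, 0 < s < t -> slope (sv n) (sv m) (ep e s) = c%:C) ->
    cintegral leb `[0, t] (fun s => slope (sv n) (sv m) (ep e s)) = (c * t)%:C.
  move=> hc; rewrite /cintegral (Rintegral_cst_interior t0 (c := c)); last first.
    by move=> s /hc ->.
  rewrite (Rintegral_cst_interior t0 (c := 0)) ?mul0r//.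
case: e tl I => k /= tl I; last first.
  rewrite (I 0) ?mul0r ?addr0//.
  by move=> s _; exact: slope_tooth.
rewrite (I (m <= k < n)%:R); last first.
  by move=> s /andP[s0 st]; apply: slope_shaft => //; rewrite s0 (lt_le_trans st).
rewrite /ramp /= -rmorphD/=; congr (_ %:C); rewrite addr0.
have [/andP[mk kn]|/negP h] := boolP (m <= k < n)%N.
  have h1 := vertex_le alpha_gt0 mk; have h2 := vertex_le alpha_gt0 kn.
  have -> : true%:R * t = t := mul1r t.
  by rewrite !max_l ?min_l; lra.
have -> : false%:R * t = 0 := mul0r t.
have [mk|km] := leqP m k; last first.
  have h1 := vertex_le alpha_gt0 km.
  by rewrite !max_l ?min_r; lra.
have nk : (n <= k)%N by rewrite leqNgt; apply/negP => kn; apply: h; rewrite mk.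
have h1 := vertex_le alpha_gt0 nk.
rewrite addr0 !max_r//; have := vertex_lt alpha_gt0 (ltnSn k); lra.
Qed.

Lemma L2norm_slope m n : (m <= n)%N ->
  L2norm mu (slope (sv n) (sv m)) ^+ 2 <= sv m - sv n.
Proof.
move=> mn; have Ls := L2_slope (sv m) (vertex_gt0 alpha n).
have mn' := vertex_le alpha_gt0 mn.
rewrite -lee_fin L2norm2_edges//; apply: lime_le.
  by apply: is_cvg_nneseries => k _ _; rewrite lee_fin addr_ge0 ?edge_energy_ge0.
apply: nearW => N; rewrite sumEFin lee_fin.
have Er k : edge_energy alpha (slope (sv n) (sv m)) (inr k) <= 0.
  rewrite -[leRHS](mul0r (len (inr k))); apply: edge_energy_upper => // t _.
  by rewrite slope_tooth normc0 expr0n.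
have El k : edge_energy alpha (slope (sv n) (sv m)) (inl k) <=
    if (m <= k < n)%N then sv k - sv k.+1 else 0.
  case: ifP => [kmn|kmn].
    rewrite -[leRHS]mul1r; apply: (edge_energy_upper alpha_gt0 (e := inl k)) => // t _.
    exact: normc_slope.
  rewrite -[leRHS](mul0r (len (inl k))); apply: edge_energy_upper => // t /andP[t0 tl].
  (* [slope_shaft] covers the interior of an edge only; the two endpoints are located by hand. *)
  have [/eqP ->|tn0] := boolP (t == 0).
    rewrite slope_out ?normc0 ?expr0n//= addr0 => /andP[h1 h2].
    move/negP : kmn; apply; apply/andP; split.
      by rewrite leqNgt; apply/negP => /(vertex_le alpha_gt0); lra.
    by rewrite ltnNge; apply/negP => /leqW /(vertex_le alpha_gt0); lra.
  have [/eqP ->|tnl] := boolP (t == len (inl k)).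
    rewrite slope_out ?normc0 ?expr0n//= addrC subrK => /andP[h1 h2].
    move/negP : kmn; apply; apply/andP; split.
      by rewrite leqNgt; apply/negP => /ltnW /(vertex_le alpha_gt0); lra.
    by rewrite ltnNge; apply/negP => /(vertex_le alpha_gt0); lra.
  rewrite slope_shaft ?kmn ?normc0 ?expr0n//.
  by rewrite !lt_neqAle eq_sym tn0 t0 tnl.
apply: (@le_trans _ _ (\sum_(0 <= k < N) if (m <= k < n)%N then sv k - sv k.+1 else 0)).
  by apply: ler_sum => k _; have := El k; have := Er k; lra.
(* The telescoped partial sum; [maxn] and [minn] clamp [N] to the range from [m] to [n]. *)
apply: (@le_trans _ _ (sv m - sv (minn (maxn m N) n))); last first.
  by rewrite lerD2l lerN2; apply: (vertex_le alpha_gt0); exact: geq_minr.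
elim: N => [|N ih]; first by rewrite big_geq// maxn0 (minn_idPl mn) subrr.
rewrite (big_nat_recr N 0)//=.
set c := if _ then _ else _; apply: (le_trans (lerD ih (lexx c))); rewrite {}/c.
have [/andP[mN Nn]|/negP h] := boolP (m <= N < n)%N.
  by rewrite (maxn_idPr mN) (maxn_idPr (leqW mN)) (minn_idPl Nn) (minn_idPl (ltnW Nn)) addrA subrK.
rewrite addr0 lerD2l lerN2; apply: (vertex_le alpha_gt0).
by rewrite leq_min !geq_min !geq_max; lia.
Qed.

End Ramps.

Section L2Dot.
Context d (T : measurableType d) (R : realType).
Variable mu : {measure set T -> \bar R}.
Implicit Types (f g h : T -> R[i]).

Lemma cmeasurableZ (c : R[i]) f : cmeasurable f -> cmeasurable (c *: f).
Proof. exact: (cmeasurableM (cmeasurable_cst _ c)). Qed.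

Lemma L2dot_disjoint f g : (forall p, f p = 0 \/ g p = 0) -> L2dot mu f g = 0.
Proof.
move=> fg; rewrite /L2dot.
have -> : (fun x => f x * conjc (g x)) = cst 0.
  by apply/funext => x; case: (fg x) => ->; rewrite ?mul0r// rmorph0 mulr0.
have r0 : \int[mu]_x (0 : R) = 0 by rewrite /Rintegral integral0.
by rewrite /cintegral /= !r0.
Qed.

Lemma L2dot_self f : L2dot mu f f = (L2norm mu f ^+ 2)%:C.
Proof.
rewrite L2norm2_Rintegral -Re_L2dot /L2dot /cintegral /=; congr (_ +i* _).
rewrite -[RHS](_ : \int[mu]_x (0 : R) = 0); last by rewrite /Rintegral integral0.
by apply: eq_Rintegral => x _; rewrite mulrC mul_conjc.
Qed.

Lemma L2dot_eqr f g h : L2 mu f -> L2 mu g -> L2 mu h -> L2norm mu (f - g) = 0 ->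
  L2dot mu h f = L2dot mu h g.
Proof.
by move=> Lf Lg Lh fg; rewrite (L2dotC Lf Lh) (L2dotC Lg Lh) (L2dot_eql Lf Lg Lh fg).
Qed.

End L2Dot.

Section Bumps.
Variables (R : realType) (alpha : R).
Hypothesis alpha_gt0 : 0 < alpha.
Local Notation sv := (shaft_vertex alpha).
Local Notation len := (edge_length alpha).
Local Notation mu := (comb_measure alpha).
Local Notation cder := (is_comb_derivative alpha).
Implicit Types (f g : plane R -> R[i]) (p q : plane R).

(** [comb_derivative] is an unspecified choice; uniqueness up to null functions lets explicit
    derivatives replace it. *)
Lemma dirichlet_formE f f' g g' : H1 alpha f -> L2 mu f' -> cder f f' ->
  H1 alpha g -> L2 mu g' -> cder g g' -> dirichlet_form alpha f g = L2dot mu f' g'.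
Proof.
move=> Hf Lf' ff' Hg Lg' gg'; have [Lf _] := H1_derivative Hf; have [Lg _] := H1_derivative Hg.
rewrite /dirichlet_form (L2dot_eql Lf Lf' Lg (comb_derivativeE Lf' ff' Hf)).
exact: L2dot_eqr (comb_derivativeE Lg' gg' Hg).
Qed.

(** The telescoping bounds decrease along the shaft vertices, so each of the n - m gaps is at least
    the one at [n]. *)
Lemma shaft_vertex_gap m n : (m <= n)%N ->
  (n - m)%:R * (alpha * shaft_vertex (1 + alpha) n) <= sv m - sv n.
Proof.
have dec k l : (k <= l)%N -> shaft_vertex (1 + alpha) l <= shaft_vertex (1 + alpha) k.
  by apply: vertex_le; rewrite addr_gt0.
elim: n => [|n ih]; first by rewrite leqn0 => /eqP ->; rewrite mul0r subrr.
rewrite leq_eqVlt => /predU1P[->|]; first by rewrite subnn mul0r subrr.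
rewrite ltnS => mn; rewrite subSn// -natr1 mulrDl mul1r.
have h1 := shaft_vertex_telescope n alpha_gt0.
have h2 : (n - m)%:R * (alpha * shaft_vertex (1 + alpha) n.+1) <=
    (n - m)%:R * (alpha * shaft_vertex (1 + alpha) n).
  by rewrite ler_wpM2l// ler_wpM2l ?(ltW alpha_gt0)// dec.
by have := ih mn; lra.
Qed.

(** There are M gaps, each at least alpha (4M+1)^(-1-alpha), and M / (4M+1) >= 1/5. *)
Lemma vertex_gap_lower M m : (0 < M)%N -> (m + M <= 4 * M)%N ->
  alpha / 5 * sv (4 * M) <= sv m - sv (m + M).
Proof.
move=> M0 mM; apply: le_trans (shaft_vertex_gap (leq_addr M m)).
rewrite addnC addnK.
have h : shaft_vertex (1 + alpha) (4 * M) <= shaft_vertex (1 + alpha) (M + m).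
  by apply: vertex_le; [rewrite addr_gt0|rewrite addnC].
apply: (@le_trans _ _ (M%:R * (alpha * shaft_vertex (1 + alpha) (4 * M)))); last first.
  by rewrite ler_wpM2l// ler_wpM2l ?(ltW alpha_gt0).
have w0 : 0 < (4 * M).+1%:R :> R by rewrite ltr0n.
have -> : shaft_vertex (1 + alpha) (4 * M) = (4 * M).+1%:R^-1 * sv (4 * M).
  rewrite /shaft_vertex opprD powRD ?powR_inv1 ?(ltW w0)//.
  by apply/implyP => _; rewrite gt_eqF.
have -> : M%:R * (alpha * ((4 * M).+1%:R^-1 * sv (4 * M))) =
    alpha * (M%:R / (4 * M).+1%:R) * sv (4 * M) by ring.
rewrite ler_wpM2r ?(ltW (vertex_gt0 _ _))// ler_wpM2l ?(ltW alpha_gt0)//.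
rewrite ler_pdivlMr// mulrC ler_pdivrMr ?ltr0n// -natrM ler_nat.
lia.
Qed.

(** This is where alpha <= 1/2 enters: [sv (4 * M) ^+ 2] is (4M+1)^(-2 alpha) >= 1 / (4M+1). *)
Lemma vertex_mass_lower M : alpha <= 1 / 2 -> (0 < M)%N ->
  1 / 5 <= M%:R * sv (4 * M) ^+ 2.
Proof.
move=> a12 M0; rewrite shaft_vertex_sqr.
have w0 : 0 < (4 * M).+1%:R :> R by rewrite ltr0n.
have h : (4 * M).+1%:R^-1 <= shaft_vertex (2 * alpha) (4 * M).
  rewrite -powR_inv1 ?(ltW w0)// /shaft_vertex ler_powR ?ler1n//; lra.
apply: (@le_trans _ _ (M%:R * (4 * M).+1%:R^-1)); last by rewrite ler_wpM2l.
rewrite ler_pdivlMr// mulrAC ler_pdivrMr ?ltr0n// mul1r -natrM ler_nat.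
lia.
Qed.

(** The factor that brings the top of the ramp, of height [sv m - sv n], to 1. *)
Definition ramp_height m n : R[i] := ((sv m - sv n)^-1)%:C.

(** Larger indices are nearer to the end: going outwards, it rises from [sv l] to [sv k], equals 1
    up to [sv j] and falls back to 0 at [sv i]. *)
Definition trapezoid i j k l : plane R -> R[i] :=
  ramp_height k l *: ramp (sv l) (sv k) + (- ramp_height i j) *: ramp (sv j) (sv i).

Definition trapezoid_slope i j k l : plane R -> R[i] :=
  ramp_height k l *: slope alpha (sv l) (sv k) + (- ramp_height i j) *: slope alpha (sv j) (sv i).

Lemma ramp_low (a b : R) p : a <= b -> p.1 <= a -> ramp a b p = 0.
Proof. by move=> ab pa; rewrite /ramp max_r// min_l// subrr. Qed.

Lemma ramp_high m n p : (m < n)%N -> sv m <= p.1 ->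
  ramp_height m n * ramp (sv n) (sv m) p = 1.
Proof.
move=> mn pm; have := vertex_lt alpha_gt0 mn => h.
rewrite /ramp /ramp_height max_l ?min_r//; last lra.
by rewrite -rmorphM mulVf ?rmorph1// subr_eq0 gt_eqF.
Qed.

Lemma normc_ramp m n p : (m < n)%N ->
  normc (ramp_height m n * ramp (sv n) (sv m) p) <= 1.
Proof.
move=> mn; have h := vertex_lt alpha_gt0 mn.
rewrite /ramp /ramp_height -rmorphM normc_real mulrC -[leRHS](mulVf (x := sv m - sv n)); last first.
  by rewrite subr_eq0 gt_eqF.
have d0 : 0 < sv m - sv n by lra.
rewrite [leRHS]mulrC normrM [X in _ * X <= _]ger0_norm ?invr_ge0 ?(ltW d0)//.
rewrite ler_wpM2r ?invr_ge0 ?(ltW d0)// ger0_norm.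
  by rewrite lerD2r ge_min lexx orbT.
by rewrite subr_ge0 le_min le_max lexx orbT ltW.
Qed.

Section Trapezoid.
Variables i j k l : nat.
Hypotheses (ij : (i < j)%N) (jk : (j <= k)%N) (kl : (k < l)%N).
Local Notation tr := (trapezoid i j k l).
Local Notation tr' := (trapezoid_slope i j k l).

Let slj : sv l <= sv j. Proof. exact: vertex_le (leq_trans jk (ltnW kl)). Qed.
Let ski : sv k <= sv i. Proof. exact: vertex_le (leq_trans (ltnW ij) jk). Qed.
Let slk := vertex_lt alpha_gt0 kl.
Let sji := vertex_lt alpha_gt0 ij.
Let Ls m n : L2 mu (slope alpha (sv n) (sv m)) := L2_slope alpha_gt0 _ (vertex_gt0 _ _).

Lemma trapezoidE p : tr p =
  ramp_height k l * ramp (sv l) (sv k) p - ramp_height i j * ramp (sv j) (sv i) p.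
Proof. by rewrite /trapezoid !fctE scaleNr. Qed.

Lemma trapezoid_slopeE p : tr' p =
  ramp_height k l * slope alpha (sv l) (sv k) p - ramp_height i j * slope alpha (sv j) (sv i) p.
Proof. by rewrite /trapezoid_slope !fctE scaleNr. Qed.

Lemma trapezoid_derivative : cder tr tr'.
Proof.
have dr m n c : (m < n)%N -> cder (c *: ramp (sv n) (sv m)) (c *: slope alpha (sv n) (sv m)).
  by move=> /ltnW mn; exact: comb_derivativeZ (Ls m n) (ramp_derivative alpha_gt0 mn).
exact: comb_derivativeD (L2Z _ (Ls _ _)) (L2Z _ (Ls _ _)) (dr _ _ _ kl) (dr _ _ _ ij).
Qed.

Lemma L2_trapezoid_slope : L2 mu tr'.
Proof. exact: L2D (L2Z _ (Ls _ _)) (L2Z _ (Ls _ _)). Qed.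

Lemma trapezoid_out p : ~ (sv l < p.1 < sv i) -> tr p = 0.
Proof.
move=> h; rewrite trapezoidE; have [pl|pl] := leP p.1 (sv l).
  rewrite (ramp_low (ltW slk) pl) (ramp_low (ltW sji) (le_trans pl slj)).
  by rewrite !mulr0 subrr.
have ph : sv i <= p.1 by rewrite leNgt; apply/negP => ph; apply: h; rewrite pl.
by rewrite (ramp_high kl (le_trans ski ph)) (ramp_high ij ph) subrr.
Qed.

Lemma trapezoid_slope_out p : ~ (sv l < p.1 < sv i) -> tr' p = 0.
Proof.
move=> h; rewrite trapezoid_slopeE.
have e1 : slope alpha (sv l) (sv k) p = 0.
  by apply: slope_out => /andP[k1 k2]; apply: h; rewrite k1 (lt_le_trans k2 ski).
have e2 : slope alpha (sv j) (sv i) p = 0.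
  by apply: slope_out => /andP[k1 k2]; apply: h; rewrite k2 (le_lt_trans slj k1).
by rewrite e1 e2 !mulr0 subrr.
Qed.

Lemma trapezoid_plateau p : sv k <= p.1 <= sv j -> tr p = 1.
Proof.
move=> /andP[k1 k2]; rewrite trapezoidE (ramp_high kl k1) (ramp_low (ltW sji) k2).
by rewrite mulr0 subr0.
Qed.

Lemma L2_trapezoid : L2 mu tr.
Proof.
apply: (L2_bounded alpha_gt0 _ (vertex_gt0 alpha l) (B := 2 ^+ 2)).
- by apply: cmeasurableD; apply: cmeasurableZ; exact: cmeasurable_ramp.
- move=> p; rewrite ler_pXn2r ?nnegrE ?normc_ge0//.
  rewrite trapezoidE; apply: le_trans (normcD _ _) _; rewrite normcN.
  exact: (lerD (normc_ramp p kl) (normc_ramp p ij)).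
by move=> p pa; apply: trapezoid_out => /andP[/lt_trans/(_ pa)]; rewrite ltxx.
Qed.

Lemma trapezoid_mass : (k - j)%:R * sv l <= L2norm mu tr ^+ 2.
Proof.
apply: (@le_trans _ _ (\sum_(j <= n < k) edge_energy alpha tr (inr n))).
  apply: (@le_trans _ _ (\sum_(j <= n < k) sv l)).
    by rewrite sumr_const_nat -[leRHS]mulr_natl.
  apply: ler_sum_nat => n /andP[jn nk].
  have s2 := vertex_le alpha_gt0 jn; have s3 := vertex_le alpha_gt0 (ltnW nk).
  apply: (@le_trans _ _ (1 * len (inr n))); first by rewrite mul1r (le_trans (ltW slk)).
  apply: (edge_energy_lower alpha_gt0 (e := inr n) L2_trapezoid) => t _.
  by rewrite trapezoid_plateau ?normc1 ?expr1n//= s3 s2.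
apply: le_trans (edge_energy_sum k L2_trapezoid).
rewrite (big_cat_nat (leq0n _) jk)/= -[leLHS]add0r lerD//.
  by apply: sumr_ge0 => n _; rewrite addr_ge0 ?edge_energy_ge0.
by apply: ler_sum_nat => n _; rewrite lerDr edge_energy_ge0.
Qed.

(** A ramp of height 1 over a length L has energy at most 1 / L; the factors 2 come from
    [L2norm_quasi]. *)
Lemma trapezoid_slope_energy :
  L2norm mu tr' ^+ 2 <= 2 * (sv k - sv l)^-1 + 2 * (sv i - sv j)^-1.
Proof.
have E (c : R[i]) m n : (m < n)%N -> normc c = `|(sv m - sv n)^-1| ->
    L2norm mu (c *: slope alpha (sv n) (sv m)) ^+ 2 <= (sv m - sv n)^-1.
  move=> mn cE; have d0 : 0 < sv m - sv n by rewrite subr_gt0 vertex_lt.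
  rewrite L2normZ// cE ger0_norm ?invr_ge0 ?(ltW d0)// exprMn.
  apply: (@le_trans _ _ ((sv m - sv n)^-1 ^+ 2 * (sv m - sv n))).
    by rewrite ler_wpM2l ?sqr_ge0// L2norm_slope// ltnW.
  by rewrite expr2 -mulrA mulVf ?mulr1// gt_eqF.
apply: le_trans (L2norm_quasi (L2Z _ (Ls _ _)) (L2Z _ (Ls _ _))) _.
by apply: lerD; rewrite ler_wpM2l ?ler0n//; apply: E => //; rewrite ?normcN normc_real.
Qed.

End Trapezoid.

(* The plateau lies over the teeth 2M, ..., 3M. *)
Definition bump M := trapezoid M (2 * M) (3 * M) (4 * M).

Definition bump_slope M := trapezoid_slope M (2 * M) (3 * M) (4 * M).

Section Bump.
Variable M : nat.
Hypothesis M_gt0 : (0 < M)%N.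

Let lt12 : (M < 2 * M)%N. Proof. lia. Qed.
Let le23 : (2 * M <= 3 * M)%N. Proof. lia. Qed.
Let lt34 : (3 * M < 4 * M)%N. Proof. lia. Qed.

Lemma L2_bump : L2 mu (bump M). Proof. exact: L2_trapezoid. Qed.

Lemma L2_bump_slope : L2 mu (bump_slope M). Proof. exact: L2_trapezoid_slope. Qed.

Lemma bump_derivative : cder (bump M) (bump_slope M).
Proof. exact: trapezoid_derivative. Qed.

Lemma bump_out p : ~ (sv (4 * M) < p.1 < sv M) -> bump M p = 0 /\ bump_slope M p = 0.
Proof. by move=> h; split; [exact: trapezoid_out|exact: trapezoid_slope_out]. Qed.

Lemma bump_mass : M%:R * sv (4 * M) <= L2norm mu (bump M) ^+ 2.
Proof.
apply: le_trans (trapezoid_mass lt12 le23 lt34).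
by rewrite -mulnBl mul1n.
Qed.

(** Each of the two ramps extends over M gaps, hence over a length at least
    [alpha / 5 * sv (4 * M)]. *)
Lemma bump_slope_energy : L2norm mu (bump_slope M) ^+ 2 <= 4 * (5 / alpha) * (sv (4 * M))^-1.
Proof.
apply: le_trans (trapezoid_slope_energy lt12 lt34) _.
have g m n : n = (m + M)%N -> (n <= 4 * M)%N -> (sv m - sv n)^-1 <= 5 / alpha * (sv (4 * M))^-1.
  move=> -> mM; have gap := vertex_gap_lower M_gt0 mM.
  have a0 : 0 < alpha / 5 * sv (4 * M) by rewrite mulr_gt0 ?divr_gt0 ?vertex_gt0.
  rewrite -[5 / alpha]invf_div -invfM lef_pV2 ?posrE//.
  exact: lt_le_trans gap.
have g1 := g (3 * M)%N (4 * M)%N ltac:(lia) (leqnn _).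
have g2 := g M (2 * M)%N ltac:(lia) ltac:(lia).
have R4 (x y : R) : 4 * x * y = 2 * (x * y) + 2 * (x * y) by ring.
rewrite R4; exact: lerD (ler_wpM2l (ler0n R 2) g1) (ler_wpM2l (ler0n R 2) g2).
Qed.

(** With x = [sv (4 * M)], the energy is of order 1 / x and the mass at least M x;
    [vertex_mass_lower] gives 1 / x <= 5 M x. *)
Lemma bump_ratio : alpha <= 1 / 2 ->
  L2norm mu (bump_slope M) ^+ 2 <= 4 * (5 / alpha) * 5 * L2norm mu (bump M) ^+ 2.
Proof.
move=> a12; apply: le_trans bump_slope_energy _.
have c0 : 0 < 4 * (5 / alpha) by rewrite mulr_gt0 ?divr_gt0.
rewrite -[leRHS]mulrA ler_pM2l//.
have s0 := vertex_gt0 alpha (4 * M).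
apply: (@le_trans _ _ (5 * (M%:R * sv (4 * M)))); last by rewrite ler_pM2l// bump_mass.
rewrite -[leLHS]mul1r ler_pdivrMr//.
have := vertex_mass_lower a12 M_gt0; rewrite expr2.
by move: (sv (4 * M)) (M%:R : R) => x y; lra.
Qed.

Lemma bump_norm_gt0 : 0 < L2norm mu (bump M).
Proof.
rewrite lt_neqAle L2norm_ge0 andbT eq_sym -sqrf_eq0 gt_eqF//.
apply: lt_le_trans bump_mass; rewrite mulr_gt0 ?ltr0n//; exact: vertex_gt0.
Qed.

End Bump.

Lemma bumps_apart M N p : (0 < M)%N -> (4 * M <= N)%N ->
  ~ (sv (4 * M) < p.1 < sv M) \/ ~ (sv (4 * N) < p.1 < sv N).
Proof.
move=> M0 MN; have h := vertex_le alpha_gt0 MN.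
have [pl|pl] := leP p.1 (sv (4 * M)); [left|right] => /andP[p1 p2] //.
by have := lt_trans (lt_le_trans p2 h) pl; rewrite ltxx.
Qed.

Definition unit_bump n : plane R -> R[i] := (L2norm mu (bump (5 ^ n)))^-1%:C *: bump (5 ^ n).

Definition unit_bump_slope n : plane R -> R[i] :=
  (L2norm mu (bump (5 ^ n)))^-1%:C *: bump_slope (5 ^ n).

Let M0 n : (0 < 5 ^ n)%N. Proof. by rewrite expn_gt0. Qed.

Lemma unit_bump_apart m n p : m != n ->
  (unit_bump m p = 0 /\ unit_bump_slope m p = 0) \/
  (unit_bump n p = 0 /\ unit_bump_slope n p = 0).
Proof.
have Z k : ~ (sv (4 * 5 ^ k) < p.1 < sv (5 ^ k)) -> unit_bump k p = 0 /\ unit_bump_slope k p = 0.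
  move=> h; have [h1 h2] := bump_out (M0 k) h.
  by rewrite /unit_bump /unit_bump_slope !fctE h1 h2 scaler0; split.
wlog mn : m n / (m < n)%N.
  move=> h mn; have [l|l|e] := ltngtP m n; first exact: h l mn.
    by case: (h n m l _) => [|H|H]; [rewrite eq_sym|right|left].
  by rewrite e eqxx in mn.
(* A bump reaches from M to 4M, so powers of 5 leave room between consecutive ones. *)
move=> _; have le4 : (4 * 5 ^ m <= 5 ^ n)%N.
  apply: (@leq_trans (5 ^ m.+1)); first by rewrite expnS leq_mul2r orbT.
  by rewrite leq_exp2l.
by case: (bumps_apart p (M0 m) le4) => /Z; [left|right].
Qed.

Lemma L2_unit_bump_slope n : L2 mu (unit_bump_slope n).
Proof. exact/L2Z/L2_bump_slope. Qed.

Lemma unit_bump_derivative n : cder (unit_bump n) (unit_bump_slope n).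
Proof. by apply: comb_derivativeZ; [exact: L2_bump_slope|exact: bump_derivative]. Qed.

Lemma H1_unit_bump n : H1 alpha (unit_bump n).
Proof.
by apply: (H1I alpha_gt0 _ (L2_unit_bump_slope n) (unit_bump_derivative n)); exact/L2Z/L2_bump.
Qed.

Lemma L2norm_unit_bump n : L2norm mu (unit_bump n) = 1.
Proof.
have b0 := bump_norm_gt0 (M0 n).
rewrite L2normZ ?normc_real ?ger0_norm ?invr_ge0 ?ltW ?mulVf ?gt_eqF//.
exact: L2_bump.
Qed.

Lemma unit_bump_orthonormal : L2_orthonormal mu unit_bump.
Proof.
move=> m n; have [->|mn] := eqVneq m n; first by rewrite L2dot_self L2norm_unit_bump expr1n.
by apply: L2dot_disjoint => p; case: (unit_bump_apart p mn) => -[? _]; [left|right].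
Qed.

Lemma unit_bump_form m n : m != n -> dirichlet_form alpha (unit_bump m) (unit_bump n) = 0.
Proof.
move=> mn; rewrite (dirichlet_formE (H1_unit_bump m) (L2_unit_bump_slope m)
  (unit_bump_derivative m) (H1_unit_bump n) (L2_unit_bump_slope n) (unit_bump_derivative n)).
by apply: L2dot_disjoint => p; case: (unit_bump_apart p mn) => -[_ ?]; [left|right].
Qed.

Lemma H1norm_unit_bump n : alpha <= 1 / 2 ->
  H1norm alpha (unit_bump n) <= Num.sqrt (1 + 4 * (5 / alpha) * 5).
Proof.
move=> a12; have [Ld _] := H1_derivative (H1_unit_bump n).
have dE := comb_derivativeE (L2_unit_bump_slope n) (unit_bump_derivative n) (H1_unit_bump n).
rewrite /H1norm L2norm_unit_bump (L2norm_eq Ld (L2_unit_bump_slope n) dE) expr1n.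
apply: ler_wsqrtr; rewrite lerD2l L2normZ; last exact: L2_bump_slope.
have b0 := bump_norm_gt0 (M0 n).
rewrite normc_real ger0_norm ?invr_ge0 ?(ltW b0)// exprMn exprVn mulrC.
by rewrite ler_pdivrMr ?exprn_gt0//; exact: bump_ratio.
Qed.

End Bumps.

Theorem theorem3p4 (R : realType) (alpha : R) (alpha_gt0 : 0 < alpha) :
  let mu := comb_measure alpha in
  let HN := neumann_laplacian alpha in
  let V := [set comb_end R] `|` tips alpha in
  let HV := dirichlet_laplacian alpha V in
  [/\ 1 / 2 < alpha ->
        [/\ compactly_embedded mu (H1 alpha) (H1norm alpha),
            compact_resolvent mu HN & purely_discrete_spectrum mu HN],
      alpha <= 1 / 2 ->
        (exists f : nat -> plane R -> R[i],
           [/\ forall n, H1 alpha (f n), L2_orthonormal mu f &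
               exists M : R, forall n, H1norm alpha (f n) <= M]) /\
        essential_spectrum mu HN !=set0
    & [/\ compactly_embedded mu (H10 alpha V) (H1norm alpha),
          compact_resolvent mu HV & purely_discrete_spectrum mu HV]].
Proof.
move=> mu HN V HV; split=> [ha|ha|].
- have cH : compactly_embedded mu (H1 alpha) (H1norm alpha).
    apply: compactness_criterion => //; first exact: H1B.
    by move=> e e0; exact: H1_tail.
  have [|cr pd] := @compact_dirichlet_laplacian R alpha alpha_gt0 set0.
    by rewrite H10_set0.
  by rewrite /HN neumann_laplacianE.
- split.
    exists (unit_bump alpha); split; [exact: H1_unit_bump|exact: unit_bump_orthonormal|].
    by exists (Num.sqrt (1 + 4 * (5 / alpha) * 5)) => n; exact: H1norm_unit_bump.
  apply: (neumann_essential_spectrum alpha_gt0 (H1_unit_bump alpha_gt0)).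
  + exact: unit_bump_orthonormal.
  + exact: unit_bump_form.
  + by move=> n; exact: H1norm_unit_bump.
have cH : compactly_embedded mu (H10 alpha V) (H1norm alpha).
  apply: compactness_criterion => //; [exact: H10_H1|exact: H10B|].
  by move=> e e0; apply: tip_tail => // p tp; right.
by have [] := compact_dirichlet_laplacian alpha_gt0 cH.
Qed.
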